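(* Let $(\mathcal P_t)_{t\ge0}$ be a decohering QMS. Let $t\mapsto p(t)$ be a twice continuously differentiable increasing real function in a neighbourhood of $0$ with $p(0)=q\ge1$, and let $t\mapsto Y(t)\in\mathcal B(\mathcal H)$ be twice continuously differentiable with $Y(t)$ positive definite in a neighbourhood of $0$; set $Y=Y(0)$. Then $\frac{d}{dt}\|Y(t)\|_{(q,p(t)),\mathcal N}\Big|_{t=0}=\frac{p'(0)}{q\|Y\|^{q-1}_{q,\sigma_{\mathrm{Tr}}}}\Big(\mathrm{Ent}_{q,\mathcal N}(Y)+\frac{q}{p'(0)}\mathrm{Tr}\big[(\Gamma^{1/q}(Y))^{q-1}\Gamma^{1/q}(Y'(0))\big]\Big)$.
   Context: $\mathcal H$ finite-dimensional of dimension $d_{\mathcal H}$; $\|Y\|_p=(\mathrm{Tr}|Y|^p)^{1/p}$. QMS $\mathcal P_t$ (unital completely positive maps), decohering = has a full-rank invariant state; $\mathcal N$ its decoherence-free algebra ($X$ with $\mathcal P_t(X^*X)=\mathcal P_t(X)^*\mathcal P_t(X)$, $\mathcal P_t(XX^* )=\mathcal P_t(X)\mathcal P_t(X)^*$ for all $t$), $E_{\mathcal N}$ the unique conditional expectation onto $\mathcal N$ with $\mathcal P_t(X-E_{\mathcal N}[X])\to0$, $E_{\mathcal N*}$ its predual, $\sigma_{\mathrm{Tr}}=E_{\mathcal N*}(\mathbb I/d_{\mathcal H})$. $\Gamma^s(X)=\sigma_{\mathrm{Tr}}^{s/2}X\sigma_{\mathrm{Tr}}^{s/2}$, $\|X\|_{p,\sigma_{\mathrm{Tr}}}=\|\Gamma^{1/p}(X)\|_p$.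 Amalgamated norms: for $1\le a\le b\le\infty$, $1/r=1/a-1/b$: $\|X\|_{(a,b),\mathcal N}=\inf\{\|A\|_{2r,\sigma_{\mathrm{Tr}}}\|B\|_{2r,\sigma_{\mathrm{Tr}}}\|Y\|_{b,\sigma_{\mathrm{Tr}}}:A,B\in\mathcal N,X=AYB\}$ and $\|X\|_{(b,a),\mathcal N}=\sup_{A,B\in\mathcal N}\|AXB\|_{a,\sigma_{\mathrm{Tr}}}/(\|A\|_{2r,\sigma_{\mathrm{Tr}}}\|B\|_{2r,\sigma_{\mathrm{Tr}}})$. For $Y>0$, $Z=\Gamma^{1/q}(Y)$: $\mathrm{Ent}_{q,\mathcal N}(Y)=\frac1q\mathrm{Tr}[Z^q(\ln Z^q-\ln\sigma_{\mathrm{Tr}}-\ln E_{\mathcal N}[\sigma_{\mathrm{Tr}}^{-1/2}Z^q\sigma_{\mathrm{Tr}}^{-1/2}])]$. *)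

(* Defs.v *)
(* mathcomp + mathcomp-analysis + real_closed complex numbers. *)
From HB Require Import structures.
From mathcomp Require Import all_boot all_order all_algebra.
From mathcomp Require Import all_classical all_reals all_analysis.
From mathcomp Require Export complex spectral.
Set Implicit Arguments. Unset Strict Implicit. Unset Printing Implicit Defensive.
Import Order.TTheory GRing.Theory Num.Theory numFieldNormedType.Exports.
Local Open Scope ring_scope.
Local Open Scope classical_set_scope.

Section QMSDefs.
Variable R : realType.
Local Notation C := R[i].

(** conjugate transpose *)
Definition adjmx m k (A : 'M[C]_(m, k)) : 'M[C]_(k, m) :=
  map_mx (fun z : C => z^*) A^T.

(** Hermitian, positive semidefinite, positive definite matrices *)
Definition mxherm k (A : 'M[C]_k) : Prop := adjmx A = A.
Definition mxpsd k (A : 'M[C]_k) : Prop :=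
  mxherm A /\ forall v : 'rV[C]_k, 0 <= (v *m A *m adjmx v) 0 0.
Definition mxpd k (A : 'M[C]_k) : Prop :=
  mxherm A /\ forall v : 'rV[C]_k, v != 0 -> 0 < (v *m A *m adjmx v) 0 0.

(** functional calculus f(A) = U^* diag(f(lambda_i)) U for a Hermitian
    (normal) matrix A, using the spectral theorem of mathcomp's spectral.v *)
Definition mfun k (f : R -> R) (A : 'M[C]_k) : 'M[C]_k :=
  invmx (spectralmx A) *m
  diag_mx (map_mx (fun z : C => (f (complex.Re z))%:C%C) (spectral_diag A)) *m
  spectralmx A.

Definition mpow k (s : R) (A : 'M[C]_k) : 'M[C]_k := mfun (fun x => x `^ s) A.
Definition mlog k (A : 'M[C]_k) : 'M[C]_k := mfun (@ln R) A.

(** |Y| = (Y^* Y)^{1/2} *)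
Definition mabs k (Y : 'M[C]_k) : 'M[C]_k := mpow (2^-1) (adjmx Y *m Y).

(** real part of the trace *)
Definition retr k (A : 'M[C]_k) : R := complex.Re (\tr A).

(** Schatten norm ||Y||_p, parametrised by th = 1/p in [0,1]:
    (Tr |Y|^p)^(1/p) for p finite, and the operator norm
    (largest eigenvalue of |Y|) for p = oo, i.e. th = 0. *)
Definition schatten_inv k (th : R) (Y : 'M[C]_k) : R :=
  if th == 0 then \big[Num.max/0]_(i < k) complex.Re (spectral_diag (mabs Y) 0 i)
  else (retr (mpow (th^-1) (mabs Y))) `^ th.

(** Gamma^s_sigma(X) = sigma^{s/2} X sigma^{s/2} *)
Definition Gammas k (sigma : 'M[C]_k) (s : R) (X : 'M[C]_k) : 'M[C]_k :=
  mpow (s / 2) sigma *m X *m mpow (s / 2) sigma.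

(** weighted norm ||X||_{p,sigma} = ||Gamma^{1/p}(X)||_p, with th = 1/p *)
Definition wnorm_inv k (sigma : 'M[C]_k) (th : R) (X : 'M[C]_k) : R :=
  schatten_inv th (Gammas sigma th X).

(** amalgamated norm ||X||_{(a,b),N} for 1 <= a <= b, 1/r = 1/a - 1/b
    (norms of A, B are ||.||_{2r,sigma}, i.e. th = (1/a - 1/b)/2) *)
Definition amalg_inf k (N : set 'M[C]_k) (sigma : 'M[C]_k) (a b : R)
    (X : 'M[C]_k) : R :=
  inf [set v : R | exists A B Y : 'M[C]_k,
        [/\ N A, N B, X = A *m Y *m B &
            v = wnorm_inv sigma ((a^-1 - b^-1) / 2) A
                * wnorm_inv sigma ((a^-1 - b^-1) / 2) B
                * wnorm_inv sigma (b^-1) Y]].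

(** amalgamated norm ||X||_{(b,a),N} for 1 <= a <= b (note the order of
    the arguments: first b, then a) *)
Definition amalg_sup k (N : set 'M[C]_k) (sigma : 'M[C]_k) (b a : R)
    (X : 'M[C]_k) : R :=
  sup [set v : R | exists A B : 'M[C]_k,
        [/\ N A, N B, A != 0, B != 0 &
            v = wnorm_inv sigma (a^-1) (A *m X *m B)
                / (wnorm_inv sigma ((a^-1 - b^-1) / 2) A
                   * wnorm_inv sigma ((a^-1 - b^-1) / 2) B)]].

(** ||X||_{(x,y),N} for arbitrary x, y >= 1: the first form if x <= y,
    the second form (with b = x, a = y) if x > y *)
Definition amalg k (N : set 'M[C]_k) (sigma : 'M[C]_k) (x y : R)
    (X : 'M[C]_k) : R :=
  if x <= y then amalg_inf N sigma x y X else amalg_sup N sigma x y X.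

(** complete positivity: id_m (x) f preserves positivity for every m *)
Definition completely_positive k (f : 'M[C]_k -> 'M[C]_k) : Prop :=
  forall (m : nat) (X : 'I_m -> 'I_m -> 'M[C]_k),
    mxpsd (\mxblock_(i < m, j < m) X i j) ->
    mxpsd (\mxblock_(i < m, j < m) f (X i j)).

Definition mx_linear k (f : 'M[C]_k -> 'M[C]_k) : Prop :=
  forall (c : C) (X Y : 'M[C]_k), f (c *: X + Y) = c *: f X + f Y.

(** quantum Markov semigroup (P_t)_{t >= 0} of unital completely positive
    maps on B(H) = 'M[C]_k, right-continuous at t = 0 *)
Definition is_QMS k (P : R -> 'M[C]_k -> 'M[C]_k) : Prop :=
  (forall t, 0 <= t -> mx_linear (P t)) /\
  (forall t, 0 <= t -> P t 1%:M = 1%:M) /\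
  (forall t, 0 <= t -> completely_positive (P t)) /\
  (forall X, P 0 X = X) /\
  (forall s t X, 0 <= s -> 0 <= t -> P (s + t) X = P s (P t X)) /\
  (forall X i j,
     (complex.Re (P x X i j) @[x --> 0^'+] --> complex.Re (X i j)) /\
     (complex.Im (P x X i j) @[x --> 0^'+] --> complex.Im (X i j))).

(** decohering: there is a full-rank (faithful) invariant state *)
Definition decohering k (P : R -> 'M[C]_k -> 'M[C]_k) : Prop :=
  exists rho : 'M[C]_k,
    [/\ mxpd rho, \tr rho = 1 &
        forall t X, 0 <= t -> \tr (rho *m P t X) = \tr (rho *m X)].

(** decoherence-free algebra N(P) *)
Definition dfa k (P : R -> 'M[C]_k -> 'M[C]_k) : set 'M[C]_k :=
  [set X | forall t, 0 <= t ->
     P t (adjmx X *m X) = adjmx (P t X) *m P t X /\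
     P t (X *m adjmx X) = P t X *m adjmx (P t X)].

(** E is a conditional expectation onto N(P) with P_t(X - E[X]) -> 0 *)
Definition is_dfa_cond_exp k (P : R -> 'M[C]_k -> 'M[C]_k)
    (E : 'M[C]_k -> 'M[C]_k) : Prop :=
  mx_linear E /\
  (forall X, dfa P (E X)) /\
  (forall X, dfa P X -> E X = X) /\
  completely_positive E /\
  (forall A B X, dfa P A -> dfa P B -> E (A *m X *m B) = A *m E X *m B) /\
  (forall X i j,
     (complex.Re (P x (X - E X) i j) @[x --> +oo] --> 0) /\
     (complex.Im (P x (X - E X) i j) @[x --> +oo] --> 0)).

(** sigma = E_* (I / d), characterised by duality Tr(sigma X) = Tr(E[X]) / d *)
Definition is_sigma_Tr k (E : 'M[C]_k -> 'M[C]_k) (sigma : 'M[C]_k) : Prop :=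
  forall X, \tr (sigma *m X) = \tr (E X) / k%:R.

(** Ent_{q,N}(Y) *)
Definition Ent_q k (E : 'M[C]_k -> 'M[C]_k) (sigma : 'M[C]_k) (q : R)
    (Y : 'M[C]_k) : R :=
  let Z := Gammas sigma (q^-1) Y in
  let Zq := mpow q Z in
  q^-1 * retr (Zq *m (mlog Zq - mlog sigma
                      - mlog (E (mpow (- 2^-1) sigma *m Zq *m mpow (- 2^-1) sigma)))).

(** f is C^2 on the open interval (-e, e) *)
Definition C2_near (e : R) (f : R -> R) : Prop :=
  forall t, `|t| < e ->
    [/\ derivable f t 1, derivable f^`() t 1 & {for t, continuous f^`()^`()}].

(** entrywise derivative at 0 of a matrix-valued function *)
Definition mderiv0 k (Y : R -> 'M[C]_k) : 'M[C]_k :=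
  \matrix_(i, j) Complex ((fun t => complex.Re (Y t i j))^`() 0)
                         ((fun t => complex.Im (Y t i j))^`() 0).

End QMSDefs.

(* Main.v *)
(**
  Put Z_t = Gamma^{1/p(t)}(Y(t)), s = 1/q - 1/p(t), W = Z_0^q and Q = tr W.
  Polar decomposition of the two factors A, B in N rewrites the p-th power of
  each competitor of the infimum (t > 0) or of the supremum (t < 0) as
  F(a, b) = tr (a^{-s/2} Z_t b^{-s} Z_t a^{-s/2})^{p/2} with a, b in N positive
  and tr (sigma a) = tr (sigma b) = 1. Adding a small multiple eta of the
  identity keeps the spectra of a and b in a compact subset of the positive
  axis, at the price of changing the constraint to 1 + eta, and then
    F(a, b) = Q + t (h - (p'(0) / 2q) tr W (ln a + ln b)) + o(t)
  uniformly in a and b. By Klein's inequality tr (W ln a) is maximal, up to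
  Q eta, at a_0 = E(sigma^{-1/2} W sigma^{-1/2}) / Q, and a = b = a_0 is itself
  admissible. So the p(t)-th power of the amalgamated norm has derivative
  h - (p'(0) / q) tr (W ln a_0) at 0; taking the p(t)-th root gives the formula.
*)
Require Import Defs.
From HB Require Import structures.
From mathcomp Require Import all_boot all_order all_algebra.
From mathcomp Require Import all_classical all_reals all_analysis.
From mathcomp Require Import complex spectral ring lra.
Import Order.TTheory GRing.Theory Num.Theory numFieldNormedType.Exports.
Local Open Scope ring_scope.
Local Open Scope classical_set_scope.
Local Open Scope sesquilinear_scope.
Set Implicit Arguments. Unset Strict Implicit. Unset Printing Implicit Defensive.

(* Abstract, rather than R[i] itself: over the concrete field, failing unifications
   of matrix expressions unfold down to the coordinates of the entries. *)
Record complexification (R : realType) := Complexification {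
  cfield :> numClosedFieldType;
  embed : {rmorphism R -> cfield};
  re : cfield -> R;
  embedK : cancel embed re;
  embed_re : forall z, embed (re z) = 'Re z }.
Arguments re {R c} z.
Arguments embedK {R} c x.
Arguments embed_re {R c} z.

Section ComplexificationTheory.
Variables (R : realType) (C : complexification R).
Local Notation "x %:C" := (embed C x) : ring_scope.
Implicit Types (x y : R) (z w : C).

Lemma re_is_additive : additive (@re R C).
Proof. by move=> z w; apply: (fmorph_inj (embed C)); rewrite rmorphB !embed_re raddfB. Qed.

HB.instance Definition _ := GRing.isAdditive.Build C R re re_is_additive.

Lemma embed_real x : x%:C \is Num.real.
Proof. by rewrite -(embedK C x) embed_re Creal_Re. Qed.

Lemma conj_embed x : x%:C^* = x%:C.
Proof. exact/CrealP/embed_real. Qed.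

Lemma re_realK z : z \is Num.real -> (re z)%:C = z.
Proof. by rewrite embed_re => /Creal_ReP. Qed.

Lemma re_mulr x z : re (x%:C * z) = x * re z.
Proof.
by apply: (fmorph_inj (embed C)); rewrite rmorphM !embed_re ReMl ?embed_real.
Qed.

Lemma embed_ge0 x : (0 <= x%:C) = (0 <= x).
Proof.
have sqr y : 0 <= y -> 0 <= y%:C.
  by move=> y0; rewrite -(sqr_sqrtr y0) rmorphXn -realEsqr embed_real.
apply/idP/idP => [xC0|/sqr //]; rewrite leNgt; apply/negP => x0.
have := sqr (- x); rewrite rmorphN !oppr_ge0 => /(_ (ltW x0)) xC0'.
have /eqP : x%:C = 0 by apply/le_anti/andP.
by rewrite fmorph_eq0 lt_eqF.
Qed.

Lemma embed_gt0 x : (0 < x%:C) = (0 < x).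
Proof. by rewrite !lt_def fmorph_eq0 embed_ge0. Qed.

Lemma re_ge0 z : 0 <= z -> 0 <= re z.
Proof. by move=> z0; rewrite -embed_ge0 re_realK // ger0_real. Qed.

Lemma re_norm_ge0 z : 0 <= re `|z|.
Proof. exact/re_ge0/normr_ge0. Qed.

Lemma embed_norm z : (re `|z|)%:C = `|z|.
Proof. by rewrite re_realK // normr_real. Qed.

End ComplexificationTheory.

(** * Definite matrices *)
Section Adjoint.
Variable C : numClosedFieldType.

Lemma trmxC_mul m n p (A : 'M[C]_(m, n)) (B : 'M[C]_(n, p)) :
  (A *m B)^t* = B^t* *m A^t*.
Proof. by rewrite trmx_mul map_mxM. Qed.

Lemma trmxCD m n (A B : 'M[C]_(m, n)) : (A + B)^t* = A^t* + B^t*.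
Proof. by rewrite linearD map_mxD. Qed.

Lemma trmxCB m n (A B : 'M[C]_(m, n)) : (A - B)^t* = A^t* - B^t*.
Proof. by rewrite linearB map_mxB. Qed.

Lemma trmxCZ m n c (A : 'M[C]_(m, n)) : (c *: A)^t* = c^* *: A^t*.
Proof. by rewrite linearZ map_mxZ. Qed.

Lemma trmxC1 n : (1%:M : 'M[C]_n)^t* = 1%:M.
Proof. by rewrite trmx1 map_mx1. Qed.

Lemma unitmx_trmxC n (A : 'M[C]_n) : (A^t* \in unitmx) = (A \in unitmx).
Proof. by rewrite map_unitmx unitmx_tr. Qed.

Lemma mxtrace_trmxC n (A : 'M[C]_n) : \tr (A^t*) = (\tr A)^*.
Proof. by rewrite trace_map_mx mxtrace_tr. Qed.

Lemma mulmx_trmxC00 n (v : 'rV[C]_n) : (v *m v^t*) 0 0 = \sum_i `|v 0 i| ^+ 2.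
Proof. by rewrite mxE; apply: eq_bigr => i _; rewrite !mxE normCK. Qed.

Lemma trmxC_mul_eq0 m n (A : 'M[C]_(m, n)) : A^t* *m A = 0 -> A = 0.
Proof.
move=> AA0; apply/matrixP => i j; rewrite [RHS]mxE.
move/matrixP/(_ j j): AA0; rewrite [RHS]mxE mxE => /eqP.
rewrite psumr_eq0 => [/allP/(_ i (mem_index_enum i))|l _]; last first.
  by rewrite !mxE mulrC -normCK exprn_ge0.
by rewrite !mxE mulf_eq0 conjC_eq0 orbb => /eqP.
Qed.

Definition hermmx n (A : 'M[C]_n) : Prop := A^t* = A.

Definition psdmx n (A : 'M[C]_n) : Prop :=
  hermmx A /\ forall v : 'rV[C]_n, 0 <= (v *m A *m v^t*) 0 0.

Definition pdmx n (A : 'M[C]_n) : Prop :=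
  hermmx A /\ forall v : 'rV[C]_n, v != 0 -> 0 < (v *m A *m v^t*) 0 0.

Lemma psdmx_herm n (A : 'M[C]_n) : psdmx A -> hermmx A. Proof. by case. Qed.

Lemma pdmx_herm n (A : 'M[C]_n) : pdmx A -> hermmx A. Proof. by case. Qed.

Lemma hermmx_congr m n (A : 'M[C]_n) (X : 'M[C]_(m, n)) :
  hermmx A -> hermmx (X *m A *m X^t*).
Proof. by move=> hA; rewrite /hermmx !trmxC_mul trmxCK hA mulmxA. Qed.

Lemma hermmxB n (A B : 'M[C]_n) :
  hermmx A -> hermmx B -> hermmx (A - B).
Proof. by move=> hA hB; rewrite /hermmx trmxCB hA hB. Qed.

Lemma psdmx_congr m n (A : 'M[C]_n) (X : 'M[C]_(m, n)) :
  psdmx A -> psdmx (X *m A *m X^t*).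
Proof.
move=> [hA psdA]; split; first exact: hermmx_congr.
by move=> v; have := psdA (v *m X); rewrite trmxC_mul !mulmxA.
Qed.

Lemma pdmx_congr n (A X : 'M[C]_n) :
  X \in unitmx -> pdmx A -> pdmx (X *m A *m X^t*).
Proof.
move=> uX [hA pdA]; split; first exact: hermmx_congr.
move=> v v0; have := pdA (v *m X); rewrite trmxC_mul !mulmxA; apply.
by apply: contra_neq v0 => /(congr1 (mulmx^~ (invmx X))); rewrite mul0mx mulmxK.
Qed.

Lemma psdmx0 n : psdmx (0 : 'M[C]_n).
Proof.
split=> [|v]; first by rewrite /hermmx trmx0 map_mx0.
by rewrite mulmx0 mul0mx mxE.
Qed.

Lemma psdmx1 n : psdmx (1%:M : 'M[C]_n).
Proof.
split=> [|v]; first exact: trmxC1.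
by rewrite mulmx1 mulmx_trmxC00 sumr_ge0 // => i _; rewrite exprn_ge0.
Qed.

Lemma psdmx_mulmx_trmxC m n (X : 'M[C]_(m, n)) : psdmx (X *m X^t*).
Proof. by rewrite -{1}[X]mulmx1; exact/psdmx_congr/psdmx1. Qed.

Lemma psdmx_trmxC_mulmx m n (X : 'M[C]_(m, n)) : psdmx (X^t* *m X).
Proof. by have := psdmx_mulmx_trmxC (X^t*); rewrite trmxCK. Qed.

Lemma psdmxD n (A B : 'M[C]_n) : psdmx A -> psdmx B -> psdmx (A + B).
Proof.
move=> [hA psdA] [hB psdB]; split; first by rewrite /hermmx trmxCD hA hB.
by move=> v; rewrite mulmxDr mulmxDl mxE addr_ge0.
Qed.

Lemma psdmx_tr_ge0 n (A : 'M[C]_n) : psdmx A -> 0 <= \tr A.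
Proof.
move=> [_ psdA]; apply: sumr_ge0 => i _; have := psdA (delta_mx 0 i).
by rewrite -rowE trmx_delta map_delta_mx -colE !mxE.
Qed.

Lemma mxtrace_rank1 n (A : 'M[C]_n) (v : 'rV[C]_n) :
  \tr (A *m (v^t* *m v)) = (v *m A *m v^t*) 0 0.
Proof. by rewrite mulmxA mxtrace_mulC mulmxA /mxtrace big_ord1. Qed.

End Adjoint.

Lemma unitmx_neq0 (F : fieldType) n (A : 'M[F]_n) :
  (0 < n)%N -> A \in unitmx -> A != 0.
Proof.
move=> n0; apply: contraTneq => ->; apply/negP => /mxrank_unit; rewrite mxrank0 => n0'.
by rewrite -n0' in n0.
Qed.

Lemma mxtrace_inj (F : comNzRingType) n (A B : 'M[F]_n) :
  (forall X, \tr (A *m X) = \tr (B *m X)) -> A = B.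
Proof.
have trE (M : 'M[F]_n) i j : \tr (M *m delta_mx j i) = M i j.
  rewrite -(mul_delta_mx (0 : 'I_1)) mulmxA mxtrace_mulC mulmxA -rowE -colE.
  by rewrite /mxtrace big_ord1 !mxE.
by move=> trAB; apply/matrixP => i j; rewrite -!trE.
Qed.

Local Notation "A \preceq B" := (psdmx (B - A))
  (at level 70, no associativity) : ring_scope.

Section Loewner.
Variable C : numClosedFieldType.

Lemma loewner_congr m n (A B : 'M[C]_n) (X : 'M[C]_(m, n)) :
  A \preceq B -> X *m A *m X^t* \preceq X *m B *m X^t*.
Proof. by move=> /(psdmx_congr X); rewrite mulmxBr mulmxBl. Qed.

Lemma psdmx_le n (A B : 'M[C]_n) : psdmx A -> A \preceq B -> psdmx B.
Proof. by move=> pA AB; have := psdmxD AB pA; rewrite subrK. Qed.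

End Loewner.

Section SimilarToDiagonal.
Variables (F : fieldType) (n : nat).
Implicit Types (V W X : 'M[F]_n) (d l : 'I_n -> F).

Definition simdiag V d : 'M[F]_n := invmx V *m diag_mx (\row_i d i) *m V.

Lemma simdiag_intertwineP V W X d l : V \in unitmx -> W \in unitmx ->
  simdiag V d *m X = X *m simdiag W l <->
  forall i j, (V *m X *m invmx W) i j * d i = (V *m X *m invmx W) i j * l j.
Proof.
move=> uV uW; rewrite /simdiag; set M := V *m X *m invmx W.
have XE : X = invmx V *m M *m W by rewrite /M !mulmxA mulVmx // mul1mx mulmxKV.
transitivity (diag_mx (\row_i d i) *m M = M *m diag_mx (\row_i l i)).
  split=> [/(congr1 (fun T => V *m T *m invmx W))|dM].
    by rewrite /M !mulmxA mulmxV // mul1mx mulmxK.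
  clearbody M; rewrite XE !mulmxA !mulmxK //; congr (_ *m W).
  by rewrite -[LHS]mulmxA dM mulmxA.
clearbody M; split=> [dM i j|dM].
  by move/matrixP/(_ i j): dM; rewrite mul_diag_mx mul_mx_diag 4!mxE mulrC.
by apply/matrixP => i j; rewrite mul_diag_mx mul_mx_diag 4!mxE mulrC.
Qed.

Lemma simdiag_intertwine V W X d l d' l' : V \in unitmx -> W \in unitmx ->
  (forall i j, d i = l j -> d' i = l' j) ->
  simdiag V d *m X = X *m simdiag W l -> simdiag V d' *m X = X *m simdiag W l'.
Proof.
move=> uV uW dl /(simdiag_intertwineP _ _ _ uV uW) dM.
apply/(simdiag_intertwineP _ _ _ uV uW) => i j; have := dM i j.
have [->|M0] := eqVneq ((V *m X *m invmx W) i j) 0; first by rewrite !mul0r.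
by move=> /(mulfI M0)/dl ->.
Qed.

Lemma unitmx_row_neq0 V i : V \in unitmx -> exists j, V i j != 0.
Proof.
move=> uV; apply/existsP; rewrite -negb_forall; apply/negP => /forallP Vi0.
have := mulmxV uV => /matrixP/(_ i i); rewrite !mxE eqxx big1 => [/eqP|j _].
  by rewrite eq_sym oner_eq0.
by rewrite (eqP (Vi0 j)) mul0r.
Qed.

Lemma simdiag_eq V W d l : V \in unitmx -> W \in unitmx ->
  simdiag V d = simdiag W l -> forall i, exists j, d i = l j.
Proof.
move=> uV uW dl i.
have /(simdiag_intertwineP _ _ _ uV uW) : simdiag V d *m 1%:M = 1%:M *m simdiag W l.
  by rewrite mulmx1 mul1mx.
rewrite mulmx1 => VW.
have [|j VWj] := @unitmx_row_neq0 (V *m invmx W) i.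
  by rewrite unitmx_mul uV unitmx_inv.
by exists j; exact: mulfI VWj _ _ (VW i j).
Qed.

Lemma simdiagM V d l : V \in unitmx ->
  simdiag V d *m simdiag V l = simdiag V (fun i => d i * l i).
Proof.
move=> uV; rewrite /simdiag !mulmxA mulmxK //; congr (_ *m V).
rewrite -[LHS]mulmxA mulmx_diag; congr (_ *m diag_mx _).
by apply/matrixP => i j; rewrite !mxE.
Qed.

Lemma simdiagD V d l : simdiag V d + simdiag V l = simdiag V (fun i => d i + l i).
Proof.
rewrite /simdiag -mulmxDl -mulmxDr -raddfD /=; congr (_ *m diag_mx _ *m _).
by apply/matrixP => i j; rewrite !mxE.
Qed.

Lemma simdiagZ V c d : c *: simdiag V d = simdiag V (fun i => c * d i).
Proof.
rewrite /simdiag scalemxAl scalemxAr; congr (_ *m _ *m _).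
by apply/matrixP => i j; rewrite !mxE mulrnAr.
Qed.

Lemma simdiag_const V c : V \in unitmx -> simdiag V (fun=> c) = c%:M.
Proof.
move=> uV; rewrite /simdiag (_ : diag_mx _ = c%:M).
  by rewrite mul_mx_scalar -scalemxAl mulVmx // scalemx1.
by apply/matrixP => i j; rewrite !mxE.
Qed.

Lemma tr_simdiag V d : V \in unitmx -> \tr (simdiag V d) = \sum_i d i.
Proof.
move=> uV; rewrite /simdiag -mulmxA mxtrace_mulC mulmxK // mxtrace_diag.
by apply: eq_bigr => i _; rewrite mxE.
Qed.

Lemma unitmx_simdiag V d : V \in unitmx ->
  (simdiag V d \in unitmx) = [forall i, d i != 0].
Proof.
move=> uV; rewrite /simdiag !unitmx_mul unitmx_inv !uV andbT /=.
rewrite unitmxE det_diag unitfE; apply/prodf_neq0/forallP => d0 i; have := d0 i.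
  by rewrite mxE; apply.
by rewrite mxE.
Qed.

Lemma row_mul_simdiag V d i : V \in unitmx ->
  row i V *m simdiag V d = d i *: row i V.
Proof.
move=> uV; rewrite /simdiag -row_mul !mulmxA mulmxV // mul1mx row_mul.
by rewrite row_diag_mx -scalemxAl -rowE mxE.
Qed.

End SimilarToDiagonal.

(** * Functional calculus *)

(* Locked, because comparing the unfoldings of [mxfun f A] and [mxfun g B] is
   prohibitively expensive for unification. *)
HB.lock Definition mxfun (R : realType) (C : complexification R) n
    (f : R -> R) (A : 'M[C]_n) : 'M[C]_n :=
  invmx (spectralmx A) *m
  diag_mx (map_mx (fun z : C => embed C (f (re z))) (spectral_diag A)) *m
  spectralmx A.

Section FunctionalCalculus.
Variables (R : realType) (C : complexification R).
Local Notation "x %:C" := (embed C x) : ring_scope.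
Implicit Types (f g : R -> R) (x c m : R).

Definition trR n (A : 'M[C]_n) : R := re (\tr A).

Definition eig n (A : 'M[C]_n) (i : 'I_n) : R := re (spectral_diag A 0 i).

Definition realdiag n (V : 'M[C]_n) (d : 'I_n -> R) : 'M[C]_n :=
  simdiag V (fun i => (d i)%:C).

Section Trace.
Variable n : nat.
Implicit Types A B : 'M[C]_n.

Lemma trRD A B : trR (A + B) = trR A + trR B.
Proof. by rewrite /trR mxtraceD raddfD. Qed.

Lemma trRN A : trR (- A) = - trR A.
Proof. by rewrite /trR !raddfN. Qed.

Lemma trRB A B : trR (A - B) = trR A - trR B.
Proof. by rewrite trRD trRN. Qed.

Lemma trRZ c A : trR (c%:C *: A) = c * trR A.
Proof. by rewrite /trR mxtraceZ re_mulr. Qed.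

Lemma trRC A B : trR (A *m B) = trR (B *m A).
Proof. by rewrite /trR mxtrace_mulC. Qed.

End Trace.

Section RealDiagonal.
Variable n : nat.
Implicit Types (V W X : 'M[C]_n) (d l : 'I_n -> R).

Lemma eq_realdiag V d l : d =1 l -> realdiag V d = realdiag V l.
Proof. by move=> /funext ->. Qed.

Lemma realdiag_intertwine V W X d l f : V \in unitmx -> W \in unitmx ->
  realdiag V d *m X = X *m realdiag W l ->
  realdiag V (f \o d) *m X = X *m realdiag W (f \o l).
Proof.
by move=> uV uW; apply: simdiag_intertwine => // i j /fmorph_inj /= ->.
Qed.

Lemma realdiagM V d l : V \in unitmx ->
  realdiag V d *m realdiag V l = realdiag V (fun i => d i * l i).
Proof.
move=> uV; rewrite /realdiag simdiagM //; congr simdiag.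
by apply/funext => i; rewrite rmorphM.
Qed.

Lemma realdiagD V d l :
  realdiag V d + realdiag V l = realdiag V (fun i => d i + l i).
Proof.
by rewrite /realdiag simdiagD; congr simdiag; apply/funext => i; rewrite rmorphD.
Qed.

Lemma realdiagZ V c d : c%:C *: realdiag V d = realdiag V (fun i => c * d i).
Proof.
by rewrite /realdiag simdiagZ; congr simdiag; apply/funext => i; rewrite rmorphM.
Qed.

Lemma trR_realdiag V d : V \in unitmx -> trR (realdiag V d) = \sum_i d i.
Proof.
move=> uV; rewrite /trR tr_simdiag // raddf_sum.
by apply: eq_bigr => i _ /=; rewrite embedK.
Qed.

End RealDiagonal.

Lemma mxfunE n f (A : 'M[C]_n) : mxfun f A = realdiag (spectralmx A) (f \o eig A).
Proof.
rewrite mxfun.unlock /realdiag /simdiag; congr (_ *m diag_mx _ *m _).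
by apply/rowP => j; rewrite !mxE.
Qed.

Lemma spectralmx_trmxC n (A : 'M[C]_n) : (spectralmx A)^t* = invmx (spectralmx A).
Proof. by rewrite (invmx_unitary (spectral_unitarymx A)). Qed.

Lemma hermmx_spectral n (A : 'M[C]_n) :
  hermmx A -> A = realdiag (spectralmx A) (eig A).
Proof.
move=> hA; have hsA : A \is hermsymmx.
  by apply/is_hermitianmxP; rewrite expr0 scale1r; apply/esym.
rewrite {1}(orthomx_spectralP (hermitian_normalmx hsA)) /realdiag /simdiag.
congr (_ *m diag_mx _ *m _); apply/rowP => j; rewrite mxE re_realK //.
by have /hermitian_spectral_diag_real/mxOverP := hsA.
Qed.

Lemma mxfun_realdiag n f (A V : 'M[C]_n) d : hermmx A -> V \in unitmx ->
  A = realdiag V d -> mxfun f A = realdiag V (f \o d).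
Proof.
move=> hA uV AV; rewrite mxfunE -[LHS]mulmx1 -[RHS]mul1mx.
apply: realdiag_intertwine => //; first exact: spectral_unit.
by rewrite -AV -hermmx_spectral // mulmx1 mul1mx.
Qed.

Lemma mxfun_intertwine n f (A B X : 'M[C]_n) : hermmx A -> hermmx B ->
  A *m X = X *m B -> mxfun f A *m X = X *m mxfun f B.
Proof.
move=> hA hB; rewrite {1}(hermmx_spectral hA) {1}(hermmx_spectral hB) !mxfunE.
by apply: realdiag_intertwine; apply: spectral_unit.
Qed.

Lemma mxfun_comm n f (A X : 'M[C]_n) : hermmx A ->
  A *m X = X *m A -> mxfun f A *m X = X *m mxfun f A.
Proof. by move=> hA; apply: mxfun_intertwine. Qed.

Section Algebra.
Variable n : nat.
Implicit Types A B : 'M[C]_n.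

Lemma mxfun_id A : hermmx A -> mxfun id A = A.
Proof. by move=> hA; rewrite mxfunE [RHS]hermmx_spectral. Qed.

Lemma eq_mxfun f g A : (forall i, f (eig A i) = g (eig A i)) -> mxfun f A = mxfun g A.
Proof. by move=> fg; rewrite !mxfunE; apply: eq_realdiag. Qed.

Lemma mxfunM f g A : mxfun f A *m mxfun g A = mxfun (fun x => f x * g x) A.
Proof. by rewrite !mxfunE realdiagM // spectral_unit. Qed.

Lemma mxfunD f g A : mxfun f A + mxfun g A = mxfun (fun x => f x + g x) A.
Proof. by rewrite !mxfunE realdiagD. Qed.

Lemma mxfunZ c f A : c%:C *: mxfun f A = mxfun (fun x => c * f x) A.
Proof. by rewrite !mxfunE realdiagZ. Qed.

Lemma mxfunN f A : - mxfun f A = mxfun (fun x => - f x) A.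
Proof.
rewrite -scaleN1r -(rmorph1 (embed C)) -rmorphN mxfunZ.
by apply: eq_mxfun => i; rewrite mulN1r.
Qed.

Lemma mxfunB f g A : mxfun f A - mxfun g A = mxfun (fun x => f x - g x) A.
Proof. by rewrite mxfunN mxfunD. Qed.

Lemma mxfun_const c A : mxfun (fun=> c) A = c%:C%:M.
Proof. by rewrite mxfunE -(simdiag_const _ (spectral_unit A)). Qed.

Lemma mxfun1 A : mxfun (fun=> 1) A = 1%:M.
Proof. by rewrite mxfun_const rmorph1. Qed.

Lemma mxfun0 A : mxfun (fun=> 0) A = 0.
Proof. by rewrite mxfun_const rmorph0 raddf0. Qed.

Lemma mxfun_herm f A : hermmx (mxfun f A).
Proof.
rewrite mxfunE /realdiag /simdiag -spectralmx_trmxC /hermmx !trmxC_mul trmxCK.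
rewrite mulmxA tr_diag_mx map_diag_mx; congr (_ *m diag_mx _ *m _).
by apply/rowP => i; rewrite !mxE; exact: conj_embed.
Qed.

Lemma mxfun_comp f g A : mxfun f (mxfun g A) = mxfun (f \o g) A.
Proof.
by rewrite (mxfun_realdiag f (mxfun_herm g A) (spectral_unit A) (mxfunE g A)) mxfunE.
Qed.

Lemma trR_mxfun f A : trR (mxfun f A) = \sum_i f (eig A i).
Proof. by rewrite mxfunE trR_realdiag // spectral_unit. Qed.

Lemma trR_hermmx A : hermmx A -> trR A = \sum_i eig A i.
Proof. by move=> hA; rewrite -{1}(mxfun_id hA) trR_mxfun. Qed.

Lemma realdiag_eig A V d i : hermmx A -> V \in unitmx ->
  A = simdiag V d -> exists j, d i = (eig A j)%:C.
Proof.
move=> hA uV; rewrite {1}(hermmx_spectral hA) => /esym/simdiag_eq; apply => //.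
exact: spectral_unit.
Qed.

End Algebra.

Section Spectrum.
Variable n : nat.
Implicit Types A B : 'M[C]_n.

Definition eigrow A i : 'rV[C]_n := row i (spectralmx A).

Lemma eigrow_unit A i : eigrow A i *m (eigrow A i)^t* = 1%:M.
Proof.
apply/matrixP => a b; rewrite !ord1 !mxE.
have /unitarymxP/matrixP/(_ i i) := spectral_unitarymx A.
rewrite [LHS]mxE [X in _ = X]mxE eqxx => <-.
by apply: eq_bigr => j _; rewrite !mxE.
Qed.

Lemma eigrow_neq0 A i : eigrow A i != 0.
Proof.
apply/eqP => e0; have := eigrow_unit A i; rewrite e0 mul0mx => /matrixP/(_ 0 0).
by rewrite !mxE eqxx /= => /eqP; rewrite eq_sym oner_eq0.
Qed.

Lemma eigrow_mxfun f A i : eigrow A i *m mxfun f A = (f (eig A i))%:C *: eigrow A i.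
Proof. by rewrite mxfunE /eigrow row_mul_simdiag // spectral_unit. Qed.

Lemma eigrow_mxfun_form f A i :
  (eigrow A i *m mxfun f A *m (eigrow A i)^t*) 0 0 = (f (eig A i))%:C.
Proof. by rewrite eigrow_mxfun -scalemxAl eigrow_unit !mxE mulr1. Qed.

Lemma mxfun_form f A (v : 'rV[C]_n) : (v *m mxfun f A *m v^t*) 0 0 =
  \sum_i (f (eig A i))%:C * `|(v *m (spectralmx A)^t*) 0 i| ^+ 2.
Proof.
rewrite mxfunE /realdiag /simdiag -spectralmx_trmxC.
set U := spectralmx A; set D := diag_mx _; set w := v *m U^t*.
have -> : v *m (U^t* *m D *m U) *m v^t* = w *m D *m w^t*.
  by rewrite /w trmxC_mul trmxCK !mulmxA.
rewrite mxE; apply: eq_bigr => i _; rewrite /D mul_mx_diag.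
by rewrite 3!mxE normCK mulrAC mulrC !mxE.
Qed.

Lemma mxfun_psdP f A : psdmx (mxfun f A) <-> forall i, 0 <= f (eig A i).
Proof.
split=> [[_ pA] i|f0]; first by rewrite -(embed_ge0 C) -eigrow_mxfun_form.
split=> [|v]; first exact: mxfun_herm.
by rewrite mxfun_form sumr_ge0 // => i _; rewrite mulr_ge0 ?exprn_ge0 // embed_ge0.
Qed.

Lemma mxfun_pdP f A : pdmx (mxfun f A) <-> forall i, 0 < f (eig A i).
Proof.
split=> [[_ pA] i|f0].
  by rewrite -(embed_gt0 C) -eigrow_mxfun_form pA // eigrow_neq0.
split=> [|v v0]; first exact: mxfun_herm.
rewrite mxfun_form; set w := v *m _.
have /matrix0Pn[i0 [i wi]] : w != 0.
  apply: contra_neq v0 => w0; rewrite -[v]mulmx1.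
  by rewrite -(mulVmx (spectral_unit A)) -spectralmx_trmxC mulmxA -/w w0 mul0mx.
rewrite ord1 in wi; rewrite (bigD1 i) //= ltr_pwDl //.
  by rewrite mulr_gt0 ?embed_gt0 // exprn_gt0 // normr_gt0.
by rewrite sumr_ge0 // => j _; rewrite mulr_ge0 ?exprn_ge0 // embed_ge0 ltW.
Qed.

Lemma psdmxP A : psdmx A <-> hermmx A /\ forall i, 0 <= eig A i.
Proof.
split=> [pA|[hA eig0]]; last by rewrite -(mxfun_id hA); apply/mxfun_psdP.
by split=> [|]; [case: pA|apply/(mxfun_psdP id); rewrite mxfun_id //; case: pA].
Qed.

Lemma pdmxP A : pdmx A <-> hermmx A /\ forall i, 0 < eig A i.
Proof.
split=> [pA|[hA eig0]]; last by rewrite -(mxfun_id hA); apply/mxfun_pdP.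
by split=> [|]; [case: pA|apply/(mxfun_pdP id); rewrite mxfun_id //; case: pA].
Qed.

Lemma psdmx_eig A i : psdmx A -> 0 <= eig A i.
Proof. by move/psdmxP => -[]. Qed.

Lemma pdmx_eig A i : pdmx A -> 0 < eig A i.
Proof. by move/pdmxP => -[]. Qed.

Lemma pdmx_psd A : pdmx A -> psdmx A.
Proof. by move=> /pdmxP[hA pA]; apply/psdmxP; split=> // i; rewrite ltW. Qed.

Lemma mxfun_psd f A : (forall i, 0 <= f (eig A i)) -> psdmx (mxfun f A).
Proof. by move/mxfun_psdP. Qed.

Lemma mxfun_pd f A : (forall i, 0 < f (eig A i)) -> pdmx (mxfun f A).
Proof. by move/mxfun_pdP. Qed.

Lemma mxfun_leP f g A :
  mxfun f A \preceq mxfun g A <-> forall i, f (eig A i) <= g (eig A i).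
Proof.
rewrite mxfunB; split=> [/mxfun_psdP fg i|fg]; first by rewrite -subr_ge0.
by apply/mxfun_psdP => i; rewrite subr_ge0.
Qed.

Lemma eig_geP A c : hermmx A -> (forall i, c <= eig A i) <-> c%:C%:M \preceq A.
Proof.
move=> hA; rewrite -{2}(mxfun_id hA) -(mxfun_const c A).
exact: iff_sym (mxfun_leP (fun=> c) id A).
Qed.

Lemma eig_leP A c : hermmx A -> (forall i, eig A i <= c) <-> A \preceq c%:C%:M.
Proof.
move=> hA; rewrite -{2}(mxfun_id hA) -(mxfun_const c A).
exact: iff_sym (mxfun_leP id (fun=> c) A).
Qed.

Lemma hermmx_scalar c : hermmx (c%:C%:M : 'M[C]_n).
Proof. by rewrite -(mxfun_const c 0); exact: mxfun_herm. Qed.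

Lemma eig_scalar c i : eig (c%:C%:M : 'M[C]_n) i = c.
Proof.
have hc := hermmx_scalar c; apply/le_anti/andP.
by split; move: i; [apply/eig_leP|apply/eig_geP]; rewrite ?subrr //; exact: psdmx0.
Qed.

Lemma mxfun_scalar f c : mxfun f (c%:C%:M : 'M[C]_n) = (f c)%:C%:M.
Proof. by rewrite -[RHS](mxfun_const _ c%:C%:M); apply: eq_mxfun => i; rewrite eig_scalar. Qed.

Lemma hermmx_unit A : hermmx A -> (A \in unitmx) = [forall i, eig A i != 0].
Proof.
move=> hA; rewrite {1}(hermmx_spectral hA) unitmx_simdiag ?spectral_unit //.
by apply: eq_forallb => i; rewrite fmorph_eq0.
Qed.

Lemma pdmx_unit A : pdmx A -> A \in unitmx.
Proof.
by move=> /pdmxP[hA pA]; rewrite hermmx_unit //; apply/forallP => i; rewrite gt_eqF.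
Qed.

Lemma psdmx_unit_pd A : psdmx A -> A \in unitmx -> pdmx A.
Proof.
move=> /psdmxP[hA pA]; rewrite hermmx_unit // => /forallP eig0.
by apply/pdmxP; split=> // i; rewrite lt_neqAle pA andbT eq_sym.
Qed.

Lemma hermmx_scale c A : hermmx A -> c%:C *: A = mxfun (fun x => c * x) A.
Proof. by move=> hA; rewrite -mxfunZ mxfun_id. Qed.

Lemma psdmxZ c A : 0 <= c -> psdmx A -> psdmx (c%:C *: A).
Proof.
move=> c0 pA; rewrite (hermmx_scale _ (psdmx_herm pA)).
by apply: mxfun_psd => i; rewrite mulr_ge0 // psdmx_eig.
Qed.

Lemma pdmxZ c A : 0 < c -> pdmx A -> pdmx (c%:C *: A).
Proof.
move=> c0 pA; rewrite (hermmx_scale _ (pdmx_herm pA)).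
by apply: mxfun_pd => i; rewrite mulr_gt0 // pdmx_eig.
Qed.

Lemma psdmx_eig_eq0 A : psdmx A -> (forall i, eig A i = 0) -> A = 0.
Proof.
move=> pA eig0; rewrite -(mxfun_id (psdmx_herm pA)) -(mxfun0 A).
exact: eq_mxfun.
Qed.

Lemma psdmx_trR_ge0 A : psdmx A -> 0 <= trR A.
Proof. by move=> pA; exact/re_ge0/psdmx_tr_ge0. Qed.

Lemma psdmx_trR_eq0 A : psdmx A -> trR A = 0 -> A = 0.
Proof.
move=> pA /eqP trA0; apply: psdmx_eig_eq0 => // i; apply/eqP; move: trA0.
rewrite trR_hermmx ?psumr_eq0 => [|j _|]; last exact: psdmx_herm.
  by move=> /allP; apply; exact: mem_index_enum.
exact: psdmx_eig.
Qed.

Lemma trR_pdmx_gt0 A : (0 < n)%N -> pdmx A -> 0 < trR A.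
Proof.
move=> n0 pA; rewrite (trR_hermmx (pdmx_herm pA)) (bigD1 (Ordinal n0)) //=.
by rewrite ltr_pwDl ?pdmx_eig // sumr_ge0 // => i _; apply/ltW/pdmx_eig.
Qed.

End Spectrum.

End FunctionalCalculus.

Section Powers.
Variables (R : realType) (C : complexification R) (n : nat).
Local Notation "x %:C" := (embed C x) : ring_scope.
Implicit Types (A : 'M[C]_n) (c r s : R).

Definition mxpow s A : 'M[C]_n := mxfun (fun x => x `^ s) A.

Definition mxlog A : 'M[C]_n := mxfun (@ln R) A.

Lemma mxpow_herm s A : hermmx (mxpow s A).
Proof. exact: mxfun_herm. Qed.

Lemma mxpow_psd s A : psdmx (mxpow s A).
Proof. by apply: mxfun_psd => i; exact: powR_ge0. Qed.

Lemma mxpow_pd s A : pdmx A -> pdmx (mxpow s A).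
Proof. by move=> pA; apply: mxfun_pd => i; rewrite powR_gt0 // pdmx_eig. Qed.

Lemma trR_mxpow_ge0 s A : 0 <= trR (mxpow s A).
Proof. by rewrite trR_mxfun sumr_ge0 // => i _; exact: powR_ge0. Qed.

Lemma mxpowD A r s : pdmx A -> mxpow r A *m mxpow s A = mxpow (r + s) A.
Proof.
move=> pA; rewrite mxfunM; apply: eq_mxfun => i.
by rewrite powRD // (gt_eqF (pdmx_eig i pA)) implybT.
Qed.

Lemma mxpow0 A : mxpow 0 A = 1%:M.
Proof. by rewrite -(mxfun1 A); apply: eq_mxfun => i; rewrite powRr0. Qed.

Lemma mxpow1 A : psdmx A -> mxpow 1 A = A.
Proof.
move=> pA; rewrite -[RHS](mxfun_id (psdmx_herm pA)); apply: eq_mxfun => i.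
by rewrite powRr1 // psdmx_eig.
Qed.

Lemma mxpowM A r s : mxpow r (mxpow s A) = mxpow (s * r) A.
Proof. by rewrite /mxpow mxfun_comp; apply: eq_mxfun => i /=; rewrite powRrM. Qed.

Lemma mxpowN_mull s A : pdmx A -> mxpow (- s) A *m mxpow s A = 1%:M.
Proof. by move=> pA; rewrite mxpowD // addNr mxpow0. Qed.

Lemma mxpow_mull s A : pdmx A -> mxpow s A *m A = mxpow (s + 1) A.
Proof. by move=> pA; rewrite -{2}(mxpow1 (pdmx_psd pA)) mxpowD. Qed.

Lemma mxpow_mulr s A : pdmx A -> A *m mxpow s A = mxpow (s + 1) A.
Proof. by move=> pA; rewrite -{1}(mxpow1 (pdmx_psd pA)) mxpowD // addrC. Qed.

Lemma mxpow_sqrt A : psdmx A -> mxpow 2^-1 A *m mxpow 2^-1 A = A.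
Proof.
move=> pA; rewrite mxfunM -[RHS](mxfun_id (psdmx_herm pA)); apply: eq_mxfun => i /=.
by rewrite powR12_sqrt ?psdmx_eig // -expr2 sqr_sqrtr ?psdmx_eig.
Qed.

Lemma mxpowN1 A : pdmx A -> mxpow (-1) A = invmx A.
Proof.
move=> pA; have uA := pdmx_unit pA; rewrite -[LHS]mulmx1 -(mulmxV uA) mulmxA.
by rewrite mxpow_mull // addNr mxpow0 mul1mx.
Qed.

Lemma sqrmx_mxpow A : pdmx A -> A *m A = mxpow 2 A.
Proof. by move=> pA; rewrite -{1}(mxpow1 (pdmx_psd pA)) mxpow_mull. Qed.

Lemma mxpow_sqr r A : pdmx A -> mxpow r (A *m A) = mxpow (2 * r) A.
Proof. by move=> pA; rewrite sqrmx_mxpow // mxpowM. Qed.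

Lemma mxpowZ c r A : 0 <= c -> psdmx A -> mxpow r (c%:C *: A) = (c `^ r)%:C *: mxpow r A.
Proof.
move=> c0 pA; rewrite (hermmx_scale _ (psdmx_herm pA)) /mxpow mxfun_comp mxfunZ.
by apply: eq_mxfun => i /=; rewrite powRM // psdmx_eig.
Qed.

Lemma mxlogZ c A : 0 < c -> pdmx A -> mxlog (c%:C *: A) = mxlog A + (ln c)%:C%:M.
Proof.
move=> c0 pA; rewrite (hermmx_scale _ (pdmx_herm pA)) /mxlog mxfun_comp.
rewrite -(mxfun_const (ln c) A) mxfunD; apply: eq_mxfun => i /=.
by rewrite lnM ?posrE ?pdmx_eig // addrC.
Qed.

Lemma mxlog_mxpow s A : mxlog (mxpow s A) = s%:C *: mxlog A.
Proof.
by rewrite /mxlog /mxpow mxfun_comp mxfunZ; apply: eq_mxfun => i /=; rewrite ln_powR.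
Qed.

Lemma mxpowN1_mulmx_trmxC A : A \in unitmx ->
  (invmx A)^t* *m invmx A = mxpow (-1) (A *m A^t*).
Proof.
move=> uA; have uAA : A *m A^t* \in unitmx by rewrite unitmx_mul uA unitmx_trmxC.
rewrite mxpowN1; last exact: psdmx_unit_pd (psdmx_mulmx_trmxC A) uAA.
rewrite -[LHS](mulmxK uAA) !mulmxA mulmxKV // -trmxC_mul mulmxV //.
by rewrite trmxC1 mul1mx.
Qed.

Lemma mxpowN1_trmxC_mulmx A : A \in unitmx ->
  invmx A *m (invmx A)^t* = mxpow (-1) (A^t* *m A).
Proof.
move=> uA; have uAA : A^t* *m A \in unitmx by rewrite unitmx_mul unitmx_trmxC uA.
rewrite mxpowN1; last exact: psdmx_unit_pd (psdmx_trmxC_mulmx A) uAA.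
rewrite -[LHS](mulKmx uAA) -!mulmxA (mulKVmx uA) -trmxC_mul mulVmx //.
by rewrite trmxC1 mulmx1.
Qed.

End Powers.

Section CommutingMatrices.
Variables (R : realType) (C : complexification R) (n : nat).
Local Notation "x %:C" := (embed C x) : ring_scope.
Implicit Types (A B V : 'M[C]_n).

Lemma hermmx_simdiag A V d : hermmx A -> V \in unitmx ->
  A = simdiag V d -> A = realdiag V (@re R C \o d).
Proof.
move=> hA uV AV; rewrite {1}AV /realdiag; congr simdiag; apply/funext => i.
by have [j /= ->] := realdiag_eig i hA uV AV; rewrite embedK.
Qed.

Lemma hermmx_diagonalizable A : hermmx A -> diagonalizable A.
Proof.
move=> hA; exists (spectralmx A); first exact: spectral_unit.
apply/(diagonalizable_forLR (spectral_unit A)); exists (\row_i (eig A i)%:C).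
by rewrite {1}(hermmx_spectral hA) mxpoly.conjumx ?unitmx_inv ?spectral_unit // invmxK.
Qed.

Lemma commuting_realdiag A B : hermmx A -> hermmx B -> A *m B = B *m A ->
  exists V dA dB, [/\ V \in unitmx, A = realdiag V dA & B = realdiag V dB].
Proof.
move=> hA hB AB.
have /codiagonalizableP : {in [:: A; B] &, forall A B, comm_mx A B} /\
    {in [:: A; B], forall A, diagonalizable A}.
  split=> [H K|H]; rewrite !inE.
    by move=> /orP[]/eqP -> /orP[]/eqP -> //; apply/comm_mx_sym.
  by move=> /orP[]/eqP ->; exact: hermmx_diagonalizable.
case=> V uV /= /andP[/(diagonalizable_forLR uV)[d Ad]].
move=> /andP[/(diagonalizable_forLR uV)[l Bl] _].
have realform (H : 'M[C]_n) m : hermmx H -> H = mxpoly.conjmx (invmx V) (diag_mx m) ->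
    H = realdiag V (fun i => re (m 0 i)).
  move=> hH; rewrite mxpoly.conjumx ?unitmx_inv // invmxK => Hm.
  apply: (@hermmx_simdiag H V (m 0)) => //; rewrite Hm /simdiag.
  by congr (_ *m diag_mx _ *m _); apply/rowP => i; rewrite mxE.
exists V, (fun i => re (d 0 i)), (fun i => re (l 0 i)).
by split=> //; exact: realform.
Qed.

Lemma hermmx_commM A B : hermmx A -> hermmx B -> A *m B = B *m A -> hermmx (A *m B).
Proof. by rewrite /hermmx trmxC_mul => -> -> ->. Qed.

Lemma realdiag_ge0 A V d : psdmx A -> V \in unitmx -> A = realdiag V d -> forall i, 0 <= d i.
Proof.
move=> pA uV AV i.
by have [j /fmorph_inj ->] := realdiag_eig i (psdmx_herm pA) uV AV; exact: psdmx_eig.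
Qed.

Lemma realdiag_gt0 A V d : pdmx A -> V \in unitmx -> A = realdiag V d -> forall i, 0 < d i.
Proof.
move=> pA uV AV i.
by have [j /fmorph_inj ->] := realdiag_eig i (pdmx_herm pA) uV AV; exact: pdmx_eig.
Qed.

Lemma mxpow_commM r A B : psdmx A -> psdmx B -> A *m B = B *m A ->
  mxpow r (A *m B) = mxpow r A *m mxpow r B.
Proof.
move=> pA pB AB; have hA := psdmx_herm pA; have hB := psdmx_herm pB.
have [V [dA [dB [uV AV BV]]]] := commuting_realdiag hA hB AB.
have ABV : A *m B = realdiag V (fun i => dA i * dB i) by rewrite AV BV realdiagM.
rewrite /mxpow (mxfun_realdiag _ (hermmx_commM hA hB AB) uV ABV).
rewrite (mxfun_realdiag _ hA uV AV) (mxfun_realdiag _ hB uV BV) realdiagM //.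
apply: eq_realdiag => i /=.
by rewrite powRM // ?(realdiag_ge0 pA uV AV) ?(realdiag_ge0 pB uV BV).
Qed.

Lemma mxlog_commM A B : pdmx A -> pdmx B -> A *m B = B *m A ->
  mxlog (A *m B) = mxlog A + mxlog B.
Proof.
move=> pA pB AB; have hA := pdmx_herm pA; have hB := pdmx_herm pB.
have [V [dA [dB [uV AV BV]]]] := commuting_realdiag hA hB AB.
have ABV : A *m B = realdiag V (fun i => dA i * dB i) by rewrite AV BV realdiagM.
rewrite /mxlog (mxfun_realdiag _ (hermmx_commM hA hB AB) uV ABV).
rewrite (mxfun_realdiag _ hA uV AV) (mxfun_realdiag _ hB uV BV) realdiagD.
apply: eq_realdiag => i /=.
by rewrite lnM // posrE ?(realdiag_gt0 pA uV AV) ?(realdiag_gt0 pB uV BV).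
Qed.

Lemma pdmx_commM A B : pdmx A -> pdmx B -> A *m B = B *m A -> pdmx (A *m B).
Proof.
move=> pA pB AB; apply: psdmx_unit_pd; last by rewrite unitmx_mul !pdmx_unit.
set T := mxpow 2^-1 A; have TB : T *m B = B *m T.
  by apply: mxfun_comm => //; exact: pdmx_herm.
have -> : A *m B = T *m B *m T^t*.
  by rewrite (mxpow_herm _ A) TB -mulmxA mxpow_sqrt //; exact: pdmx_psd.
exact/psdmx_congr/pdmx_psd.
Qed.

End CommutingMatrices.

Lemma poly_interpolation (F : fieldType) (s : seq F) (f : F -> F) :
  exists p : {poly F}, forall x, x \in s -> p.[x] = f x.
Proof.
elim: s => [|a s [p pf]]; first by exists 0.
have [sa|sa] := boolP (a \in s).
  by exists p => x; rewrite inE => /predU1P[->|]; exact: pf.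
pose m := \prod_(y <- s) ('X - y%:P).
have ma : m.[a] != 0 by rewrite -[_ == 0]/(root m a) root_prod_XsubC.
exists (p + ((f a - p.[a]) / m.[a]) *: m) => x.
rewrite inE hornerD hornerZ => /predU1P[->|sx]; first by rewrite divfK // subrKC.
have /rootP -> : root m x by rewrite root_prod_XsubC.
by rewrite mulr0 addr0 pf.
Qed.

Section Subalgebra.
Variables (R : realType) (C : complexification R) (n : nat).
Local Notation "x %:C" := (embed C x) : ring_scope.

Lemma mxfun_subalgebra (N : set 'M[C]_n) f (A : 'M[C]_n) :
  N 1%:M -> (forall X Y, N X -> N Y -> N (X + Y)) ->
  (forall c X, N X -> N (c *: X)) -> (forall X Y, N X -> N Y -> N (X *m Y)) ->
  hermmx A -> N A -> N (mxfun f A).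
Proof.
move=> N1 ND NZ NM hA NA.
have [p pf] := poly_interpolation [seq eig A i | i <- enum 'I_n] f.
have -> : mxfun f A = mxfun (horner p) A.
  by apply: eq_mxfun => i; rewrite pf //; apply: map_f; rewrite mem_enum.
elim/poly_ind: p {pf} => [|p c Np].
  have -> : mxfun (horner 0) A = 0 *: 1%:M.
    by rewrite scale0r -(mxfun0 A); apply: eq_mxfun => i; rewrite horner0.
  exact: NZ.
have -> : mxfun (horner (p * 'X + c%:P)) A = mxfun (horner p) A *m A + c%:C *: 1%:M.
  rewrite -{3}(mxfun_id hA) mxfunM scalemx1 -(mxfun_const c A) mxfunD.
  by apply: eq_mxfun => i; rewrite !hornerE.
by apply: ND; [exact: NM|exact: NZ].
Qed.

End Subalgebra.

(** * Trace inequalities *)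
Section RealPowers.
Variable R : realType.
Implicit Types x y k : R.

Lemma powRVK x k : 0 <= x -> k != 0 -> (x `^ k^-1) `^ k = x.
Proof. by move=> x0 k0; rewrite -powRrM mulVf // powRr1. Qed.

Lemma ler_powR2r x y k : 0 < k -> 0 <= x -> 0 <= y -> (x `^ k <= y `^ k) = (x <= y).
Proof.
move=> k0 x0 y0; apply/idP/idP => [|xy].
  by apply: contraTT; rewrite -!ltNge => yx; exact: gt0_ltr_powR.
by apply: ge0_ler_powR; rewrite ?nnegrE // ltW.
Qed.

Lemma powR_tangent_ge x y k : 0 <= x -> 0 <= y -> 1 <= k ->
  x `^ k + k * x `^ (k - 1) * (y - x) <= y `^ k.
Proof.
move=> x0 y0; rewrite le_eqVlt => /predU1P[<-|k1].
  by rewrite subrr powRr0 !powRr1 //; lra.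
have k0 : 0 < k by lra.
have kV1 : 0 < 1 - k^-1 by rewrite subr_gt0 invf_lt1.
have kE : (k - 1) / (1 - k^-1) = k by field; rewrite !gt_eqF // subr_gt0.
have := @conjugate_powR R y (x `^ (k - 1)) k (1 - k^-1)^-1 y0 (powR_ge0 _ _) k0.
rewrite invr_gt0 invrK subrKC -powRrM kE => /(_ kV1 erefl).
rewrite -(ler_pM2l k0) -(mulr_powRB1 x0 k0).
move: (x `^ (k - 1)) (y `^ k) => u v young.
suff : k * (v / k + x * u * (1 - k^-1)) = v + (k - 1) * (x * u) by nra.
by field; rewrite gt_eqF.
Qed.

Lemma powR_tangent_le x y k : 0 < x -> 0 <= y -> 0 < k < 1 ->
  y `^ k <= x `^ k + k * x `^ (k - 1) * (y - x).
Proof.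
move=> x0 y0 /andP[k0 k1]; have k1' : 0 < 1 - k by rewrite subr_gt0.
have := @conjugate_powR R (y `^ k) (x `^ (1 - k)) k^-1 (1 - k)^-1.
rewrite !invr_gt0 !invrK subrKC -!powRrM !mulfV ?gt_eqF // !powRr1 ?(ltW x0) //.
move=> /(_ (powR_ge0 _ _) (powR_ge0 _ _) k0 k1' erefl).
have xk : x `^ (1 - k) * x `^ (k - 1) = 1.
  by rewrite -powRD ?(gt_eqF x0) ?implybT // subrKA subrr powRr0.
rewrite -(ler_pM2r (powR_gt0 (k - 1) x0)) -[leLHS]mulrA xk mulr1.
by rewrite -(mulr_powRB1 (ltW x0) k0); lra.
Qed.

Lemma powR_subadditive x y k : 0 <= x -> 0 < y -> 0 < k < 1 ->
  (x + y) `^ k <= x `^ k + y `^ k.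
Proof.
move=> x0 y0 /andP[k0 k1]; set s := x + y.
have s0 : 0 < s by rewrite ltr_wpDl.
have sk z : 0 <= z <= s -> z / s * s `^ k <= z `^ k.
  move=> /andP[z0 zs]; rewrite -[z in leRHS](divfK (lt0r_neq0 s0)).
  rewrite powRM ?divr_ge0 ?(ltW s0) // ler_wpM2r ?powR_ge0 //.
  have [->|zn0] := eqVneq z 0; first by rewrite mul0r powR_ge0.
  have zp : 0 < z by rewrite lt_neqAle eq_sym zn0.
  by rewrite ger1_powR ?(ltW k1) // divr_gt0 //= ler_pdivrMr // mul1r.
have : x / s * s `^ k + y / s * s `^ k <= x `^ k + y `^ k.
  by apply: lerD; apply: sk; rewrite /s; lra.
by rewrite -!mulrDl mulfV ?gt_eqF // mul1r.
Qed.

End RealPowers.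

Section Klein.
Variables (R : realType) (C : complexification R) (n : nat).
Local Notation "x %:C" := (embed C x) : ring_scope.
Implicit Types (A B X T : 'M[C]_n) (f g : R -> R) (c r : R).

Definition overlap A B i j : R :=
  re (`|(spectralmx A *m (spectralmx B)^t*) i j| ^+ 2).

Lemma overlap_ge0 A B i j : 0 <= overlap A B i j.
Proof. by apply: re_ge0; rewrite exprn_ge0. Qed.

Lemma mxtrace_diag2 (F : comPzRingType) (d l : 'rV[F]_n) (V W : 'M[F]_n) :
  \tr (diag_mx d *m V *m diag_mx l *m W) =
  \sum_i \sum_j d 0 i * l 0 j * (V i j * W j i).
Proof.
apply: eq_bigr => i _; rewrite mxE; apply: eq_bigr => j _.
by rewrite mul_mx_diag mxE mul_diag_mx mxE; ring.
Qed.

Lemma trR_mxfun2 f g A B : trR (mxfun f A *m mxfun g B) =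
  \sum_i \sum_j f (eig A i) * g (eig B j) * overlap A B i j.
Proof.
rewrite !mxfunE /realdiag /simdiag -!spectralmx_trmxC.
set U := spectralmx A; set V := spectralmx B.
have assoc D D' : U^t* *m D *m U *m (V^t* *m D' *m V) =
  U^t* *m (D *m (U *m V^t*) *m D' *m V) by rewrite !mulmxA.
rewrite assoc trRC -mulmxA /trR mxtrace_diag2 raddf_sum; apply: eq_bigr => i _.
rewrite raddf_sum; apply: eq_bigr => j _ /=; rewrite ![(\row__ _) _ _]mxE.
rewrite -rmorphM re_mulr /overlap normCK; congr (_ * re (_ * _)).
have -> : V *m U^t* = (U *m V^t*)^t* by rewrite trmxC_mul trmxCK.
by rewrite 2!mxE.
Qed.

Lemma trR_bregman f f' A B : hermmx A -> hermmx B ->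
  trR (mxfun f A) - trR (mxfun f B) - trR (mxfun f' B *m (A - B)) =
  \sum_i \sum_j (f (eig A i) - f (eig B j) - f' (eig B j) * (eig A i - eig B j))
    * overlap A B i j.
Proof.
move=> hA hB.
have -> : trR (mxfun f A) = trR (mxfun f A *m mxfun (fun=> 1) B).
  by rewrite mxfun1 mulmx1.
have -> : trR (mxfun f B) = trR (mxfun (fun=> 1) A *m mxfun f B).
  by rewrite mxfun1 mul1mx.
have -> : trR (mxfun f' B *m (A - B)) = trR (mxfun id A *m mxfun f' B)
    - trR (mxfun (fun=> 1) A *m mxfun (fun x => f' x * x) B).
  by rewrite mulmxBr trRB trRC mxfun_id // mxfun1 mul1mx -(mxfunM _ id) mxfun_id.
rewrite !trR_mxfun2 -!sumrB; apply: eq_bigr => i _.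
by rewrite -!sumrB; apply: eq_bigr => j _; ring.
Qed.

(* Klein: the weights in [trR_bregman] are nonnegative, so that a pointwise
   inequality between eigenvalues becomes an inequality of traces. *)
Lemma klein_inequality f f' A B : hermmx A -> hermmx B ->
  (forall i j, f (eig B j) + f' (eig B j) * (eig A i - eig B j) <= f (eig A i)) ->
  trR (mxfun f B) + trR (mxfun f' B *m (A - B)) <= trR (mxfun f A).
Proof.
move=> hA hB fAB; rewrite -subr_ge0 opprD addrA trR_bregman //.
apply: sumr_ge0 => i _; apply: sumr_ge0 => j _; apply: mulr_ge0; last exact: overlap_ge0.
by have := fAB i j; lra.
Qed.

Lemma trR_sqr_sub A B : hermmx A -> hermmx B ->
  trR ((A - B) *m (A - B)) =
  \sum_i \sum_j (eig A i - eig B j) ^+ 2 * overlap A B i j.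
Proof.
move=> hA hB; have := trR_bregman (fun x => x * x) (fun x => 2 * x) hA hB.
rewrite -!(mxfunM id id) -(mxfunZ 2 id) !mxfun_id // -scalemxAl trRZ.
rewrite !mulmxBr !mulmxBl !trRB (trRC B A) => trE.
rewrite (_ : _ - _ - _ = trR (A *m A) - trR (B *m B)
  - 2 * (trR (A *m B) - trR (B *m B))); last by ring.
by rewrite trE; apply: eq_bigr => i _; apply: eq_bigr => j _; ring.
Qed.

Lemma trR_mxfun_taylor f f' K A B : hermmx A -> hermmx B ->
  (forall i j, `|f (eig A i) - f (eig B j) - f' (eig B j) * (eig A i - eig B j)|
     <= K * (eig A i - eig B j) ^+ 2) ->
  `|trR (mxfun f A) - trR (mxfun f B) - trR (mxfun f' B *m (A - B))|
     <= K * trR ((A - B) *m (A - B)).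
Proof.
move=> hA hB fAB; rewrite trR_bregman // trR_sqr_sub // mulr_sumr.
apply: (le_trans (ler_norm_sum _ _ _)); apply: ler_sum => i _; rewrite mulr_sumr.
apply: (le_trans (ler_norm_sum _ _ _)); apply: ler_sum => j _.
by rewrite normrM (ger0_norm (overlap_ge0 _ _ _ _)) mulrA ler_wpM2r ?overlap_ge0.
Qed.

Lemma trR_mulmx_ge0 A B : psdmx A -> psdmx B -> 0 <= trR (A *m B).
Proof.
move=> pA pB; rewrite -(mxfun_id (psdmx_herm pA)) -(mxfun_id (psdmx_herm pB)).
rewrite trR_mxfun2 sumr_ge0 // => i _; rewrite sumr_ge0 // => j _.
by rewrite !mulr_ge0 ?psdmx_eig ?overlap_ge0.
Qed.

Lemma klein_entropy A B : pdmx A -> pdmx B ->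
  trR A - trR B <= trR (A *m (mxlog A - mxlog B)).
Proof.
move=> pA pB; have hA := pdmx_herm pA; have hB := pdmx_herm pB.
have := @klein_inequality (fun x => x * ln x) (fun x => 1 + ln x) A B hA hB.
rewrite -!(mxfunM id) -(mxfunD (fun=> 1)) mxfun1 !mxfun_id // -!/(mxlog _).
rewrite mulmxDl mul1mx mulmxBr !mulmxBr !(trRD, trRN) (trRC _ A) (trRC _ B) => trAB.
suff : forall i j, eig B j * ln (eig B j) + (1 + ln (eig B j)) * (eig A i - eig B j)
    <= eig A i * ln (eig A i) by move=> /trAB; lra.
move=> i j; have := pdmx_eig i pA; have := pdmx_eig j pB.
move: (eig A i) (eig B j) => x y y0 x0.
have := expR_ge1Dx (ln (y / x)); rewrite lnK ?posrE ?divr_gt0 // ln_div ?posrE //.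
by rewrite ler_pdivlMr //; lra.
Qed.

Lemma trR_mxpow_le_ge1 r A B : psdmx A -> A \preceq B -> 1 <= r ->
  trR (mxpow r A) <= trR (mxpow r B).
Proof.
move=> pA AB r1; have pB := psdmx_le pA AB.
have := klein_inequality (f := fun x => x `^ r) (f' := fun x => r * x `^ (r - 1))
  (psdmx_herm pB) (psdmx_herm pA).
rewrite -mxfunZ -scalemxAl trRZ => kleinAB.
apply: le_trans (kleinAB _); last first.
  by move=> i j; apply: powR_tangent_ge => //; exact: psdmx_eig.
rewrite lerDl mulr_ge0 ?trR_mulmx_ge0 //; last exact: mxpow_psd.
by rewrite (le_trans ler01).
Qed.

Lemma trR_mxpow_le_lt1 r A B : psdmx A -> pdmx B -> A \preceq B -> 0 < r < 1 ->
  trR (mxpow r A) <= trR (mxpow r B).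
Proof.
move=> pA pB AB r01; have /andP[r0 _] := r01.
have := klein_inequality (f := fun x => - x `^ r) (f' := fun x => - r * x `^ (r - 1))
  (psdmx_herm pA) (pdmx_herm pB).
rewrite -!(mxfunN (fun x => x `^ r)) -mxfunZ -scalemxAl trRZ !trRN => kleinAB.
rewrite -lerN2; apply: le_trans (kleinAB _); last first.
  move=> i j; have := powR_tangent_le (pdmx_eig j pB) (psdmx_eig i pA) r01; lra.
rewrite lerDl -(opprB B A) mulmxN trRN mulrNN mulr_ge0 ?(ltW r0) //.
by apply: trR_mulmx_ge0 => //; exact: mxpow_psd.
Qed.

Lemma trR_mxpow_le r A B : psdmx A -> A \preceq B -> 0 < r ->
  trR (mxpow r A) <= trR (mxpow r B).
Proof.
move=> pA AB r0; have pB := psdmx_le pA AB.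
have [r1|r1] := leP 1 r; first exact: trR_mxpow_le_ge1.
(* Below exponent 1 the tangent is taken at B, which must be invertible. *)
apply/ler_addgt0Pr => e e0.
pose d : R := (e / n.+1%:R) `^ r^-1.
have d0 : 0 < d by rewrite powR_gt0 // divr_gt0.
have dr : d `^ r = e / n.+1%:R.
  by rewrite /d -powRrM mulVf ?gt_eqF // powRr1 // ltW // divr_gt0.
pose Bd := mxfun (fun x => x + d) B.
have pBd : pdmx Bd by apply: mxfun_pd => i; rewrite ltr_wpDl ?psdmx_eig.
have ABd : A \preceq Bd.
  rewrite -(subrKA B); apply: psdmxD => //.
  by rewrite -{1}(mxfun_id (psdmx_herm pB)); apply/mxfun_leP => i; rewrite lerDl ltW.
have r01 : 0 < r < 1 by rewrite r0.
apply: le_trans (trR_mxpow_le_lt1 pA pBd ABd r01) _.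
rewrite /mxpow mxfun_comp !trR_mxfun.
apply: (@le_trans _ _ (\sum_i (eig B i `^ r + e / n.+1%:R))).
  by apply: ler_sum => i _; rewrite /= -dr powR_subadditive ?psdmx_eig.
rewrite big_split /= lerD2l sumr_const card_ord -[_ *+ n]mulr_natr mulrAC.
by rewrite ler_pdivrMr ?ltr0n // ler_pM2l // ler_nat.
Qed.

Lemma trR_mxfun_mulmx_trmxC f T X : T *m X = X *m T ->
  trR (T *m mxfun f (X *m X^t*)) = trR (T *m mxfun f (X^t* *m X)).
Proof.
move=> TX; pose g x : R := if x == 0 then 0 else (f x - f 0) / x.
have fE x : f x = f 0 + x * g x.
  by rewrite /g; case: eqP => [->|/eqP x0]; rewrite ?mulr0 ?addr0 // mulrC divfK // subrKC.
have hl := psdmx_herm (psdmx_mulmx_trmxC X).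
have hr := psdmx_herm (psdmx_trmxC_mulmx X).
have mxfunE0 (H : 'M[C]_n) : hermmx H -> mxfun f H = (f 0)%:C%:M + H *m mxfun g H.
  move=> hH; rewrite -{2}(mxfun_id hH) mxfunM -(mxfun_const _ H) mxfunD.
  exact: eq_mxfun.
rewrite !mxfunE0 // !mulmxDr !trRD; congr (_ + _).
have gX : mxfun g (X^t* *m X) *m X^t* = X^t* *m mxfun g (X *m X^t*).
  by apply: mxfun_intertwine => //; rewrite mulmxA.
have -> : T *m (X *m X^t* *m mxfun g (X *m X^t*)) =
    X *m (T *m mxfun g (X^t* *m X) *m X^t*).
  by rewrite -[X *m X^t* *m _]mulmxA -gX !mulmxA TX.
have gXX : mxfun g (X^t* *m X) *m (X^t* *m X) = X^t* *m X *m mxfun g (X^t* *m X).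
  exact: mxfun_comm.
by rewrite trRC -gXX !mulmxA.
Qed.

Lemma trR_mxfun_trmxC f X : trR (mxfun f (X *m X^t*)) = trR (mxfun f (X^t* *m X)).
Proof.
rewrite -[mxfun f _ in LHS]mul1mx -[mxfun f _ in RHS]mul1mx.
by apply: trR_mxfun_mulmx_trmxC; rewrite mul1mx mulmx1.
Qed.

Lemma eig_mulmx_trmxC_le c X : (forall i, eig (X^t* *m X) i <= c) ->
  forall i, eig (X *m X^t*) i <= c.
Proof.
move=> Xc i; have := trR_mxfun_trmxC (fun x => (c < x)%R%:R) X.
rewrite !trR_mxfun [in RHS]big1 => [/eqP|j _]; last by rewrite ltNge Xc.
rewrite psumr_eq0 => [/allP/(_ i (mem_index_enum _))|j _]; last exact: ler0n.
by rewrite pnatr_eq0 eqb0 -leNgt.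
Qed.

End Klein.

(** * First-order expansions, uniform in parameters *)
Section UniformLittleO.
Variables (R : realType) (I : Type) (T : set I).
Implicit Types f g : R -> I -> R.

Definition uniform_littleo f : Prop := forall e : R, 0 < e ->
  \forall t \near (0 : R), forall i, T i -> `|f t i| <= e * `|t|.

Lemma uniform_littleo_le f g K : uniform_littleo g ->
  (\forall t \near (0 : R), forall i, T i -> `|f t i| <= K * `|g t i|) ->
  uniform_littleo f.
Proof.
move=> og fg e e0; have K0 : 0 < `|K| + 1 by rewrite ltr_wpDl.
near=> t => i Ti; have fgt : `|f t i| <= K * `|g t i| by move: i Ti; near: t.
apply: le_trans fgt _; apply: (@le_trans _ _ ((`|K| + 1) * `|g t i|)).
  by rewrite ler_wpM2r // (le_trans (ler_norm K)) // lerDl.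
rewrite -ler_pdivlMl // mulrA [_ * e]mulrC.
by move: i Ti; near: t; apply: og; rewrite divr_gt0.
Unshelve. all: by end_near. Qed.

Lemma near_eq_uniform_littleo f g :
  (\forall t \near (0 : R), forall i, T i -> f t i = g t i) ->
  uniform_littleo f -> uniform_littleo g.
Proof.
by move=> fg of_ e /of_; apply: filterS2 fg => t fg ft i Ti; rewrite -fg ?ft.
Qed.

Lemma uniform_littleoD f g : uniform_littleo f -> uniform_littleo g ->
  uniform_littleo (fun t i => f t i + g t i).
Proof.
move=> of_ og e e0; have e2 : 0 < e / 2 by rewrite divr_gt0.
near=> t => i Ti; rewrite (splitr e) mulrDl (le_trans (ler_normD _ _)) //.
by apply: lerD; move: i Ti; near: t; [apply: of_|apply: og].
Unshelve. all: by end_near. Qed.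

Lemma uniform_littleo_sqr : uniform_littleo (fun t _ => t ^+ 2).
Proof.
move=> e e0; near=> t => i _; rewrite normrX expr2 ler_wpM2r //.
Unshelve. all: by end_near. Qed.

End UniformLittleO.

Lemma uniform_littleo_comp (R : realType) (I J : Type) (T : set I) (U : set J)
    (phi : J -> I) (f : R -> I -> R) : (forall j, U j -> T (phi j)) ->
  uniform_littleo T f -> uniform_littleo U (fun t j => f t (phi j)).
Proof. by move=> UT of_ e /of_; apply: filterS => t ft j /UT; exact: ft. Qed.

Section ScalarExpansions.
Variable R : realType.
Implicit Types (x y u w m M k t : R) (g : R -> R).

Lemma is_derive_divr g (x g1 c : R) : is_derive x (1 : R) g g1 ->
  is_derive x (1 : R) (fun t => g t / c) (g1 / c).
Proof. by move=> dg; apply: is_derive_eq; rewrite scaler0 add0r [LHS]mulrC. Qed.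

Lemma is_derive_cvg g (x g1 : R) : is_derive x (1 : R) g g1 -> g t @[t --> x] --> g x.
Proof.
by move=> dg; apply/differentiable_continuous/derivable1_diffP; exact: ex_derive.
Qed.

Lemma is_derive0P g (g1 : R) : is_derive (0 : R) (1 : R) g g1 <->
  uniform_littleo [set: unit] (fun t _ => g t - g 0 - t * g1).
Proof.
pose D h := h^-1 *: ((g \o shift 0) (h *: (1 : R)) - g 0).
have DE h : D h = h^-1 * (g h - g 0) by rewrite /D /= addr0 [h *: 1]mulr1.
have remE h : h != 0 -> g h - g 0 - h * g1 = h * (D h - g1).
  by move=> h0; rewrite DE; field.
split=> [[dg gE] e e0|og].
  have /cvgrPdist_le/(_ e e0) : D h @[h --> 0^'] --> g1 by rewrite -gE; exact: dg.
  move=> [d /= d0 hd]; exists d => // t td [] _.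
  have [->|t0] := eqVneq t 0; first by rewrite mul0r subrr subr0 normr0 mulr0.
  by rewrite remE // normrM mulrC ler_wpM2r // distrC hd.
have cvD : D h @[h --> 0^'] --> g1.
  apply/cvgrPdist_le => e e0.
  have oge : \forall t \near (0 : R), `|g t - g 0 - t * g1| <= e * `|t|.
    by apply: filterS (og e e0) => t /(_ tt I).
  near=> t; have t0 : t != 0 by near: t; exact: nbhs_dnbhs_neq.
  rewrite distrC -(@ler_pM2l _ `|t|) ?normr_gt0 // -normrM -remE // [leRHS]mulrC.
  by near: t; exact: nbhs_dnbhs.
by apply: DeriveDef; [apply/cvg_ex; exists g1|exact: cvg_lim].
Unshelve. all: by end_near. Qed.

Lemma is_derive0_incr_ge0 g (g1 : R) : is_derive (0 : R) (1 : R) g g1 ->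
  (\forall t \near (0 : R), 0 < t -> g 0 <= g t) -> 0 <= g1.
Proof.
move=> dg g_incr; rewrite leNgt; apply/negP => g1_lt0.
have e0 : 0 < - (g1 / 2) by rewrite oppr_gt0 pmulr_llt0.
have /is_derive0P/(_ _ e0) := dg.
move=> /(filterI g_incr)/nbhs_ballP[d /= d0 gd]; have d2 : 0 < d / 2 by rewrite divr_gt0.
have /gd[/(_ d2) g0_le /(_ tt Logic.I)] : ball (0 : R) d (d / 2).
  by rewrite /ball /= sub0r normrN gtr0_norm // ltr_pdivrMr // ltr_pMr // ltr1n.
by rewrite (gtr0_norm d2) ler_norml => /andP[_]; nra.
Qed.

Lemma is_derive0_lipschitz g (g1 : R) : is_derive (0 : R) (1 : R) g g1 ->
  \forall t \near (0 : R), `|g t - g 0| <= (1 + `|g1|) * `|t|.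
Proof.
move=> /is_derive0P/(_ 1 ltr01); apply: filterS => t /(_ tt I) gt.
rewrite -[g t - g 0](subrK (t * g1)) (le_trans (ler_normD _ _)) // normrM.
by rewrite mulrDl [`|t| * _]mulrC lerD.
Qed.

Lemma expR_taylor2 u w : u <= w -> `|expR u - 1 - u| <= (1 + expR w) * u ^+ 2.
Proof.
move=> uw; have eu1 := expR_ge1Dx u; have ew0 := expR_gt0 w.
have euw : expR u <= expR w by rewrite ler_expR.
have euN : expR u * (1 - u) <= 1.
  by rewrite -[leRHS](expRxMexpNx_1 u) ler_pM2l ?expR_gt0 ?expR_ge1Dx.
rewrite ger0_norm; last by lra.
by have [u0|u0] := leP 0 u; nra.
Qed.

Lemma is_derive0_powR_root (v p : R -> R) (p1 u1 : R) :
  is_derive (0 : R) (1 : R) p p1 -> p 0 != 0 -> 0 < v 0 ->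
  (\forall t \near (0 : R), 0 <= v t) ->
  is_derive (0 : R) (1 : R) (fun t => v t `^ p t) u1 ->
  is_derive (0 : R) (1 : R) v (v 0 * ((u1 / v 0 `^ p 0 - p1 * ln (v 0)) / p 0)).
Proof.
move=> dp p0 v0 v_ge0 du; pose u t := v t `^ p t.
have u0 : 0 < u 0 := powR_gt0 _ v0.
have dln := @is_derive1_comp _ (@ln R) u _ _ _ (is_derive1_ln u0) du.
have dexp := is_derive1_comp (is_derive_expR _) (is_deriveM dln (is_deriveV p0 dp)).
have pV0 := is_derive_cvg dp; have uV0 := is_derive_cvg du.
have vE : \forall t \near (0 : R), expR (ln (u t) * (p t)^-1) = v t.
  near=> t.
  have pt : p t != 0 by near: t; exact: (cvgr_neq0 _ pV0 p0).
  have ut : 0 < u t by near: t; exact: (cvgr_gt _ uV0 _ u0).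
  have vt : 0 < v t.
    rewrite lt_neqAle andbC; apply/andP; split; first by near: t.
    by apply: contraTneq ut => v0t; rewrite /u -v0t powR0 // ltxx.
  by rewrite /u ln_powR mulrAC mulfV // mul1r lnK.
apply: near_eq_is_derive (vE) (is_derive_eq dexp _).
rewrite -[expR _]/(expR (ln (u 0) * (p 0)^-1)) (nbhs_singleton vE); congr (_ * _).
rewrite /= -/(u 0) /GRing.scale /= [ln _]ln_powR; move: (u 0) u0 => w w0.
field.
by rewrite p0 gt_eqF.
Unshelve. all: by end_near. Qed.

Lemma ln_lipschitz m x y : 0 < m -> m <= x -> m <= y ->
  `|ln x - ln y| <= `|x - y| / m.
Proof.
move=> m0 mx my.
have ln_sub a b : m <= a -> m <= b -> ln a - ln b <= `|a - b| / m.
  move=> ma mb; have a0 := lt_le_trans m0 ma; have b0 := lt_le_trans m0 mb.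
  have := expR_ge1Dx (ln (a / b)); rewrite lnK ?posrE ?divr_gt0 //.
  rewrite ln_div ?posrE // => le_ab; apply: (@le_trans _ _ (`|a - b| / b)).
    apply: (@le_trans _ _ ((a - b) / b)); last by rewrite ler_pM2r ?invr_gt0 ?ler_norm.
    by rewrite mulrBl mulfV ?gt_eqF //; lra.
  by rewrite ler_wpM2l // lef_pV2 ?posrE.
rewrite ler_norml ln_sub // andbT lerNl opprB distrC; exact: ln_sub.
Qed.

Lemma powR_expR x k : 0 < x -> x `^ k = expR (k * ln x).
Proof. by move=> x0; rewrite /powR gt_eqF. Qed.

Definition ln_bound m M : R := `|ln m| + `|ln M|.

Lemma ln_bound_ge0 m M : 0 <= ln_bound m M.
Proof. exact: addr_ge0. Qed.

Lemma norm_ln_le m M x : 0 < m -> m <= x <= M -> `|ln x| <= ln_bound m M.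
Proof.
move=> m0 /andP[mx xM]; have x0 := lt_le_trans m0 mx; have M0 := lt_le_trans x0 xM.
have lnmx : ln m <= ln x by rewrite ler_ln ?posrE.
have lnxM : ln x <= ln M by rewrite ler_ln ?posrE.
rewrite /ln_bound ler_norml; have := ler_norm (ln M); have := ler_norm (- ln m).
by rewrite normrN; have := normr_ge0 (ln m); have := normr_ge0 (ln M); lra.
Qed.

Lemma powR_le_expR m M x k : 0 < m -> m <= x <= M ->
  x `^ k <= expR (`|k| * ln_bound m M).
Proof.
move=> m0 xmM; have x0 : 0 < x by case/andP: xmM => /(lt_le_trans m0).
rewrite powR_expR // ler_expR (le_trans (ler_norm _)) // normrM ler_wpM2l //.
exact: norm_ln_le.
Qed.

Lemma expR_secant_le k w K L : `|k| <= K -> `|w| <= L ->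
  `|expR (k * w) - 1 - k * (expR w - 1)| <=
  (1 + expR ((K + 1) * L)) * (K ^+ 2 + K) * w ^+ 2.
Proof.
move=> kK wL; have K0 : 0 <= K := le_trans (normr_ge0 k) kK.
have L0 : 0 <= L := le_trans (normr_ge0 w) wL.
have kwL : k * w <= (K + 1) * L.
  by rewrite (le_trans (ler_norm _)) // normrM ler_pM // (le_trans kK) // lerDl.
have wKL : w <= (K + 1) * L.
  by rewrite (le_trans (ler_norm _)) // -[`|w|]mul1r ler_pM // lerDr.
have := expR_taylor2 kwL; have := expR_taylor2 wKL.
move: (expR_ge0 ((K + 1) * L)); set D := expR ((K + 1) * L) => D0 tw tkw.
have -> : expR (k * w) - 1 - k * (expR w - 1) =
    (expR (k * w) - 1 - k * w) - k * (expR w - 1 - w) by ring.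
rewrite (le_trans (ler_normB _ _)) // normrM.
have k2 : k ^+ 2 <= K ^+ 2 by rewrite -[k ^+ 2]real_normK ?num_real // ler_pXn2r ?nnegrE.
have : (1 + D) * (k * w) ^+ 2 <= (1 + D) * (K ^+ 2 * w ^+ 2).
  by rewrite exprMn ler_wpM2l ?addr_ge0 // ler_wpM2r // sqr_ge0.
have : `|k| * `|expR w - 1 - w| <= K * ((1 + D) * w ^+ 2) by apply: ler_pM.
by lra.
Qed.

(* With w = ln x - ln y, x^k = y^k e^(k w) and x = y e^w, so the remainder is
   y^k times the one bounded in [expR_secant_le]. *)
Lemma powR_taylor2 m M (K : R) : 0 < m -> exists D : R, 0 <= D /\
  forall k x y, `|k| <= K -> m <= x <= M -> m <= y <= M ->
  `|x `^ k - y `^ k - k * y `^ (k - 1) * (x - y)| <= D * (x - y) ^+ 2.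
Proof.
move=> m0; pose L := ln_bound m M; pose B := expR (`|K| * L).
pose D := (1 + expR ((`|K| + 1) * (2 * L))) * (`|K| ^+ 2 + `|K|).
exists (B * (D * m ^- 2)); split.
  rewrite !mulr_ge0 ?addr_ge0 ?expR_ge0 ?sqr_ge0 //.
  by rewrite invr_ge0 exprn_ge0 // ltW.
move=> k x y kK mxM myM.
have kK' : `|k| <= `|K| by rewrite (le_trans kK) // ler_norm.
have /andP[mx _] := mxM; have /andP[my _] := myM.
have x0 := lt_le_trans m0 mx; have y0 := lt_le_trans m0 my.
pose w := ln x - ln y.
have wL : `|w| <= 2 * L.
  have := norm_ln_le m0 mxM; have := norm_ln_le m0 myM.
  by have := ler_normB (ln x) (ln y); rewrite /w -/L; lra.
have -> : x `^ k - y `^ k - k * y `^ (k - 1) * (x - y) =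
    y `^ k * (expR (k * w) - 1 - k * (expR w - 1)).
  have -> : x `^ k = y `^ k * expR (k * w).
    by rewrite !powR_expR // -expRD /w; congr expR; ring.
  have -> : y `^ k = y * y `^ (k - 1).
    by rewrite !powR_expR // -{2}[y]lnK ?posrE // -expRD; congr expR; ring.
  by rewrite /w expRB !lnK ?posrE //; field; rewrite gt_eqF.
rewrite normrM ger0_norm ?powR_ge0 // -mulrA ler_pM ?powR_ge0 //.
  by rewrite (le_trans (powR_le_expR k m0 myM)) // ler_expR ler_wpM2r ?ln_bound_ge0.
apply: le_trans (expR_secant_le kK' wL) _; rewrite -/D -[leRHS]mulrA ler_wpM2l //.
  by rewrite mulr_ge0 ?addr_ge0 ?sqr_ge0 ?expR_ge0.
rewrite -exprVn -exprMn -[w ^+ 2]real_normK ?num_real //.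
rewrite -[(_ * _) ^+ 2]real_normK ?num_real // ler_pXn2r ?nnegrE //.
by rewrite normrM [`|m^-1|]gtr0_norm ?invr_gt0 // mulrC; exact: ln_lipschitz.
Qed.

Lemma powR_uniform_derive m M g (g1 : R) : 0 < m -> is_derive (0 : R) (1 : R) g g1 ->
  uniform_littleo [set x | m <= x <= M]
    (fun t x => x `^ g t - x `^ g 0 - t * (g1 * (x `^ g 0 * ln x))).
Proof.
move=> m0 dg; pose L := ln_bound m M; have L0 : 0 <= L := ln_bound_ge0 m M.
pose B := expR (`|g 0| * L); pose G := 1 + `|g1|.
have G0 : 0 <= G by rewrite addr_ge0.
have GL1 : 0 < G * L + 1 by rewrite ltr_wpDl // mulr_ge0.
pose rem t x := (1 + expR 1) * (G * L) ^+ 2 * t ^+ 2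
  + L * `|g t - g 0 - t * g1|.
apply: (@uniform_littleo_le _ _ _ _ rem B).
  apply: uniform_littleoD.
    apply: (uniform_littleo_le (K := (1 + expR 1) * (G * L) ^+ 2)).
      exact: uniform_littleo_sqr.
    by near=> t => x _; rewrite normrM ger0_norm // mulr_ge0 ?sqr_ge0.
  apply: (uniform_littleo_le (K := L)).
    have := dg => /is_derive0P; exact: (uniform_littleo_comp (phi := fun=> tt)).
  by near=> t => x _; rewrite normrM normr_id ger0_norm.
near=> t => x /= xmM; have x0 : 0 < x by case/andP: xmM => /(lt_le_trans m0).
have lnx : `|ln x| <= L := norm_ln_le m0 xmM.
pose u := (g t - g 0) * ln x.
have uGL : `|u| <= G * L * `|t|.
  rewrite normrM mulrAC ler_pM //; near: t; exact: is_derive0_lipschitz.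
have u1 : u <= 1.
  rewrite (le_trans (ler_norm _)) // (le_trans uGL) //.
  apply: (@le_trans _ _ ((G * L + 1) * `|t|)); first by rewrite ler_wpM2r // lerDl.
  rewrite -ler_pdivlMl // mulr1; near: t.
  by apply: (@nbhs0_le R R^o); rewrite invr_gt0.
have -> : x `^ g t - x `^ g 0 - t * (g1 * (x `^ g 0 * ln x)) =
    x `^ g 0 * ((expR u - 1 - u) + (g t - g 0 - t * g1) * ln x).
  have -> : x `^ g t = x `^ g 0 * expR u.
    by rewrite !powR_expR // -expRD /u; congr expR; ring.
  by rewrite /u; ring.
rewrite normrM ger0_norm ?powR_ge0 // ler_pM ?powR_ge0 ?powR_le_expR //.
rewrite (le_trans _ (ler_norm _)) // (le_trans (ler_normD _ _)) // lerD //.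
  rewrite (le_trans (expR_taylor2 u1)) // -mulrA ler_wpM2l ?addr_ge0 ?expR_ge0 //.
  rewrite -exprMn -[u ^+ 2]real_normK ?num_real // -[leRHS]real_normK ?num_real //.
  by rewrite ler_pXn2r ?nnegrE // [leRHS]normrM [`|G * L|]ger0_norm // mulr_ge0.
by rewrite normrM mulrC ler_wpM2r.
Unshelve. all: by end_near. Qed.

End ScalarExpansions.

Section MatrixNorm.
Variables (R : realType) (C : complexification R).
Local Notation "x %:C" := (embed C x) : ring_scope.

Definition normmx m n (A : 'M[C]_(m, n)) : R := \sum_i \sum_j re `|A i j|.

Lemma re_norm_le_add (z w : C) : re `|z + w| <= re `|z| + re `|w|.
Proof. by rewrite -raddfD -subr_ge0 -raddfB re_ge0 // subr_ge0 ler_normD. Qed.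

Lemma re_normM (z w : C) : re `|z * w| = re `|z| * re `|w|.
Proof. by rewrite normrM -{1}(embed_norm z) re_mulr. Qed.

Lemma re_norm_embed x : re `|x%:C| = `|x|.
Proof.
have [x0|x0] := leP 0 x; first by rewrite !ger0_norm ?embed_ge0 // embedK.
by rewrite -(normrN x%:C) -rmorphN ger0_norm ?embed_ge0 ?oppr_ge0 ?ltW // embedK ltr0_norm.
Qed.

Lemma norm_re_le (z : C) : `|re z| <= re `|z|.
Proof.
rewrite -re_norm_embed embed_re -subr_ge0 -raddfB re_ge0 // subr_ge0.
exact: leif_normC_Re_Creal.
Qed.

Lemma re_norm_sum_le (I : Type) (r : seq I) (P : pred I) (F : I -> C) :
  re `|\sum_(i <- r | P i) F i| <= \sum_(i <- r | P i) re `|F i|.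
Proof.
elim/big_rec2: _ => [|i x z _ zx]; first by rewrite normr0 raddf0.
by rewrite (le_trans (re_norm_le_add _ _)) // lerD2l.
Qed.

Section Size.
Variables m n : nat.
Implicit Types A B : 'M[C]_(m, n).

Lemma normmx_ge0 A : 0 <= normmx A.
Proof. by rewrite sumr_ge0 // => i _; rewrite sumr_ge0 // => j _; exact: re_norm_ge0. Qed.

Lemma normmx0 : normmx (0 : 'M[C]_(m, n)) = 0.
Proof. by rewrite /normmx !big1 // => i _; rewrite big1 // => j _; rewrite mxE normr0 raddf0. Qed.

Lemma ler_normmxD A B : normmx (A + B) <= normmx A + normmx B.
Proof.
rewrite /normmx -big_split; apply: ler_sum => i _; rewrite -big_split.
by apply: ler_sum => j _; rewrite mxE re_norm_le_add.
Qed.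

Lemma normmxZ c A : normmx (c%:C *: A) = `|c| * normmx A.
Proof.
rewrite /normmx mulr_sumr; apply: eq_bigr => i _; rewrite mulr_sumr.
by apply: eq_bigr => j _; rewrite mxE re_normM re_norm_embed.
Qed.

Lemma normmx_le A c : (forall i j, re `|A i j| <= c) -> normmx A <= (m * n)%:R * c.
Proof.
move=> Ac; apply: (@le_trans _ _ (\sum_(i < m) \sum_(j < n) c)).
  by apply: ler_sum => i _; apply: ler_sum => j _.
by rewrite !sumr_const !card_ord -mulrnA mulr_natl mulnC.
Qed.

End Size.

Lemma ler_normmxM m n p (A : 'M[C]_(m, n)) (B : 'M[C]_(n, p)) :
  normmx (A *m B) <= normmx A * normmx B.
Proof.
rewrite /normmx mulr_suml; apply: ler_sum => i _.
apply: (@le_trans _ _ (\sum_k \sum_j re `|A i j| * re `|B j k|)).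
  apply: ler_sum => k _; rewrite mxE (le_trans (re_norm_sum_le _ _ _)) //.
  by apply: ler_sum => j _; rewrite re_normM.
rewrite exchange_big mulr_suml; apply: ler_sum => j _ /=.
rewrite -mulr_sumr ler_wpM2l ?re_norm_ge0 // (bigD1 j) //= lerDl sumr_ge0 // => l _.
by rewrite sumr_ge0 // => k _; exact: re_norm_ge0.
Qed.

Section Square.
Variable n : nat.
Implicit Types A B : 'M[C]_n.

Lemma norm_trR_le A : `|trR A| <= normmx A.
Proof.
rewrite /trR raddf_sum (le_trans (ler_norm_sum _ _ _)) //; apply: ler_sum => i _.
rewrite (bigD1 i) //= (le_trans (norm_re_le _)) // lerDl sumr_ge0 // => j _.
exact: re_norm_ge0.
Qed.

Lemma trR_sqr_le A : trR (A *m A) <= normmx A ^+ 2.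
Proof. by rewrite (le_trans (ler_norm _)) // (le_trans (norm_trR_le _)) // ler_normmxM. Qed.

Lemma unit_row_le1 (v : 'rV[C]_n) j : v *m v^t* = 1%:M -> re `|v 0 j| <= 1.
Proof.
move=> /matrixP/(_ 0 0); rewrite mulmx_trmxC00 mxE eqxx => /(congr1 re).
rewrite raddf_sum -(rmorph1 (embed C)) embedK (bigD1 j) //= expr2 -normrM re_normM => v1.
have : 0 <= \sum_(i < n | i != j) re (`|v 0 i| ^+ 2).
  by rewrite sumr_ge0 // => i _; apply: re_ge0; rewrite exprn_ge0.
by have := re_norm_ge0 (v 0 j); nra.
Qed.

Lemma spectralmx_le1 A i j : re `|spectralmx A i j| <= 1.
Proof. by have := unit_row_le1 j (eigrow_unit A i); rewrite mxE. Qed.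

Lemma norm_eig_le A i : hermmx A -> `|eig A i| <= normmx A.
Proof.
move=> hA; rewrite -re_norm_embed.
have <- : (eigrow A i *m A *m (eigrow A i)^t*) 0 0 = (eig A i)%:C.
  by rewrite -{2}(mxfun_id hA) eigrow_mxfun_form.
rewrite mxE (le_trans (re_norm_sum_le _ _ _)) // /normmx exchange_big.
apply: ler_sum => j _; rewrite re_normM !mxE norm_conjC.
have v1 k : re `|eigrow A i 0 k| <= 1 := unit_row_le1 k (eigrow_unit A i).
have vA : re `|\sum_k eigrow A i 0 k * A k j| <= \sum_k re `|A k j|.
  rewrite (le_trans (re_norm_sum_le _ _ _)) //; apply: ler_sum => k _.
  by rewrite re_normM ler_piMl ?re_norm_ge0.
apply: le_trans vA; rewrite ler_piMr ?re_norm_ge0 //.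
by have := v1 j; rewrite mxE.
Qed.

Lemma normmx_mxfun_le f A c : (forall i, `|f (eig A i)| <= c) ->
  normmx (mxfun f A) <= (n ^ 3)%:R * c.
Proof.
move=> fc; rewrite expnSr natrM -mulrA -mulnn.
apply: normmx_le => i j; rewrite mxfunE /realdiag /simdiag -spectralmx_trmxC.
rewrite mul_mx_diag mxE (le_trans (re_norm_sum_le _ _ _)) //.
rewrite -[n in n%:R]card_ord mulr_natl -sumr_const; apply: ler_sum => l _.
rewrite !mxE !re_normM norm_conjC re_norm_embed /=.
have Ui := spectralmx_le1 A l i; have Uj := spectralmx_le1 A l j.
have c0 : 0 <= c := le_trans (normr_ge0 _) (fc l).
apply: (@le_trans _ _ (1 * c * 1)); last by rewrite mul1r mulr1.
by rewrite !ler_pM ?mulr_ge0 ?re_norm_ge0.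
Qed.

Definition spectrum_in (l u : R) A := hermmx A /\ forall i, l <= eig A i <= u.

Definition min_eig A : R := \big[Num.min/1]_i eig A i.

Lemma min_eig_gt0 A : pdmx A -> 0 < min_eig A.
Proof. by move=> pA; apply: lt_bigmin => // i _; exact: pdmx_eig. Qed.

Lemma min_eig_le A i : min_eig A <= eig A i.
Proof. exact: bigmin_le_cond. Qed.

Lemma min_eig_trR_le A X : hermmx A -> psdmx X -> min_eig A * trR X <= trR (A *m X).
Proof.
move=> hA pX; have /eig_geP geA := @min_eig_le A.
by have := trR_mulmx_ge0 (geA hA) pX; rewrite mulmxBl trRB mul_scalar_mx trRZ subr_ge0.
Qed.

Lemma pdmx_faithful A X : pdmx A -> psdmx X -> trR (A *m X) = 0 -> X = 0.
Proof.
move=> pA pX AX0; apply: psdmx_trR_eq0 => //; apply/le_anti; rewrite psdmx_trR_ge0 // andbT.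
by rewrite -(pmulr_rle0 _ (min_eig_gt0 pA)) -AX0 min_eig_trR_le //; exact: pdmx_herm.
Qed.

Lemma psdmx_eig_le_trR A i : psdmx A -> eig A i <= trR A.
Proof.
move=> pA; rewrite (trR_hermmx (psdmx_herm pA)) (bigD1 i) //= lerDl.
by apply: sumr_ge0 => j _; exact: psdmx_eig.
Qed.

Lemma pdmx_spectrum_in A : pdmx A -> exists l u : R, 0 < l /\ spectrum_in l u A.
Proof.
move=> pA; exists (min_eig A), (trR A); split; first exact: min_eig_gt0.
split=> [|i]; first exact: pdmx_herm.
by rewrite min_eig_le psdmx_eig_le_trR //; exact: pdmx_psd.
Qed.

Lemma spectrum_in_pd l u A : 0 < l -> spectrum_in l u A -> pdmx A.
Proof.
move=> l0 [hA Alu]; apply/pdmxP; split=> // i.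
by apply: lt_le_trans l0 _; case/andP: (Alu i).
Qed.

Lemma spectrum_in_perturb l u A B : hermmx A -> spectrum_in l u B ->
  spectrum_in (l - normmx (A - B)) (u + normmx (A - B)) A.
Proof.
move=> hA [hB Blu]; set d := normmx _; split=> // i.
have hAB : hermmx (A - B) := hermmxB hA hB.
have ABd j : - d <= eig (A - B) j <= d by rewrite -ler_norml norm_eig_le.
have /eig_geP lB : forall j, l <= eig B j by move=> j; case/andP: (Blu j).
have /eig_leP Bu : forall j, eig B j <= u by move=> j; case/andP: (Blu j).
have /eig_geP dAB : forall j, - d <= eig (A - B) j by move=> j; case/andP: (ABd j).
have /eig_leP ABd' : forall j, eig (A - B) j <= d by move=> j; case/andP: (ABd j).
apply/andP; split; move: i.
  apply/eig_geP => //; have := psdmxD (lB hB) (dAB hAB).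
  by rewrite addrACA subrKC -opprD -raddfD -rmorphD.
apply/eig_leP => //; have := psdmxD (Bu hB) (ABd' hAB).
by rewrite addrACA -opprD subrKC -raddfD -rmorphD.
Qed.

End Square.

End MatrixNorm.

Section UniformDerivative.
Variables (R : realType) (C : complexification R) (n : nat).
Local Notation "x %:C" := (embed C x) : ring_scope.

Section Family.
Variables (I : Type) (T : set I).
Implicit Types (F G : R -> I -> 'M[C]_n) (dF dG : I -> 'M[C]_n).

Definition uniform_bounded dF := exists K : R, forall i, T i -> normmx (dF i) <= K.

(* The analogue of [is_derive 0 1] for families of matrices, uniformly on T. *)
Definition is_uderive F dF :=
  [/\ uniform_bounded (F 0), uniform_bounded dF &
      uniform_littleo T (fun t i => normmx (F t i - F 0 i - t%:C *: dF i))].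

Lemma uniform_boundedD dF dG : uniform_bounded dF -> uniform_bounded dG ->
  uniform_bounded (fun i => dF i + dG i).
Proof.
move=> [K FK] [L GL]; exists (K + L) => i Ti.
by rewrite (le_trans (ler_normmxD _ _)) // lerD ?FK ?GL.
Qed.

Lemma uniform_boundedM dF dG : uniform_bounded dF -> uniform_bounded dG ->
  uniform_bounded (fun i => dF i *m dG i).
Proof.
move=> [K FK] [L GL]; exists (K * L) => i Ti.
by rewrite (le_trans (ler_normmxM _ _)) // ler_pM ?normmx_ge0 ?FK ?GL.
Qed.

Lemma is_uderive_lipschitz F dF : is_uderive F dF -> exists K : R,
  \forall t \near (0 : R), forall i, T i -> normmx (F t i - F 0 i) <= K * `|t|.
Proof.
move=> [_ [K dFK] oF]; exists (1 + K); near=> t => i Ti.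
rewrite -[F t i - F 0 i](subrK (t%:C *: dF i)) (le_trans (ler_normmxD _ _)) //.
rewrite mulrDl; apply: lerD; last by rewrite normmxZ [leRHS]mulrC ler_wpM2l ?dFK.
apply: le_trans (ler_norm _) _; move: i Ti; near: t; exact: oF.
Unshelve. all: by end_near. Qed.

Lemma is_uderive_bounded F dF : is_uderive F dF -> exists K : R,
  \forall t \near (0 : R), forall i, T i -> normmx (F t i) <= K.
Proof.
move=> hF; have [K FK] := is_uderive_lipschitz hF; have [[L F0L] _ _] := hF.
exists (`|K| + L); near=> t => i Ti; rewrite -[F t i](subrK (F 0 i)).
rewrite (le_trans (ler_normmxD _ _)) // lerD ?F0L //.
apply: (@le_trans _ _ (K * `|t|)); first by move: i Ti; near: t.
apply: (@le_trans _ _ (`|K| * `|t|)); first by rewrite ler_wpM2r ?ler_norm.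
by rewrite ler_piMr //; near: t; exact: (@nbhs0_le R R^o).
Unshelve. all: by end_near. Qed.

Lemma is_uderive_cst dF : uniform_bounded dF -> is_uderive (fun=> dF) (fun=> 0).
Proof.
move=> bF; split=> //; first by exists 0 => i _; rewrite normmx0.
move=> e e0; near=> t => i _.
by rewrite subrr scaler0 subr0 normmx0 normr0 mulr_ge0 // ltW.
Unshelve. all: by end_near. Qed.

Lemma is_uderiveD F dF G dG : is_uderive F dF -> is_uderive G dG ->
  is_uderive (fun t i => F t i + G t i) (fun i => dF i + dG i).
Proof.
move=> [bF0 bF1 oF] [bG0 bG1 oG]; split; [exact: uniform_boundedD..|].
apply: (uniform_littleo_le (K := 1) (uniform_littleoD oF oG)).
near=> t => i _; rewrite mul1r !ger0_norm ?addr_ge0 ?normmx_ge0 //.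
rewrite (_ : F t i + G t i - _ - _ =
  (F t i - F 0 i - t%:C *: dF i) + (G t i - G 0 i - t%:C *: dG i)) ?ler_normmxD //.
by rewrite scalerDr !opprD !addrA !(addrAC _ _ (G t i)) !(addrAC _ _ (- G 0 i)).
Unshelve. all: by end_near. Qed.

Lemma is_uderiveM F dF G dG : is_uderive F dF -> is_uderive G dG ->
  is_uderive (fun t i => F t i *m G t i) (fun i => F 0 i *m dG i + dF i *m G 0 i).
Proof.
move=> [bF0 bF1 oF] hG; have [bG0 bG1 oG] := hG; split.
- exact: uniform_boundedM.
- by apply: uniform_boundedD; apply: uniform_boundedM.
have [K F0K] := bF0; have [K1 dFK] := bF1.
have [L GL] := is_uderive_bounded hG; have [L1 GL1] := is_uderive_lipschitz hG.
pose r t i := normmx (F t i - F 0 i - t%:C *: dF i).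
pose s t i := normmx (G t i - G 0 i - t%:C *: dG i).
have ro : uniform_littleo T (fun t i => L * r t i + K * s t i + K1 * L1 * t ^+ 2).
  apply: uniform_littleoD; first apply: uniform_littleoD.
  - by apply: (uniform_littleo_le (K := `|L|) oF); near=> t => i _; rewrite normrM.
  - by apply: (uniform_littleo_le (K := `|K|) oG); near=> t => i _; rewrite normrM.
  apply: (uniform_littleo_le (K := `|K1 * L1|) (uniform_littleo_sqr _)).
  by near=> t => i _; rewrite normrM.
apply: (uniform_littleo_le (K := 1) ro); near=> t => i Ti.
rewrite mul1r ger0_norm ?normmx_ge0 // (le_trans _ (ler_norm _)) //.
have -> : F t i *m G t i - F 0 i *m G 0 i
      - t%:C *: (F 0 i *m dG i + dF i *m G 0 i) =
    (F t i - F 0 i - t%:C *: dF i) *m G t i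
    + F 0 i *m (G t i - G 0 i - t%:C *: dG i)
    + t%:C *: (dF i *m (G t i - G 0 i)).
  rewrite !mulmxBl !mulmxBr -!scalemxAl -!scalemxAr scalerDr scalerBr.
  move: (F t i *m _) (F 0 i *m G t i) (F 0 i *m G 0 i) => x y z.
  move: (_ *: (dF i *m G t i)) (_ *: (dF i *m G 0 i)) (_ *: (F 0 i *m _)) => a b c.
  by apply/matrixP => j k; rewrite !mxE; ring.
have [GLt GL1t] : normmx (G t i) <= L /\ normmx (G t i - G 0 i) <= L1 * `|t|.
  by split; move: i Ti; near: t.
rewrite (le_trans (ler_normmxD _ _)) // lerD //.
  rewrite (le_trans (ler_normmxD _ _)) // lerD // (le_trans (ler_normmxM _ _)) //.
    by rewrite mulrC ler_wpM2r ?normmx_ge0.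
  by rewrite ler_wpM2r ?normmx_ge0 ?F0K.
rewrite normmxZ -[t ^+ 2]real_normK ?num_real // expr2 mulrC mulrA ler_wpM2r //.
by rewrite (le_trans (ler_normmxM _ _)) // -mulrA ler_pM ?normmx_ge0 ?dFK.
Unshelve. all: by end_near. Qed.

Lemma is_uderive_scalar (g : R -> R) (g1 : R) : is_derive (0 : R) (1 : R) g g1 ->
  is_uderive (fun t _ => (g t)%:C%:M) (fun=> g1%:C%:M).
Proof.
have bounded_cst (A : 'M[C]_n) : uniform_bounded (fun=> A) by exists (normmx A).
move=> dg; split; [exact: bounded_cst..|].
have /is_derive0P og := dg.
apply: (uniform_littleo_le (K := normmx (1%:M : 'M[C]_n))
  (uniform_littleo_comp (phi := fun=> tt) (U := T) (fun _ _ => Logic.I) og)).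
near=> t => i _; rewrite ger0_norm ?normmx_ge0 // mulrC -normmxZ scalemx1.
by rewrite scale_scalar_mx -rmorphM -!raddfB.
Unshelve. all: by end_near. Qed.

Lemma is_uderive_trR F dF : is_uderive F dF ->
  uniform_littleo T (fun t i => trR (F t i) - trR (F 0 i) - t * trR (dF i)).
Proof.
move=> [_ _ oF]; apply: (uniform_littleo_le (K := 1) oF); near=> t => i _.
by rewrite mul1r -trRZ -!trRB [leRHS]ger0_norm ?normmx_ge0 ?norm_trR_le.
Unshelve. all: by end_near. Qed.

Lemma is_uderive_eq F dF dG : (forall i, T i -> dF i = dG i) ->
  is_uderive F dF -> is_uderive F dG.
Proof.
move=> FG [bF0 [K dFK] oF]; split=> //; first by exists K => i Ti; rewrite -FG ?dFK.
by move=> e /oF; apply: filterS => t Ft i Ti; rewrite -FG ?Ft.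
Qed.

End Family.

Lemma is_uderive_comp (I J : Type) (T : set I) (U : set J) (phi : J -> I)
    (F : R -> I -> 'M[C]_n) dF : (forall j, U j -> T (phi j)) ->
  is_uderive T F dF -> is_uderive U (fun t j => F t (phi j)) (fun j => dF (phi j)).
Proof.
move=> UT [[K F0K] [K1 dFK] oF]; split; last exact: uniform_littleo_comp UT oF.
  by exists K => j /UT; exact: F0K.
by exists K1 => j /UT; exact: dFK.
Qed.

Lemma is_uderive_mxpow (l u : R) (g : R -> R) (g1 : R) : 0 < l ->
  is_derive (0 : R) (1 : R) g g1 ->
  is_uderive [set A : 'M[C]_n | spectrum_in l u A] (fun t A => mxpow (g t) A)
    (fun A => g1%:C *: (mxpow (g 0) A *m mxlog A)).
Proof.
move=> l0 dg; pose L := ln_bound l u; pose B := expR (`|g 0| * L).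
have powB A i : spectrum_in l u A -> `|eig A i `^ g 0| <= B.
  by move=> [_ lAu]; rewrite ger0_norm ?powR_ge0 // powR_le_expR.
split.
- by exists ((n ^ 3)%:R * B) => A Alu; apply: normmx_mxfun_le => i; exact: powB.
- exists ((n ^ 3)%:R * (`|g1| * (B * L))) => A Alu.
  rewrite mxfunM mxfunZ; apply: normmx_mxfun_le => i; rewrite !normrM.
  by rewrite ler_wpM2l // ler_pM ?powB ?(norm_ln_le l0) //; case: Alu.
have n1 : 0 < (n ^ 3)%:R + 1 :> R by rewrite ltr_wpDl.
move=> e e0; have e1 : 0 < e / ((n ^ 3)%:R + 1) by rewrite divr_gt0.
near=> t => A [hA lAu]; rewrite ger0_norm ?normmx_ge0 //.
rewrite mxfunM !mxfunZ !mxfunB.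
apply: (@le_trans _ _ ((n ^ 3)%:R * (e / ((n ^ 3)%:R + 1) * `|t|))).
  apply: normmx_mxfun_le => i; move: (eig A i) (lAu i); near: t.
  exact: (powR_uniform_derive u l0 dg).
rewrite mulrA ler_wpM2r // mulrCA ler_piMr ?(ltW e0) // ler_pdivrMr // mul1r.
by rewrite lerDl.
Unshelve. all: by end_near. Qed.

End UniformDerivative.

Section TracePowerDerivative.
Variables (R : realType) (C : complexification R) (n : nat).
Variables (J : Type) (T : set J) (H : R -> J -> 'M[C]_n) (dH : J -> 'M[C]_n).
Variables (A : 'M[C]_n) (r : R -> R) (r1 : R).
Hypotheses (pA : pdmx A) (H0 : forall i, T i -> H 0 i = A).
Hypotheses (hH : is_uderive T H dH) (dr : is_derive (0 : R) (1 : R) r r1).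
Hypothesis herm_H : \forall t \near (0 : R), forall i, T i -> hermmx (H t i).

Lemma trR_mxpow_taylor : uniform_littleo T (fun t i =>
  trR (mxpow (r t) (H t i)) - trR (mxpow (r t) A)
  - r t * trR (mxpow (r t - 1) A *m (H t i - A))).
Proof.
have [l [u [l0 sA]]] := pdmx_spectrum_in pA.
have l2 : 0 < l / 2 by rewrite divr_gt0.
have [D [D0 taylor]] := powR_taylor2 (u + l / 2) (`|r 0| + (1 + `|r1|)) l2.
have [K HK] := is_uderive_lipschitz hH.
have K1 : 0 < `|K| + 1 by rewrite ltr_wpDl.
apply: (uniform_littleo_le (K := D * K ^+ 2) (uniform_littleo_sqr _)).
near=> t => i Ti; rewrite [`|t ^+ 2|]ger0_norm ?sqr_ge0 //.
have [HAK hHt] : normmx (H t i - A) <= K * `|t| /\ hermmx (H t i).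
  by split; [rewrite -(H0 Ti)|]; move: i Ti; near: t.
have rt : `|r t| <= `|r 0| + (1 + `|r1|).
  rewrite -[r t](subrKC (r 0)) (le_trans (ler_normD _ _)) // lerD2l.
  apply: (@le_trans _ _ ((1 + `|r1|) * `|t|)).
    by near: t; exact: is_derive0_lipschitz.
  by rewrite ler_piMr //; near: t; exact: (@nbhs0_le R R^o).
have HAl : normmx (H t i - A) <= l / 2.
  apply: le_trans HAK _; apply: (@le_trans _ _ ((`|K| + 1) * `|t|)).
    by rewrite ler_wpM2r // (le_trans (ler_norm K)) // lerDl.
  rewrite -ler_pdivlMl //; near: t.
  by apply: (@nbhs0_le R R^o); rewrite mulr_gt0 ?invr_gt0.
have [_ sH] := spectrum_in_perturb hHt sA.
have := trR_mxfun_taylor (f := fun x => x `^ r t) (f' := fun x => r t * x `^ (r t - 1))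
  (K := D) hHt (pdmx_herm pA).
rewrite -mxfunZ -scalemxAl trRZ => taylor_rt; apply: le_trans (taylor_rt _) _.
  move=> j k; apply: taylor => //.
    by have := sH j; move: HAl; lra.
  by have := sA.2 k; move: l0; lra.
rewrite -mulrA -exprMn ler_wpM2l // (le_trans (trR_sqr_le _)) //.
rewrite -[leRHS]real_normK ?num_real // ler_pXn2r ?nnegrE ?normmx_ge0 //.
by rewrite (le_trans HAK) // normrM ler_wpM2r ?ler_norm.
Unshelve. all: by end_near. Qed.

Lemma is_uderive_trR_mxpow : uniform_littleo T (fun t i =>
  trR (mxpow (r t) (H t i)) - trR (mxpow (r 0) A)
  - t * (r1 * trR (mxpow (r 0) A *m mxlog A)
         + r 0 * trR (mxpow (r 0 - 1) A *m dH i))).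
Proof.
have [l [u [l0 sA]]] := pdmx_spectrum_in pA.
have dpow (g : R -> R) (g1 : R) (dg : is_derive (0 : R) (1 : R) g g1) :=
  is_uderive_comp (phi := fun=> A) (U := T) (fun _ _ => sA)
    (@is_uderive_mxpow R C n l u g g1 l0 dg).
have dr1 : is_derive (0 : R) (1 : R) (fun t => r t - 1) r1.
  by rewrite -[r1]subr0; exact: is_deriveB.
have bA : uniform_bounded T (fun=> - A) by exists (normmx (- A)).
have dG := is_uderiveD (dpow _ _ dr)
  (is_uderiveM (is_uderiveM (is_uderive_scalar C n T dr) (dpow _ _ dr1))
    (is_uderiveD hH (is_uderive_cst bA))).
have oG := uniform_littleoD trR_mxpow_taylor (is_uderive_trR dG).
apply: near_eq_uniform_littleo oG; near=> t => i Ti /=.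
rewrite !H0 // !subrr !(mulmx0, addr0) !mul_scalar_mx -!scalemxAl !trRD !trRZ.
ring.
Unshelve. all: by end_near. Qed.

End TracePowerDerivative.

(** * Weighted Schatten norms *)
Section SchattenForm.
Variables (R : realType) (C : complexification R) (n : nat).
Local Notation "x %:C" := (embed C x) : ring_scope.
Implicit Types (L Q X Z x y : 'M[C]_n) (k c d : R).

(* The k-th power trace of |L Z Q|^2, as a function of x = L^* L and y = Q Q^*. *)
Definition schatten_form k x Z y : R :=
  trR (mxpow k (mxpow 2^-1 x *m Z *m y *m Z^t* *m mxpow 2^-1 x)).

Lemma schatten_formE k L Z Q :
  trR (mxpow k ((L *m Z *m Q)^t* *m (L *m Z *m Q))) =
  schatten_form k (L^t* *m L) Z (Q *m Q^t*).
Proof.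
rewrite /schatten_form; set h := mxpow 2^-1 _; have hh : h^t* = h := mxpow_herm _ _.
pose X := (Z *m Q)^t* *m h.
have -> : (L *m Z *m Q)^t* *m (L *m Z *m Q) = X *m X^t*.
  rewrite /X (trmxC_mul _ h) hh trmxCK -(mulmxA L) trmxC_mul !mulmxA.
  by rewrite -(mulmxA _ h h) mxpow_sqrt ?mulmxA //; exact: psdmx_trmxC_mulmx.
have -> : h *m Z *m (Q *m Q^t*) *m Z^t* *m h = X^t* *m X.
  by rewrite /X trmxC_mul hh trmxCK trmxC_mul !mulmxA.
exact: trR_mxfun_trmxC.
Qed.

Lemma schatten_form11 k Z : schatten_form k 1%:M Z 1%:M = trR (mxpow k (Z^t* *m Z)).
Proof. by have := schatten_formE k 1%:M Z 1%:M; rewrite trmxC1 !mul1mx !mulmx1. Qed.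

Lemma schatten_formC k x Z y : psdmx x -> psdmx y ->
  schatten_form k x Z y = schatten_form k y (Z^t*) x.
Proof.
move=> px py; have hx := mxpow_herm 2^-1 x; have hy := mxpow_herm 2^-1 y.
have := schatten_formE k (mxpow 2^-1 y) (Z^t*) (mxpow 2^-1 x).
rewrite hx hy !mxpow_sqrt // => <-; congr (trR (mxpow k _)).
rewrite !trmxC_mul hx hy trmxCK !mulmxA.
by rewrite -(mulmxA _ (mxpow 2^-1 y) (mxpow 2^-1 y)) mxpow_sqrt.
Qed.

Lemma schatten_form_le k x x' Z y y' : 0 < k -> psdmx x -> psdmx y ->
  x \preceq x' -> y \preceq y' -> schatten_form k x Z y <= schatten_form k x' Z y'.
Proof.
move=> k0 px py xx' yy'; have py' := psdmx_le py yy'; have px' := psdmx_le px xx'.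
have mono u V v v' : psdmx v -> v \preceq v' ->
    schatten_form k u V v <= schatten_form k u V v'.
  move=> pv vv'; rewrite /schatten_form; set h := mxpow 2^-1 u.
  have hh : h^t* = h := mxpow_herm _ _.
  have congrE w : h *m V *m w *m V^t* *m h = h *m V *m w *m (h *m V)^t*.
    by rewrite trmxC_mul hh !mulmxA.
  rewrite !congrE; apply: trR_mxpow_le => //; first exact: psdmx_congr.
  exact: loewner_congr.
rewrite (le_trans (mono x _ _ _ py yy')) // schatten_formC // [leRHS]schatten_formC //.
exact: mono.
Qed.

Lemma schatten_formZ k c d x Z y : 0 <= c -> 0 <= d -> psdmx x -> psdmx y ->
  schatten_form k (c%:C *: x) Z (d%:C *: y) = (c * d) `^ k * schatten_form k x Z y.
Proof.
move=> c0 d0 px py; rewrite /schatten_form mxpowZ //.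
rewrite -!(scalemxAl, scalemxAr) !scalerA -!rmorphM.
have -> : c `^ 2^-1 * (c `^ 2^-1 * d) = c * d.
  by rewrite mulrA !powR12_sqrt // -expr2 sqr_sqrtr.
rewrite mxpowZ ?mulr_ge0 ?trRZ //; set h := mxpow 2^-1 x.
have -> : h *m Z *m y *m Z^t* *m h = h *m Z *m y *m (h *m Z)^t*.
  by rewrite trmxC_mul (mxpow_herm 2^-1 x) !mulmxA.
exact: psdmx_congr.
Qed.

End SchattenForm.

Section Norms.
Variables (R : realType) (C : complexification R) (n : nat).
Implicit Types (N : set 'M[C]_n) (E : 'M[C]_n -> 'M[C]_n).
Implicit Types (A B X Y : 'M[C]_n) (a b q s th : R).
Variable sigma : 'M[C]_n.

Definition mxabs Y : 'M[C]_n := mxpow 2^-1 (Y^t* *m Y).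

Definition schatten_norm th Y : R :=
  if th == 0 then \big[Num.max/0]_i eig (mxabs Y) i
  else trR (mxpow th^-1 (mxabs Y)) `^ th.

Definition Gamma s X : 'M[C]_n := mxpow (s / 2) sigma *m X *m mxpow (s / 2) sigma.

Definition weighted_norm th X : R := schatten_norm th (Gamma th X).

Definition amalgamated_inf N a b X : R :=
  inf [set v : R | exists A B Y, [/\ N A, N B, X = A *m Y *m B &
    v = weighted_norm ((a^-1 - b^-1) / 2) A * weighted_norm ((a^-1 - b^-1) / 2) B
        * weighted_norm b^-1 Y]].

Definition amalgamated_sup N b a X : R :=
  sup [set v : R | exists A B, [/\ N A, N B, A != 0, B != 0 &
    v = weighted_norm a^-1 (A *m X *m B)
        / (weighted_norm ((a^-1 - b^-1) / 2) A * weighted_norm ((a^-1 - b^-1) / 2) B)]].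

Definition amalgamated_norm N a b X : R :=
  if a <= b then amalgamated_inf N a b X else amalgamated_sup N a b X.

Definition relative_entropy E q Y : R :=
  let W := mxpow q (Gamma q^-1 Y) in
  q^-1 * trR (W *m (mxlog W - mxlog sigma
                    - mxlog (E (mxpow (- 2^-1) sigma *m W *m mxpow (- 2^-1) sigma)))).

Lemma schatten_norm_ge0 th Y : 0 <= schatten_norm th Y.
Proof.
rewrite /schatten_norm; case: ifP => _; last exact: powR_ge0.
by apply/bigmax_geP; left.
Qed.

Lemma weighted_norm_ge0 th X : 0 <= weighted_norm th X.
Proof. exact: schatten_norm_ge0. Qed.

Lemma weighted_normE th X : th != 0 ->
  weighted_norm th X = trR (mxpow (th^-1 / 2) ((Gamma th X)^t* *m Gamma th X)) `^ th.
Proof.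
by move=> /negPf th0; rewrite /weighted_norm /schatten_norm th0 mxpowM mulrC.
Qed.

Lemma weighted_norm_powR q X : 0 < q ->
  weighted_norm q^-1 X `^ q = schatten_form (q / 2) 1%:M (Gamma q^-1 X) 1%:M.
Proof.
move=> q0; rewrite weighted_normE ?gt_eqF ?invr_gt0 // invrK schatten_form11.
by rewrite powRVK ?gt_eqF ?trR_mxpow_ge0.
Qed.

Lemma pdmx_Gamma s X : pdmx sigma -> pdmx X -> pdmx (Gamma s X).
Proof.
move=> psigma pX; rewrite /Gamma -{2}(mxpow_herm _ sigma); apply: pdmx_congr => //.
exact/pdmx_unit/mxpow_pd.
Qed.

Lemma mxabs_pdmx Y : pdmx Y -> mxabs Y = Y.
Proof.
move=> pY; rewrite /mxabs (pdmx_herm pY) mxpow_sqr // mulfV ?pnatr_eq0 // mxpow1 //.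
exact: pdmx_psd.
Qed.

Lemma weighted_norm_pdmx th X : th != 0 -> pdmx sigma -> pdmx X ->
  weighted_norm th X = trR (mxpow th^-1 (Gamma th X)) `^ th.
Proof.
move=> /negPf th0 psigma pX; rewrite /weighted_norm /schatten_norm th0.
by rewrite mxabs_pdmx //; exact: pdmx_Gamma.
Qed.

Lemma weighted_norm0E A : weighted_norm 0 A = \big[Num.max/0]_i eig (mxabs A) i.
Proof.
by rewrite /weighted_norm /schatten_norm eqxx /Gamma mul0r mxpow0 mul1mx mulmx1.
Qed.

Lemma eig_trmxC_mulmx_le A i : eig (A^t* *m A) i <= weighted_norm 0 A ^+ 2.
Proof.
have pA := psdmx_trmxC_mulmx A; have pabs : psdmx (mxabs A) := mxpow_psd _ _.
move: i; apply/(eig_leP _ (psdmx_herm pA)); rewrite -(mxpow_sqrt pA) -/(mxabs A).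
rewrite -{1 2}(mxfun_id (psdmx_herm pabs)) mxfunM -(mxfun_const _ (mxabs A)).
apply/mxfun_leP => i; rewrite expr2 ler_pM ?psdmx_eig //.
all: by rewrite weighted_norm0E; apply: le_bigmax.
Qed.

End Norms.

(** * Conditional expectations *)
Section PositiveMap.
Variables (R : realType) (C : complexification R) (n : nat).
Variable E : {linear 'M[C]_n -> 'M[C]_n}.
Hypothesis E_psd : forall X, psdmx X -> psdmx (E X).
Implicit Types X : 'M[C]_n.

Lemma positive_map_herm X : hermmx X -> hermmx (E X).
Proof.
move=> hX; have -> : X = mxfun (fun x => Num.max x 0) X - mxfun (fun x => Num.max (- x) 0) X.
  rewrite mxfunB -[LHS](mxfun_id hX); apply: eq_mxfun => i; rewrite /= !maxEle.
  by case: ifP; case: ifP => /=; lra.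
by rewrite linearB; apply: hermmxB; apply/psdmx_herm/E_psd/mxfun_psd => i;
  rewrite le_max lexx orbT.
Qed.

Lemma positive_map_trmxC X : E (X^t*) = (E X)^t*.
Proof.
pose H := X + X^t*; pose K := 'i *: (X - X^t*).
have hH : hermmx H by rewrite /hermmx trmxCD trmxCK addrC.
have hK : hermmx K.
  by rewrite /hermmx trmxCZ conjCi trmxCB trmxCK scaleNr -scalerN opprB.
have iK : 'i *: K = X^t* - X.
  by rewrite scalerA -expr2 sqrCi scaleN1r opprB.
have twoX : 2 *: X = H - 'i *: K.
  by rewrite iK /H opprB addrCA addrK scaler_nat mulr2n.
have twoXC : 2 *: X^t* = H + 'i *: K.
  by rewrite iK /H [X + _]addrC -addrA subrKC scaler_nat mulr2n.
have two0 : (2 : C) != 0 by rewrite pnatr_eq0.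
apply: (scalerI two0).
have -> : 2 *: (E X)^t* = (E (2 *: X))^t*.
  by rewrite linearZ /= trmxCZ rmorph_nat.
rewrite -linearZ /= twoXC twoX.
have -> : E (H + 'i *: K) = E H + 'i *: E K by rewrite linearD linearZ.
have -> : E (H - 'i *: K) = E H - 'i *: E K by rewrite linearB linearZ.
rewrite trmxCB trmxCZ conjCi (positive_map_herm hH) (positive_map_herm hK).
by rewrite scaleNr opprK.
Qed.

End PositiveMap.

(* E is a conditional expectation onto N, and sigma is the density, faithful,
   of the state X |-> tr (E X) / n. *)
Record condexp (R : realType) (C : complexification R) n (N : set 'M[C]_n)
    (E : {linear 'M[C]_n -> 'M[C]_n}) (sigma : 'M[C]_n) : Prop := CondExp {
  condexp_dim_gt0 : (0 < n)%N;
  condexp_range : forall X, N (E X);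
  condexp_id : forall X, N X -> E X = X;
  condexp_bimodule : forall A B X, N A -> N B -> E (A *m X *m B) = A *m E X *m B;
  condexp_psd : forall X, psdmx X -> psdmx (E X);
  condexp_mem1 : N 1%:M;
  condexp_trace : forall X, \tr (sigma *m X) = \tr (E X) / n%:R;
  condexp_sigma_pd : pdmx sigma }.

Section ConditionalExpectation.
Variables (R : realType) (C : complexification R) (n : nat).
Local Notation "x %:C" := (embed C x) : ring_scope.
Variables (N : set 'M[C]_n) (E : {linear 'M[C]_n -> 'M[C]_n}) (sigma : 'M[C]_n).
Hypothesis ce : condexp N E sigma.
Implicit Types (A B L Q X : 'M[C]_n) (s q : R).

Let sigma_pd : pdmx sigma := condexp_sigma_pd ce.

Lemma condexp1 : E 1%:M = 1%:M.
Proof. exact: (condexp_id ce (condexp_mem1 ce)). Qed.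

Lemma condexp_mull A X : N A -> E (A *m X) = A *m E X.
Proof.
by move=> NA; rewrite -[A *m X]mulmx1 (condexp_bimodule ce) ?mulmx1 //; exact: condexp_mem1 ce.
Qed.

Lemma condexp_mulr X B : N B -> E (X *m B) = E X *m B.
Proof.
move=> NB; rewrite -[X in X *m B]mul1mx (condexp_bimodule ce) ?mul1mx //.
exact: condexp_mem1 ce.
Qed.

Lemma condexp_memM A B : N A -> N B -> N (A *m B).
Proof.
by move=> NA NB; rewrite -(condexp_id ce NB) -condexp_mull //; exact: condexp_range ce _.
Qed.

Lemma condexp_memD A B : N A -> N B -> N (A + B).
Proof.
move=> NA NB; rewrite -(condexp_id ce NA) -(condexp_id ce NB) -linearD.
exact: condexp_range ce _.
Qed.

Lemma condexp_memZ c A : N A -> N (c *: A).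
Proof. by move=> NA; rewrite -(condexp_id ce NA) -linearZ; exact: condexp_range ce _. Qed.

Lemma condexp_mem_mxfun f A : hermmx A -> N A -> N (mxfun f A).
Proof.
apply: mxfun_subalgebra; [exact: condexp_mem1 ce|exact: condexp_memD|..].
  exact: condexp_memZ.
exact: condexp_memM.
Qed.

Lemma condexp_mem_trmxC A : N A -> N (A^t*).
Proof.
move=> NA; rewrite -(condexp_id ce NA) -(positive_map_trmxC (condexp_psd ce)).
exact: condexp_range ce _.
Qed.

Lemma condexp_mem_trmxC_mulmx A : N A -> N (A^t* *m A).
Proof. by move=> NA; apply: condexp_memM => //; exact: condexp_mem_trmxC. Qed.

Lemma condexp_mem_mulmx_trmxC A : N A -> N (A *m A^t*).
Proof. by move=> NA; apply: condexp_memM => //; exact: condexp_mem_trmxC. Qed.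

Lemma condexp_mem_inv A : A \in unitmx -> N A -> N (invmx A).
Proof.
move=> uA NA; have pA := psdmx_trmxC_mulmx A.
have uAA : A^t* *m A \in unitmx by rewrite unitmx_mul unitmx_trmxC uA.
have -> : invmx A = mxpow (-1) (A^t* *m A) *m A^t*.
  rewrite mxpowN1; last exact: psdmx_unit_pd.
  by rewrite -[LHS](mulKmx uAA) -mulmxA mulmxV // mulmx1.
apply: condexp_memM; last exact: condexp_mem_trmxC.
by apply: condexp_mem_mxfun; [exact: psdmx_herm|exact: condexp_mem_trmxC_mulmx].
Qed.

Lemma condexp_sigma_comm A : N A -> sigma *m A = A *m sigma.
Proof.
move=> NA; apply: mxtrace_inj => X; rewrite -!mulmxA (mxtrace_mulC A) -mulmxA.
by rewrite !(condexp_trace ce) condexp_mull // condexp_mulr // mxtrace_mulC.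
Qed.

Lemma condexp_sigma_mxfun_comm f A : N A -> mxfun f sigma *m A = A *m mxfun f sigma.
Proof.
by move=> NA; apply: mxfun_comm; [exact: pdmx_herm|exact: condexp_sigma_comm].
Qed.

Lemma trR_sigma_condexp X B : N B -> trR (sigma *m E X *m B) = trR (sigma *m X *m B).
Proof.
move=> NB; rewrite /trR -!mulmxA !(condexp_trace ce) -condexp_mulr //.
by rewrite (condexp_id ce (condexp_range ce _)).
Qed.

Lemma trR_sigma : trR sigma = 1.
Proof.
rewrite -[sigma]mulmx1 /trR (condexp_trace ce) condexp1 mxtrace1 mulfV.
  by rewrite -(rmorph1 (embed C)) embedK.
by rewrite pnatr_eq0 -lt0n (condexp_dim_gt0 ce).
Qed.

Lemma condexp_pd X : pdmx X -> pdmx (E X).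
Proof.
move=> pX; have [l [u [l0 [hX lXu]]]] := pdmx_spectrum_in pX.
have hEX := positive_map_herm (condexp_psd ce) hX.
apply/pdmxP; split=> // i; apply: lt_le_trans l0 _; move: i; apply/eig_geP => //.
have -> : l%:C%:M = E l%:C%:M by rewrite -scalemx1 linearZ /= condexp1.
rewrite -linearB; apply: (condexp_psd ce); apply/eig_geP => // i.
by case/andP: (lXu i).
Qed.

Lemma Gamma_bimodule s A X B : N A -> N B ->
  Gamma sigma s (A *m X *m B) = A *m Gamma sigma s X *m B.
Proof.
move=> NA NB; rewrite /Gamma; set h := mxpow _ sigma.
have -> : h *m (A *m X *m B) *m h = (h *m A) *m X *m (B *m h) by rewrite !mulmxA.
by rewrite [h *m A]condexp_sigma_mxfun_comm // -[B *m h]condexp_sigma_mxfun_comm // !mulmxA.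
Qed.

Lemma weighted_norm_sandwich q L X Q : 0 < q -> N L -> N Q ->
  weighted_norm sigma q^-1 (L *m X *m Q) `^ q =
  schatten_form (q / 2) (L^t* *m L) (Gamma sigma q^-1 X) (Q *m Q^t*).
Proof.
by move=> q0 NL NQ; rewrite weighted_norm_powR // Gamma_bimodule // schatten_form11 schatten_formE.
Qed.

Lemma weighted_norm_mem s A : 0 < s -> N A ->
  weighted_norm sigma (s / 2) A = trR (sigma *m mxpow s^-1 (A^t* *m A)) `^ (s / 2).
Proof.
move=> s0 NA; rewrite weighted_normE ?gt_eqF ?divr_gt0 //; congr (trR _ `^ _).
have NAA := condexp_mem_trmxC_mulmx NA.
have -> : Gamma sigma (s / 2) A = mxpow (s / 2) sigma *m A.
  by rewrite /Gamma -mulmxA -condexp_sigma_mxfun_comm // mulmxA mxpowD // -splitr.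
rewrite trmxC_mul (mxpow_herm _ sigma) mulmxA -(mulmxA (A^t*)) mxpowD // -splitr.
have <- : mxpow s sigma *m A^t* = A^t* *m mxpow s sigma.
  exact/condexp_sigma_mxfun_comm/condexp_mem_trmxC.
rewrite -mulmxA.
have -> : (s / 2)^-1 / 2 = s^-1 by field; rewrite gt_eqF.
rewrite mxpow_commM; [|exact: mxpow_psd|exact: psdmx_trmxC_mulmx|]; last first.
  exact: condexp_sigma_mxfun_comm.
by rewrite mxpowM mulfV ?gt_eqF // mxpow1 //; exact: pdmx_psd.
Qed.

Lemma weighted_norm_mem_trmxC s A : 0 < s -> N A ->
  weighted_norm sigma (s / 2) A = trR (sigma *m mxpow s^-1 (A *m A^t*)) `^ (s / 2).
Proof.
move=> s0 NA; rewrite (weighted_norm_mem s0 NA).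
by rewrite [in RHS](trR_mxfun_mulmx_trmxC _ (condexp_sigma_comm NA)).
Qed.

Lemma weighted_norm_mul_le q A X B : 0 < q -> N A -> N B ->
  weighted_norm sigma q^-1 (A *m X *m B) <=
  weighted_norm sigma 0 A * weighted_norm sigma 0 B * weighted_norm sigma q^-1 X.
Proof.
move=> q0 NA NB; have := eig_trmxC_mulmx_le sigma A.
have := eig_mulmx_trmxC_le (eig_trmxC_mulmx_le sigma B).
have := weighted_norm_ge0 sigma 0 A; have := weighted_norm_ge0 sigma 0 B.
move: (weighted_norm sigma 0 A) (weighted_norm sigma 0 B) => a b b0 a0.
have pA := psdmx_trmxC_mulmx A; have pB := psdmx_mulmx_trmxC B.
move=> /(eig_leP _ (psdmx_herm pB)) Bb /(eig_leP _ (psdmx_herm pA)) Aa.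
rewrite -(ler_powR2r q0) ?mulr_ge0 ?weighted_norm_ge0 // powRM ?mulr_ge0 ?weighted_norm_ge0 //.
rewrite [leLHS](weighted_norm_sandwich X q0 NA NB).
rewrite [Y in _ <= _ * Y](weighted_norm_powR sigma X q0).
have -> : (a * b) `^ q = (a ^+ 2 * b ^+ 2) `^ (q / 2).
  rewrite -exprMn -powR_mulrn ?mulr_ge0 // -powRrM.
  by rewrite mulrCA mulfV ?pnatr_eq0 // mulr1.
have p1 := psdmx1 C n.
rewrite -(schatten_formZ _ _ (sqr_ge0 a) (sqr_ge0 b) p1 p1) !scalemx1.
by apply: (schatten_form_le _ _ pA pB Aa Bb); rewrite divr_gt0.
Qed.

Lemma weighted_norm0_1 : weighted_norm sigma 0 1%:M = 1.
Proof.
have abs1 : mxabs (1%:M : 'M[C]_n) = 1%:M.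
  by rewrite /mxabs trmxC1 mulmx1 -(rmorph1 (embed C)) /mxpow mxfun_scalar powR1.
rewrite weighted_norm0E abs1 -(rmorph1 (embed C)); apply/le_anti/andP; split.
  by apply/bigmax_leP; split=> // i _; rewrite eig_scalar.
rewrite -{1}(eig_scalar C 1 (Ordinal (condexp_dim_gt0 ce))); exact: le_bigmax.
Qed.

Lemma amalgamated_inf_diag q X : 0 < q ->
  amalgamated_inf sigma N q q X = weighted_norm sigma q^-1 X.
Proof.
move=> q0; rewrite /amalgamated_inf subrr mul0r; set T := [set v | _].
have TX : T (weighted_norm sigma q^-1 X).
  exists 1%:M, 1%:M, X; rewrite weighted_norm0_1 !mul1r mul1mx mulmx1.
  by split=> //; exact: condexp_mem1 ce.
have lbT : lbound T (weighted_norm sigma q^-1 X).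
  by move=> v [A [B [Y [NA NB -> ->]]]]; exact: weighted_norm_mul_le.
apply/le_anti/andP; split; last by apply: lb_le_inf => //; exists (weighted_norm sigma q^-1 X).
by apply: ge_inf => //; exists (weighted_norm sigma q^-1 X).
Qed.

End ConditionalExpectation.

(** * Reduction of the amalgamated norms to positive densities *)
Section PowerBounds.
Variable R : realType.
Implicit Types (T : set R) (r x : R).

Lemma powR_half_cancel (c p s : R) : 0 < c -> (c `^ (s / 2)) `^ p * (c `^ (- s)) `^ (p / 2) = 1.
Proof.
move=> c0; rewrite -!powRrM -powRD ?(gt_eqF c0) ?implybT //.
by rewrite (_ : s / 2 * p + - s * (p / 2) = 0) ?powRr0 //; field.
Qed.

Lemma inf_powR_bounds T r (L x0 : R) : 0 < r -> T x0 ->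
  (forall x, T x -> 0 <= x /\ L <= x `^ r) ->
  [/\ 0 <= inf T, L <= inf T `^ r & inf T `^ r <= x0 `^ r].
Proof.
move=> r0 Tx0 TL; have T0 : T !=set0 by exists x0.
have inf0 : 0 <= inf T by apply: lb_le_inf => // x /TL[].
have [x00 _] := TL _ Tx0; split=> //.
  have [L0|L0] := leP L 0; first exact: le_trans L0 (powR_ge0 _ _).
  rewrite -(powRVK (ltW L0) (lt0r_neq0 r0)) ler_powR2r ?powR_ge0 //.
  apply: lb_le_inf => // x /TL[x1 Lx].
  by rewrite -(ler_powR2r r0) ?powR_ge0 // powRVK ?gt_eqF // ltW.
by rewrite ler_powR2r //; apply: ge_inf => //; exists 0 => x /TL[].
Qed.

Lemma sup_powR_bounds T r (U x0 : R) : 0 < r -> T x0 ->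
  (forall x, T x -> 0 <= x /\ x `^ r <= U) ->
  [/\ 0 <= sup T, x0 `^ r <= sup T `^ r & sup T `^ r <= U].
Proof.
move=> r0 Tx0 TU; have T0 : T !=set0 by exists x0.
have [x00 x0U] := TU _ Tx0; have U0 : 0 <= U := le_trans (powR_ge0 _ _) x0U.
have ubT : ubound T (U `^ r^-1).
  move=> x /TU[x1 xU].
  by rewrite -(ler_powR2r r0) ?powR_ge0 // powRVK ?gt_eqF.
have x0sup : x0 <= sup T by apply: ub_le_sup => //; exists (U `^ r^-1).
have sup0 : 0 <= sup T := le_trans x00 x0sup.
split=> //; first by rewrite ler_powR2r.
by rewrite -[leRHS](powRVK U0 (lt0r_neq0 r0)) ler_powR2r ?powR_ge0 // ge_sup.
Qed.

End PowerBounds.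

Section Reduction.
Variables (R : realType) (C : complexification R) (n : nat).
Local Notation "x %:C" := (embed C x) : ring_scope.
Variables (N : set 'M[C]_n) (E : {linear 'M[C]_n -> 'M[C]_n}) (sigma : 'M[C]_n).
Hypothesis ce : condexp N E sigma.
Implicit Types (A B W X Y a b x : 'M[C]_n).

Let sigma_pd : pdmx sigma := condexp_sigma_pd ce.

Local Notation Gamma := (Gamma sigma).
Local Notation wnorm := (weighted_norm sigma).

(* The element of N that represents the functional B |-> tr (W B) on N, relative
   to sigma. *)
Definition condexp_density W := E (mxpow (- 2^-1) sigma *m W *m mxpow (- 2^-1) sigma).

Definition normalized_density W := (trR W)^-1%:C *: condexp_density W.

Lemma trR_condexp_density W B : N B ->
  trR (sigma *m condexp_density W *m B) = trR (W *m B).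
Proof.
move=> NB; rewrite (trR_sigma_condexp ce) //.
have sigmaE : sigma *m mxpow (- 2^-1) sigma = mxpow 2^-1 sigma.
  by rewrite mxpow_mulr //; congr (mxpow _ _); lra.
rewrite !mulmxA sigmaE; set h := mxpow 2^-1 sigma; set g := mxpow (- 2^-1) sigma.
have hB : h *m B = B *m h by exact: (condexp_sigma_mxfun_comm ce).
have -> : h *m W *m g *m B = h *m (W *m (g *m B)) by rewrite !mulmxA.
by rewrite (trRC h) -!mulmxA -hB (mulmxA g) mxpowN_mull // mul1mx.
Qed.

Lemma condexp_density_pd W : pdmx W -> pdmx (condexp_density W).
Proof.
move=> pW; apply: (condexp_pd ce); rewrite -{2}(mxpow_herm (- 2^-1) sigma).
by apply: pdmx_congr => //; apply: pdmx_unit; exact: mxpow_pd.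
Qed.

Lemma trR_gt0 W : pdmx W -> 0 < trR W.
Proof. by move=> pW; rewrite trR_pdmx_gt0 // (condexp_dim_gt0 ce). Qed.

Lemma normalized_density_pd W : pdmx W -> pdmx (normalized_density W).
Proof.
by move=> pW; apply: pdmxZ; [rewrite invr_gt0 trR_gt0|exact: condexp_density_pd].
Qed.

Lemma normalized_density_mem W : N (normalized_density W).
Proof. by apply: (condexp_memZ ce); exact: condexp_range ce _. Qed.

Lemma trR_normalized_density W B : N B ->
  trR (sigma *m normalized_density W *m B) = (trR W)^-1 * trR (W *m B).
Proof. by move=> NB; rewrite -scalemxAr -scalemxAl trRZ trR_condexp_density. Qed.

Lemma trR_sigma_normalized_density W : pdmx W -> trR (sigma *m normalized_density W) = 1.
Proof.
move=> pW; rewrite -[_ *m normalized_density W]mulmx1.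
rewrite trR_normalized_density; last exact: condexp_mem1 ce.
by rewrite mulmx1 mulVf // gt_eqF // trR_gt0.
Qed.

Lemma trR_mulmx_log_le W a : pdmx W -> pdmx a -> N a ->
  trR (W *m mxlog a) <=
  trR (W *m mxlog (normalized_density W)) + trR W * (trR (sigma *m a) - 1).
Proof.
move=> pW pa Na; set d := normalized_density W.
have pd : pdmx d := normalized_density_pd pW; have Nd : N d := normalized_density_mem W.
have sa := condexp_sigma_comm ce Na; have sd := condexp_sigma_comm ce Nd.
have := klein_entropy (pdmx_commM sigma_pd pd sd) (pdmx_commM sigma_pd pa sa).
rewrite !mxlog_commM // trR_sigma_normalized_density // opprD addrACA subrr add0r.
rewrite mulmxBr trRB !trR_normalized_density; last first.
- by apply: (condexp_mem_mxfun ce) => //; exact: pdmx_herm.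
- by apply: (condexp_mem_mxfun ce) => //; exact: pdmx_herm.
by rewrite -mulrBr mulrC ler_pdivlMr ?trR_gt0 //; lra.
Qed.

Lemma trR_sigma_mxpow_gt0 (r : R) x : 0 < r -> psdmx x -> x != 0 ->
  0 < trR (sigma *m mxpow r x).
Proof.
move=> r0 px x0; apply: lt_le_trans (min_eig_trR_le (pdmx_herm sigma_pd) (mxpow_psd r x)).
rewrite mulr_gt0 ?min_eig_gt0 //.
have [i xi] : exists i, eig x i != 0.
  apply/existsP; rewrite -negb_forall; apply: contra x0 => /forallP eig0.
  by apply/eqP/psdmx_eig_eq0 => // i; exact/eqP.
rewrite trR_mxfun (bigD1 i) //= ltr_pwDl ?sumr_ge0 // => [|j _]; last exact: powR_ge0.
by rewrite powR_gt0 // lt_neqAle eq_sym xi psdmx_eig.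
Qed.

Definition regular_density (eta : R) a :=
  [/\ N a, spectrum_in eta ((1 + eta) / min_eig sigma) a & trR (sigma *m a) = 1 + eta].

(* x^{1/tau}, normalised and then shifted so that its spectrum stays in a compact
   subset of the positive axis that does not depend on x. *)
Definition regularize (tau eta : R) x :=
  mxfun (fun y => (trR (sigma *m mxpow tau^-1 x))^-1 * y `^ tau^-1 + eta) x.

Section Regularization.
Variables (tau eta : R) (x : 'M[C]_n).
Hypotheses (tau0 : 0 < tau) (eta0 : 0 < eta) (px : psdmx x) (x0 : x != 0).

Let mass := trR (sigma *m mxpow tau^-1 x).
Let mass_gt0 : 0 < mass. Proof. by apply: trR_sigma_mxpow_gt0 => //; rewrite invr_gt0. Qed.
Let eta_le y : eta <= mass^-1 * y `^ tau^-1 + eta.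
Proof. by rewrite lerDr mulr_ge0 ?powR_ge0 // invr_ge0 ltW. Qed.

Lemma regularize_density : N x -> regular_density eta (regularize tau eta x).
Proof.
move=> Nx; have hx := psdmx_herm px; have hreg : hermmx (regularize tau eta x).
  exact: mxfun_herm.
have preg : psdmx (regularize tau eta x).
  by apply: mxfun_psd => i; exact: le_trans (ltW eta0) (eta_le _).
have trreg : trR (sigma *m regularize tau eta x) = 1 + eta.
  rewrite /regularize -/mass -mxfunD -mxfunZ mxfun_const mulmxDr trRD -scalemxAr trRZ.
  by rewrite mul_mx_scalar trRZ (trR_sigma ce) mulr1 mulVf // gt_eqF.
split=> //; first exact: (condexp_mem_mxfun ce).
split=> // i; apply/andP; split; last first.
  rewrite ler_pdivlMr ?min_eig_gt0 // -trreg mulrC.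
  apply: le_trans (min_eig_trR_le (pdmx_herm sigma_pd) preg).
  by rewrite ler_pM2l ?min_eig_gt0 // psdmx_eig_le_trR.
by move: i; apply/eig_geP => //; rewrite -(mxfun_const eta x); apply/mxfun_leP => i.
Qed.

Let scale_ge (y : R) : 0 <= y -> y <= mass `^ tau * (mass^-1 * y `^ tau^-1 + eta) `^ tau.
Proof.
move=> y0; have reg0 : 0 <= mass^-1 * y `^ tau^-1 + eta := le_trans (ltW eta0) (eta_le y).
rewrite -powRM ?(ltW mass_gt0) // -[leLHS](powRVK y0 (lt0r_neq0 tau0)).
rewrite ler_powR2r ?powR_ge0 ?mulr_ge0 ?(ltW mass_gt0) //.
by rewrite mulrDr mulVKf ?gt_eqF // lerDl mulr_ge0 // ltW.
Qed.

Lemma regularize_ge : x \preceq (mass `^ tau)%:C *: mxpow tau (regularize tau eta x).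
Proof.
rewrite -{2}(mxfun_id (psdmx_herm px)) /mxpow mxfun_comp mxfunZ.
by apply/mxfun_leP => i; exact/scale_ge/psdmx_eig.
Qed.

Lemma regularize_inv_le : x \in unitmx ->
  (mass `^ (- tau))%:C *: mxpow (- tau) (regularize tau eta x) \preceq mxpow (-1) x.
Proof.
move=> ux; have pdx := psdmx_unit_pd px ux.
rewrite /mxpow mxfun_comp mxfunZ; apply/mxfun_leP => i /=.
have xi := pdmx_eig i pdx; rewrite !powRN powRr1 ?(ltW xi) // -invfM lef_pV2 ?posrE //.
  exact/scale_ge/ltW.
by rewrite mulr_gt0 ?powR_gt0 // (lt_le_trans eta0).
Qed.

End Regularization.

Lemma amalgamated_inf_term_ge (s p eta : R) A Y B :
  0 < s -> 0 < p -> 0 < eta -> N A -> N B -> pdmx (A *m Y *m B) ->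
  exists a b, [/\ regular_density eta a, regular_density eta b &
    schatten_form (p / 2) (mxpow (- s) a) (Gamma p^-1 (A *m Y *m B)) (mxpow (- s) b)
      <= (wnorm (s / 2) A * wnorm (s / 2) B * wnorm p^-1 Y) `^ p].
Proof.
move=> s0 p0 eta0 NA NB; set X := A *m Y *m B => pX.
have /andP[uA uB] : (A \in unitmx) && (B \in unitmx).
  by have := pdmx_unit pX; rewrite !unitmx_mul -andbA => /and3P[-> _ ->].
pose x := A *m A^t*; pose y := B^t* *m B.
have px : psdmx x := psdmx_mulmx_trmxC A; have py : psdmx y := psdmx_trmxC_mulmx B.
have ux : x \in unitmx by rewrite unitmx_mul unitmx_trmxC uA.
have uy : y \in unitmx by rewrite unitmx_mul unitmx_trmxC uB.
have n0 := condexp_dim_gt0 ce; have x0 := unitmx_neq0 n0 ux; have y0 := unitmx_neq0 n0 uy.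
have regx := regularize_density s0 eta0 px x0 (condexp_mem_mulmx_trmxC ce NA).
have regy := regularize_density s0 eta0 py y0 (condexp_mem_trmxC_mulmx ce NB).
exists (regularize s eta x), (regularize s eta y); split=> //.
have lex := regularize_inv_le s0 eta0 px x0 ux.
have ley := regularize_inv_le s0 eta0 py y0 uy.
have cx0 : 0 < trR (sigma *m mxpow s^-1 x) by rewrite trR_sigma_mxpow_gt0 ?invr_gt0.
have cy0 : 0 < trR (sigma *m mxpow s^-1 y) by rewrite trR_sigma_mxpow_gt0 ?invr_gt0.
have YE : Y = invmx A *m X *m invmx B by rewrite /X !mulmxA mulVmx // mul1mx mulmxK.
rewrite [leRHS]powRM ?mulr_ge0 ?weighted_norm_ge0 // YE.
rewrite (weighted_norm_sandwich ce) //; try exact: (condexp_mem_inv ce).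
rewrite mxpowN1_mulmx_trmxC // mxpowN1_trmxC_mulmx //.
rewrite (weighted_norm_mem_trmxC ce s0 NA) (weighted_norm_mem ce s0 NB) -/x -/y.
move: cx0 cy0 lex ley; move: (trR (_ *m mxpow _ x)) (trR (_ *m mxpow _ y)) => c d c0 d0.
move: (regularize _ _ x) (regularize _ _ y) => a b lex ley.
have pa := mxpow_psd (- s) a; have pb := mxpow_psd (- s) b.
rewrite -[leLHS]mul1r -[X in X * _ <= _](powR_half_cancel p s (mulr_gt0 c0 d0)).
rewrite -!powRM ?(ltW c0) ?(ltW d0) //.
rewrite -mulrA ler_wpM2l ?powR_ge0 // (powRM (- s)) ?(ltW c0) ?(ltW d0) //.
rewrite -schatten_formZ ?powR_ge0 //.
by apply: schatten_form_le; rewrite ?divr_gt0 //; apply: psdmxZ; rewrite ?powR_ge0.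
Qed.

Lemma amalgamated_sup_term_le (s p eta : R) A X B :
  0 < s -> 0 < p -> 0 < eta -> N A -> N B -> A != 0 -> B != 0 ->
  exists a b, [/\ regular_density eta a, regular_density eta b &
    (wnorm p^-1 (A *m X *m B) / (wnorm (s / 2) A * wnorm (s / 2) B)) `^ p
      <= schatten_form (p / 2) (mxpow s a) (Gamma p^-1 X) (mxpow s b)].
Proof.
move=> s0 p0 eta0 NA NB A0 B0; pose x := A^t* *m A; pose y := B *m B^t*.
have px : psdmx x := psdmx_trmxC_mulmx A; have py : psdmx y := psdmx_mulmx_trmxC B.
have x0 : x != 0 by apply: contra A0 => /eqP/trmxC_mul_eq0 ->.
have y0 : y != 0.
  apply: contra B0 => /eqP; rewrite /y -{1}[B]trmxCK => /trmxC_mul_eq0 BC0.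
  by rewrite -[B]trmxCK BC0 trmx0 map_mx0.
have regx := regularize_density s0 eta0 px x0 (condexp_mem_trmxC_mulmx ce NA).
have regy := regularize_density s0 eta0 py y0 (condexp_mem_mulmx_trmxC ce NB).
exists (regularize s eta x), (regularize s eta y); split=> //.
have lex := regularize_ge s0 eta0 px x0; have ley := regularize_ge s0 eta0 py y0.
have cx0 : 0 < trR (sigma *m mxpow s^-1 x) by rewrite trR_sigma_mxpow_gt0 ?invr_gt0.
have cy0 : 0 < trR (sigma *m mxpow s^-1 y) by rewrite trR_sigma_mxpow_gt0 ?invr_gt0.
rewrite powRM ?invr_ge0 ?mulr_ge0 ?weighted_norm_ge0 //.
rewrite (weighted_norm_sandwich ce) // -/x -/y.
rewrite (weighted_norm_mem ce s0 NA) (weighted_norm_mem_trmxC ce s0 NB) -/x -/y.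
move: cx0 cy0 lex ley; move: (trR (_ *m mxpow _ x)) (trR (_ *m mxpow _ y)) => c d c0 d0.
move: (regularize _ _ x) (regularize _ _ y) => a b lex ley.
have pa := mxpow_psd s a; have pb := mxpow_psd s b.
rewrite mulrC -[leRHS]mul1r.
rewrite -[X in _ <= X * _](powR_half_cancel p (- s) (mulr_gt0 c0 d0)) opprK mulNr powRN.
rewrite -!powRM ?(ltW c0) ?(ltW d0) //.
rewrite -mulrA ler_wpM2l ?powR_ge0 // (powRM s) ?(ltW c0) ?(ltW d0) //.
rewrite -schatten_formZ ?powR_ge0 //.
by apply: schatten_form_le; rewrite ?divr_gt0.
Qed.

Lemma weighted_norm_mxpow_density (s : R) a :
  0 < s -> N a -> pdmx a -> trR (sigma *m a) = 1 -> wnorm (s / 2) (mxpow (s / 2) a) = 1.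
Proof.
move=> s0 Na pa tra; rewrite (weighted_norm_mem ce) //; last first.
  by apply: (condexp_mem_mxfun ce) => //; exact: pdmx_herm.
rewrite mxpow_herm mxpowD // -splitr mxpowM mulfV ?gt_eqF // mxpow1.
  by rewrite tra powR1.
exact: pdmx_psd.
Qed.

Section Bounds.
Variables (q p eta : R) (X a : 'M[C]_n).
Hypotheses (q0 : 0 < q) (p0 : 0 < p) (eta0 : 0 < eta).
Hypotheses (Na : N a) (pa : pdmx a) (tra : trR (sigma *m a) = 1).
Let form b c := schatten_form (p / 2)
  (mxpow (- (q^-1 - p^-1)) b) (Gamma p^-1 X) (mxpow (- (q^-1 - p^-1)) c).

Lemma amalgamated_inf_bounds L : pdmx X -> q < p ->
  (forall b c, regular_density eta b -> regular_density eta c -> L <= form b c) ->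
  [/\ 0 <= amalgamated_inf sigma N q p X, L <= amalgamated_inf sigma N q p X `^ p &
      amalgamated_inf sigma N q p X `^ p <= form a a].
Proof.
rewrite /form; set s := q^-1 - p^-1 => pX qp Lform.
have s0 : 0 < s by rewrite subr_gt0 ltf_pV2.
pose g := mxpow (- (s / 2)) a; pose h := mxpow (s / 2) a.
have Ng : N g by apply: (condexp_mem_mxfun ce) => //; exact: pdmx_herm.
have Nh : N h by apply: (condexp_mem_mxfun ce) => //; exact: pdmx_herm.
have gg : g *m g = mxpow (- s) a by rewrite mxpowD //; congr mxpow; lra.
have <- : wnorm p^-1 (g *m X *m g) `^ p =
    schatten_form (p / 2) (mxpow (- s) a) (Gamma p^-1 X) (mxpow (- s) a).
  by rewrite (weighted_norm_sandwich ce) // mxpow_herm gg.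
apply: inf_powR_bounds => //.
  exists h, h, (g *m X *m g); rewrite weighted_norm_mxpow_density // !mul1r.
  by split=> //; rewrite !mulmxA mxpowD // subrr mxpow0 mul1mx -mulmxA mxpowN_mull // mulmx1.
move=> v [A [B [Y [NA NB XE ->]]]]; split; first by rewrite !mulr_ge0 ?weighted_norm_ge0.
have := @amalgamated_inf_term_ge _ _ _ A Y B s0 p0 eta0 NA NB; rewrite -XE.
move=> /(_ pX)[b [c [regb regc]]].
exact: le_trans (Lform b c regb regc).
Qed.

Lemma amalgamated_sup_bounds U : p < q ->
  (forall b c, regular_density eta b -> regular_density eta c -> form b c <= U) ->
  [/\ 0 <= amalgamated_sup sigma N q p X, form a a <= amalgamated_sup sigma N q p X `^ p &
      amalgamated_sup sigma N q p X `^ p <= U].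
Proof.
rewrite /form opprB; set s := p^-1 - q^-1 => pq Uform.
have s0 : 0 < s by rewrite subr_gt0 ltf_pV2.
pose h := mxpow (s / 2) a; have hh : h *m h = mxpow s a by rewrite mxpowD // -splitr.
have Nh : N h by apply: (condexp_mem_mxfun ce) => //; exact: pdmx_herm.
have h0 : h != 0 by apply: unitmx_neq0 (condexp_dim_gt0 ce) _; exact/pdmx_unit/mxpow_pd.
have <- : wnorm p^-1 (h *m X *m h) `^ p =
    schatten_form (p / 2) (mxpow s a) (Gamma p^-1 X) (mxpow s a).
  by rewrite (weighted_norm_sandwich ce) // mxpow_herm hh.
apply: sup_powR_bounds => //.
  by exists h, h; rewrite weighted_norm_mxpow_density // mulr1 divr1.
move=> v [A [B [NA NB A0 B0 ->]]].
split; first by rewrite divr_ge0 ?mulr_ge0 ?weighted_norm_ge0.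
have [b [c [regb regc]]] := amalgamated_sup_term_le X s0 p0 eta0 NA NB A0 B0.
by move=> le_v; exact: le_trans le_v (Uform b c regb regc).
Qed.

End Bounds.
End Reduction.

(** * First-order expansion of the amalgamated norm *)
Section FirstOrder.
Variables (R : realType) (C : complexification R) (n : nat).
Local Notation "x %:C" := (embed C x) : ring_scope.
Implicit Types (A D F G S V W Z : 'M[C]_n).

Lemma is_uderive_mxpow_at (I : Type) (T : set I) A (g : R -> R) (g1 : R) :
  pdmx A -> is_derive (0 : R) (1 : R) g g1 ->
  is_uderive T (fun t _ => mxpow (g t) A)
    (fun=> g1%:C *: (mxpow (g 0) A *m mxlog A)).
Proof.
move=> /pdmx_spectrum_in[l [u [l0 sA]]] dg.
exact: (is_uderive_comp (phi := fun=> A) (fun _ _ => sA) (is_uderive_mxpow C n u l0 dg)).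
Qed.

Lemma is_uderive_Gamma (I : Type) (T : set I) S (g : R -> R) (g1 : R)
    (Y : R -> I -> 'M[C]_n) (dY : I -> 'M[C]_n) :
  pdmx S -> is_derive (0 : R) (1 : R) g g1 -> is_uderive T Y dY ->
  is_uderive T (fun t i => Gamma S (g t) (Y t i))
    (fun i => Gamma S (g 0) (dY i) + (g1 / 2)%:C *:
       (mxlog S *m Gamma S (g 0) (Y 0 i) + Gamma S (g 0) (Y 0 i) *m mxlog S)).
Proof.
move=> pS dg hY; have dg2 : is_derive (0 : R) (1 : R) (fun t => g t / 2) (g1 / 2).
  exact: is_derive_divr.
have dS := is_uderive_mxpow_at T pS dg2.
apply: is_uderive_eq (is_uderiveM (is_uderiveM dS hY) dS) => i _.
rewrite /Gamma /=; set h := mxpow _ S.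
have hlog : h *m mxlog S = mxlog S *m h.
  by rewrite !mxfunM; apply: eq_mxfun => j; rewrite mulrC.
rewrite mulmxDl -!(scalemxAl, scalemxAr) scalerDr !mulmxA hlog addrCA.
by congr (_ + _); rewrite addrC.
Qed.

(* The five terms come from the product rule for a^{k/2} Z b^k Z a^{k/2} at k = 0,
   paired with D; V and W stand for Z^{q-1} and Z^q. *)
Lemma trR_product_rule D F G V W Z Z1 :
  D *m Z = V -> Z *m D = V -> V *m Z = W -> Z *m V = W ->
  trR (D *m (Z *m Z *m F + (Z *m Z1 + (Z *m G + (Z1 + F *m Z)) *m Z))) =
  2 * trR (W *m F) + trR (W *m G) + 2 * trR (V *m Z1).
Proof.
move=> DZ ZD VZ ZV; rewrite !(mulmxDr, mulmxDl) !trRD.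
have -> : trR (D *m (Z *m Z *m F)) = trR (W *m F) by rewrite !mulmxA DZ VZ.
have -> : trR (D *m (Z *m Z1)) = trR (V *m Z1) by rewrite mulmxA DZ.
have -> : trR (D *m (Z *m G *m Z)) = trR (W *m G).
  by rewrite !mulmxA DZ trRC mulmxA ZV.
have -> : trR (D *m (Z1 *m Z)) = trR (V *m Z1) by rewrite mulmxA trRC mulmxA ZD.
have -> : trR (D *m (F *m Z *m Z)) = trR (W *m F).
  by rewrite -mulmxA mulmxA trRC !mulmxA -(mulmxA Z Z D) ZD ZV.
by ring.
Qed.

End FirstOrder.

Section SchattenFormExpansion.
Variables (R : realType) (C : complexification R) (n : nat).
Local Notation "x %:C" := (embed C x) : ring_scope.
Variables (p g : R -> R) (p1 g1 : R) (Z : R -> 'M[C]_n) (Z1 : 'M[C]_n).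
Hypotheses (dp : is_derive (0 : R) (1 : R) p p1).
Hypotheses (dg : is_derive (0 : R) (1 : R) g g1) (g0 : g 0 = 0).
Hypotheses (dZ : is_uderive [set: unit] (fun t _ => Z t) (fun=> Z1)).
Hypothesis pZ : \forall t \near (0 : R), pdmx (Z t).

Let pZ0 : pdmx (Z 0). Proof. exact: nbhs_singleton pZ. Qed.
Let W := mxpow (p 0) (Z 0).
Let V := mxpow (p 0 - 1) (Z 0).
Let T (l u : R) : set ('M[C]_n * 'M[C]_n) :=
  [set i | spectrum_in l u i.1 /\ spectrum_in l u i.2].

Let sandwich t (i : 'M[C]_n * 'M[C]_n) :=
  mxpow (g t / 2) i.1 *m Z t *m mxpow (g t) i.2 *m Z t *m mxpow (g t / 2) i.1.

Let is_uderive_sandwich (l u : R) : 0 < l ->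
  is_uderive (T l u) sandwich (fun i =>
    let F := (g1 / 2)%:C *: mxlog i.1 in let G := g1%:C *: mxlog i.2 in
    Z 0 *m Z 0 *m F + (Z 0 *m Z1 + (Z 0 *m G + (Z1 + F *m Z 0)) *m Z 0)).
Proof.
move=> l0.
have dF := is_uderive_comp (phi := fst) (U := T l u) (fun _ => @proj1 _ _)
  (is_uderive_mxpow C n u l0 (is_derive_divr 2 dg)).
have dG := is_uderive_comp (phi := snd) (U := T l u) (fun _ => @proj2 _ _)
  (is_uderive_mxpow C n u l0 dg).
have dZT := is_uderive_comp (phi := fun=> tt) (U := T l u) (fun _ _ => Logic.I) dZ.
apply: is_uderive_eq (is_uderiveM (is_uderiveM (is_uderiveM (is_uderiveM dF dZT) dG) dZT) dF).
by move=> i _ /=; rewrite g0 mul0r !mxpow0 !mul1mx !mulmx1.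
Qed.

Lemma schatten_form_expansion (l u : R) : 0 < l ->
  uniform_littleo [set i | spectrum_in l u i.1 /\ spectrum_in l u i.2] (fun t i =>
    schatten_form (p t / 2) (mxpow (g t) i.1) (Z t) (mxpow (g t) i.2) - trR W
    - t * (p1 * trR (W *m mxlog (Z 0)) + p 0 * trR (V *m Z1)
           + p 0 * g1 / 2 * trR (W *m (mxlog i.1 + mxlog i.2)))).
Proof.
move=> l0; have pZZ : pdmx (Z 0 *m Z 0) by apply: pdmx_commM.
have q2 : 2 * (p 0 / 2) = p 0 by rewrite mulrC divfK // pnatr_eq0.
have herm_sandwich : \forall t \near (0 : R), forall i, T l u i -> hermmx (sandwich t i).
  apply: filterS pZ => t /pdmx_herm hZ i _.
  rewrite /sandwich /hermmx !trmxC_mul; do ![rewrite mxpow_herm|rewrite hZ].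
  by rewrite !mulmxA.
have sandwich0 i : T l u i -> sandwich 0 i = Z 0 *m Z 0.
  by move=> _; rewrite /sandwich g0 mul0r !mxpow0 !mul1mx !mulmx1.
have := is_uderive_trR_mxpow pZZ sandwich0 (is_uderive_sandwich u l0) (is_derive_divr 2 dp)
  herm_sandwich.
have WlogE : trR (mxpow (p 0 / 2) (Z 0 *m Z 0) *m mxlog (Z 0 *m Z 0)) =
    2 * trR (W *m mxlog (Z 0)).
  by rewrite mxpow_sqr // q2 sqrmx_mxpow // mxlog_mxpow // -scalemxAr trRZ.
have DE : mxpow (p 0 / 2 - 1) (Z 0 *m Z 0) = mxpow (p 0 - 2) (Z 0).
  by rewrite mxpow_sqr // mulrBr q2 mulr1.
apply: near_eq_uniform_littleo; near=> t => i _; rewrite WlogE DE mxpow_sqr // q2 -/W.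
have hZ : (Z t)^t* = Z t by apply: pdmx_herm; near: t.
rewrite /schatten_form !mxpowM hZ -/(sandwich t i); congr (_ - _ * _).
rewrite (@trR_product_rule _ _ _ _ _ _ V W); first last.
- by rewrite mxpow_mulr // subrK.
- by rewrite mxpow_mull // subrK.
- by rewrite mxpow_mulr //; congr mxpow; lra.
- by rewrite mxpow_mull //; congr mxpow; lra.
rewrite -!scalemxAr !trRZ mulmxDr trRD.
by field.
Unshelve. all: by end_near. Qed.

End SchattenFormExpansion.

Section NormDerivative.
Variables (R : realType) (C : complexification R) (n : nat).
Variables (N : set 'M[C]_n) (E : {linear 'M[C]_n -> 'M[C]_n}) (sigma : 'M[C]_n).
Hypothesis ce : condexp N E sigma.
Variables (p : R -> R) (p1 : R) (Y : R -> 'M[C]_n) (Y1 : 'M[C]_n).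
Hypotheses (dp : is_derive (0 : R) (1 : R) p p1) (p0 : 0 < p 0).
Hypothesis p_incr : \forall t \near (0 : R), (t < 0 -> p t < p 0) /\ (0 < t -> p 0 < p t).
Hypothesis pY : \forall t \near (0 : R), pdmx (Y t).
Hypothesis dY : is_uderive [set: unit] (fun t _ => Y t) (fun=> Y1).

Local Notation Gamma := (Gamma sigma).
Local Notation q := (p 0).

Let sigma_pd : pdmx sigma := condexp_sigma_pd ce.
Let Z t := Gamma (p t)^-1 (Y t).
Let Z1 := Gamma q^-1 Y1.
Let W := mxpow q (Z 0).
Let V := mxpow (q - 1) (Z 0).
Let Q := trR W.
Let a0 := normalized_density E sigma W.

Let form t a b := schatten_form (p t / 2)
  (mxpow (- (q^-1 - (p t)^-1)) a) (Z t) (mxpow (- (q^-1 - (p t)^-1)) b).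

(* The derivative at 0 of the form is affine in x = tr W (ln a + ln b). *)
Let slope x := p1 * trR (W *m mxlog (Z 0)) + q * trR (V *m Z1)
  - p1 / q * trR (W *m mxlog sigma) - p1 / q / 2 * x.

Let pZ : \forall t \near (0 : R), pdmx (Z t).
Proof. by apply: filterS pY => t; exact: pdmx_Gamma. Qed.

Let pZ0 : pdmx (Z 0). Proof. exact: nbhs_singleton pZ. Qed.
Let pW : pdmx W. Proof. exact: mxpow_pd. Qed.
Let Q0 : 0 < Q. Proof. exact: trR_gt0 ce _ pW. Qed.

Lemma schatten_form_log_expansion (l u : R) : 0 < l ->
  uniform_littleo [set i | spectrum_in l u i.1 /\ spectrum_in l u i.2] (fun t i =>
    form t i.1 i.2 - Q - t * slope (trR (W *m (mxlog i.1 + mxlog i.2)))).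
Proof.
move=> l0; have dinv := is_deriveV (lt0r_neq0 p0) dp.
have dg : is_derive (0 : R) (1 : R) (fun t => - (q^-1 - (p t)^-1)) (- (p1 / q ^+ 2)).
  apply: is_derive_eq; rewrite /GRing.scale /=; field.
  by rewrite gt_eqF.
have g0 : - (q^-1 - q^-1) = 0 by rewrite subrr oppr0.
have dZ := is_uderive_Gamma sigma_pd dinv dY.
have := schatten_form_expansion dp dg g0 dZ pZ u l0.
apply: near_eq_uniform_littleo; near=> t => i _; congr (_ - _ * _).
rewrite -/(Z 0) -/Z1 -/W -/V mulmxDr trRD -scalemxAr trRZ mulmxDr trRD.
have -> : trR (V *m (mxlog sigma *m Z 0)) = trR (W *m mxlog sigma).
  by rewrite mulmxA trRC mulmxA mxpow_mulr // subrK.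
have -> : trR (V *m (Z 0 *m mxlog sigma)) = trR (W *m mxlog sigma).
  by rewrite mulmxA mxpow_mull // subrK.
rewrite /slope /GRing.scale /=; field.
by rewrite gt_eqF.
Unshelve. all: by end_near. Qed.

Let p1_ge0 : 0 <= p1.
Proof. by apply: (is_derive0_incr_ge0 dp); apply: filterS p_incr => t [_ /[apply]/ltW]. Qed.

Let slope_le x y : x <= y -> slope y <= slope x.
Proof. by move=> xy; rewrite lerD2l lerN2 ler_wpM2l // !divr_ge0 // ltW. Qed.

Let max_log := 2 * trR (W *m mxlog a0).

Let regular_log_le (eta : R) a b : regular_density N sigma eta a ->
  regular_density N sigma eta b -> 0 < eta ->
  trR (W *m (mxlog a + mxlog b)) <= max_log + 2 * (Q * eta).
Proof.
move=> [Na sa tra] [Nb sb trb] eta0; rewrite mulmxDr trRD.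
have := trR_mulmx_log_le ce pW (spectrum_in_pd eta0 sa) Na.
have := trR_mulmx_log_le ce pW (spectrum_in_pd eta0 sb) Nb.
by rewrite tra trb /max_log -/Q; lra.
Qed.

Lemma schatten_form_density_expansion :
  uniform_littleo [set: unit] (fun t _ => form t a0 a0 - Q - t * slope max_log).
Proof.
have [l [u [l0 sa]]] := pdmx_spectrum_in (normalized_density_pd ce pW).
have := uniform_littleo_comp (phi := fun=> (a0, a0)) (U := [set: unit])
  (fun _ _ => conj sa sa) (schatten_form_log_expansion u l0).
apply: near_eq_uniform_littleo; near=> t => _ _.
by rewrite mulmxDr trRD /max_log mulr2n mulrDl mul1r.
Unshelve. all: by end_near. Qed.

Lemma schatten_form_regular_bounds (e : R) : 0 < e -> exists2 eta : R, 0 < eta &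
  \forall t \near (0 : R), forall a b,
    regular_density N sigma eta a -> regular_density N sigma eta b ->
    (t < 0 -> form t a b <= Q + t * slope max_log + e * `|t|) /\
    (0 < t -> Q + t * slope max_log - e * `|t| <= form t a b).
Proof.
move=> e0; have c0 : 0 <= p1 / q := divr_ge0 p1_ge0 (ltW p0).
pose K := p1 / q * Q + 1; have K0 : 0 < K by rewrite ltr_wpDl // mulr_ge0 // ltW.
pose eta := e / 2 / K; have e2 : 0 < e / 2 by rewrite divr_gt0.
have eta0 : 0 < eta by rewrite divr_gt0.
have slope_eta : slope max_log - e / 2 <= slope (max_log + 2 * (Q * eta)).
  have : p1 / q * Q * eta <= e / 2.
    by rewrite /eta mulrCA ler_piMr ?(ltW e2) // ler_pdivrMr // mul1r lerDl.
  by rewrite /slope; lra.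
exists eta => //.
have := schatten_form_log_expansion ((1 + eta) / min_eig sigma) eta0 e2.
apply: filterS => t form_t a b ra rb; have [_ sa _] := ra; have [_ sb _] := rb.
have := form_t (a, b) (conj sa sb); rewrite /= ler_norml => /andP[form_ge form_le].
have slope_ab : slope max_log - e / 2 <= slope (trR (W *m (mxlog a + mxlog b))).
  exact: le_trans slope_eta (slope_le (regular_log_le ra rb eta0)).
split=> t0; have := ler_wpM2l (normr_ge0 t) slope_ab.
  by move: form_le; rewrite (ltr0_norm t0); lra.
by move: form_ge; rewrite (gtr0_norm t0); lra.
Qed.

Let norm_t t := amalgamated_norm sigma N q (p t) (Y t).

Let norm0 : norm_t 0 = Q `^ q^-1.
Proof.
have qV0 : q^-1 != 0 by rewrite gt_eqF ?invr_gt0.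
rewrite /norm_t /amalgamated_norm lexx (amalgamated_inf_diag ce _ p0).
by rewrite (weighted_norm_pdmx qV0 sigma_pd (nbhs_singleton pY)) invrK.
Qed.

Lemma amalgamated_norm_expansion :
  (\forall t \near (0 : R), 0 <= norm_t t) /\
  uniform_littleo [set: unit] (fun t _ => norm_t t `^ p t - Q - t * slope max_log).
Proof.
have Na := normalized_density_mem ce W; have pa := normalized_density_pd ce pW.
have tra := trR_sigma_normalized_density ce pW.
have expansion (e : R) : 0 < e -> \forall t \near (0 : R), 0 <= norm_t t /\
    `|norm_t t `^ p t - Q - t * slope max_log| <= e * `|t|.
  move=> e0; have [eta eta0 bounds] := schatten_form_regular_bounds e0.
  have attained := schatten_form_density_expansion e0.
  near=> t.
  have pt : 0 < p t by near: t; exact: (cvgr_gt _ (is_derive_cvg dp) _ p0).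
  have [lt_p gt_p] : (t < 0 -> p t < q) /\ (0 < t -> q < p t) by near: t.
  have form_t : `|form t a0 a0 - Q - t * slope max_log| <= e * `|t|.
    by near: t; apply: filterS attained => t; exact.
  have bounds_t : forall a b,
    regular_density N sigma eta a -> regular_density N sigma eta b ->
    (t < 0 -> form t a b <= Q + t * slope max_log + e * `|t|) /\
    (0 < t -> Q + t * slope max_log - e * `|t| <= form t a b) by near: t.
  have [t0|t0|t0] := ltgtP t 0.
  - rewrite /norm_t /amalgamated_norm (leNgt q) (lt_p t0) /=.
    have [|norm_ge0 form_le norm_le] := amalgamated_sup_bounds (X := Y t)
      (U := Q + t * slope max_log + e * `|t|) ce p0 pt eta0 Na pa tra (lt_p t0).
      by move=> a b ra rb; have [/(_ t0) form_ab _] := bounds_t a b ra rb; exact: form_ab.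
    split=> //; move: form_t norm_le form_le; rewrite -/(Z t) -/(form t a0 a0).
    by rewrite !ler_norml => /andP[? _] ? ?; apply/andP; split; lra.
  - rewrite /norm_t /amalgamated_norm (ltW (gt_p t0)).
    have pYt : pdmx (Y t) by near: t.
    have [|norm_ge0 norm_ge form_ge] := amalgamated_inf_bounds (X := Y t)
      (L := Q + t * slope max_log - e * `|t|) ce p0 pt eta0 Na pa tra pYt (gt_p t0).
      by move=> a b ra rb; have [_ /(_ t0) form_ab] := bounds_t a b ra rb; exact: form_ab.
    split=> //; move: form_t norm_ge form_ge; rewrite -/(Z t) -/(form t a0 a0).
    by rewrite !ler_norml => /andP[_ ?] ? ?; apply/andP; split; lra.
  have norm_q : norm_t 0 `^ q = Q by rewrite norm0 powRVK ?gt_eqF ?ltW.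
  rewrite t0 norm_q mul0r subrr subr0 normr0 mulr0; split=> //.
  by rewrite norm0 powR_ge0.
split; first by apply: filterS (expansion _ ltr01) => t [].
by move=> e /expansion; apply: filterS => t [_ norm_t_le] _ _.
Unshelve. all: by end_near. Qed.

Let slope_max_log : slope max_log =
  p1 * relative_entropy sigma E q (Y 0) + q * trR (V *m Z1) + p1 / q * (Q * ln Q).
Proof.
have log_a0 : trR (W *m mxlog a0) =
    trR (W *m mxlog (condexp_density E sigma W)) - Q * ln Q.
  rewrite /a0 /normalized_density mxlogZ ?invr_gt0 //; last exact: condexp_density_pd ce _ pW.
  by rewrite mulmxDr trRD mul_mx_scalar trRZ lnV ?posrE // -/Q; ring.
rewrite /slope /max_log log_a0 /relative_entropy -/(Z 0) -/W -/(condexp_density E sigma W).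
rewrite {3}/W mxlog_mxpow !mulmxBr !trRB -scalemxAr trRZ.
by field; rewrite gt_eqF.
Qed.

Theorem is_derive_amalgamated_norm :
  is_derive (0 : R) (1 : R) (fun t => amalgamated_norm sigma N q (p t) (Y t))
    ((p1 * relative_entropy sigma E q (Y 0)
      + q * trR (mxpow (q - 1) (Gamma q^-1 (Y 0)) *m Gamma q^-1 Y1))
     / (q * weighted_norm sigma q^-1 (Y 0) `^ (q - 1))).
Proof.
have [norm_ge0 expansion] := amalgamated_norm_expansion.
have w0 : 0 < Q `^ q^-1 by rewrite powR_gt0.
have wq : (Q `^ q^-1) `^ q = Q by rewrite powRVK ?gt_eqF ?ltW.
have dpow : is_derive (0 : R) (1 : R) (fun t => norm_t t `^ p t) (slope max_log).
  apply/is_derive0P; apply: near_eq_uniform_littleo expansion.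
  by near=> t => _ _; rewrite norm0 wq.
have norm00 : 0 < norm_t 0 by rewrite norm0.
apply: is_derive_eq (is_derive0_powR_root dp (lt0r_neq0 p0) norm00 norm_ge0 dpow) _.
have normE : weighted_norm sigma q^-1 (Y 0) = Q `^ q^-1.
  by rewrite -norm0 /norm_t /amalgamated_norm lexx (amalgamated_inf_diag ce _ p0).
rewrite normE norm0 wq slope_max_log ln_powR -/(Z 0) -/Z1 -/V.
have -> : (Q `^ q^-1) `^ (q - 1) = Q / Q `^ q^-1.
  by rewrite powRD ?(gt_eqF w0) ?implybT // wq powRN powRr1 // ltW.
move: (Q `^ q^-1) w0 => w w0; field.
by rewrite !gt_eqF.
Unshelve. all: by end_near. Qed.

End NormDerivative.

(** * Decohering semigroups *)
Section Decoherence.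
Variables (R : realType) (C : complexification R) (n : nat).
Implicit Types (X rho sigma : 'M[C]_n).

Lemma psdmx_mxblock1 X : psdmx (\mxblock_(i < 1, j < 1) X) <-> psdmx X.
Proof.
have trmxC_block (Y : 'M[C]_n) :
    (\mxblock_(i < 1, j < 1) Y)^t* = \mxblock_(i < 1, j < 1) Y^t*.
  by apply/matrixP => i j; rewrite !mxE.
have trmxC_row (v : 'rV[C]_n) : (\mxrow_(j < 1) v)^t* = \mxcol_(j < 1) v^t*.
  by apply/matrixP => i j; rewrite !mxE.
have formE (v : 'rV[C]_n) : \mxrow_(j < 1) v *m \mxblock_(i < 1, j < 1) X
    *m (\mxrow_(j < 1) v)^t* = v *m X *m v^t*.
  by rewrite trmxC_row mul_mxrow_mxblock mul_mxrow_mxcol !big_ord1.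
split=> -[hX psdX]; split.
- by move: hX; rewrite /hermmx trmxC_block => /mxblockP/(_ 0 0); rewrite !mxblockK.
- by move=> v; rewrite -formE.
- by rewrite /hermmx trmxC_block hX.
move=> v; have -> : v = \mxrow_(j < 1) submxrow v 0.
  by rewrite -[LHS]submxrowK; apply/mxrowP => j; rewrite !mxrowK ord1.
by rewrite formE.
Qed.

(* The invariant functional tr (rho .) is constant along the orbit of D. *)
Lemma trR_decay_eq0 (P : R -> 'M[C]_n -> 'M[C]_n) rho D :
  (forall t, 0 <= t -> trR (rho *m P t D) = trR (rho *m D)) ->
  normmx (P t D) @[t --> +oo] --> 0 -> trR (rho *m D) = 0.
Proof.
move=> invariant decay; apply/eqP; rewrite -normr_le0; apply/ler_addgt0Pr => e e0.
have K0 : 0 < normmx rho + 1 by rewrite ltr_wpDl ?normmx_ge0.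
have /cvgrPdist_le/(_ _ (divr_gt0 e0 K0)) small := decay.
near (pinfty_nbhs R) => t.
have t0 : 0 <= t by near: t; exact: nbhs_pinfty_ge.
have Pt : `|0 - normmx (P t D)| <= e / (normmx rho + 1) by near: t.
rewrite add0r -(invariant t t0) (le_trans (norm_trR_le _)) //.
rewrite (le_trans (ler_normmxM _ _)) //.
apply: (@le_trans _ _ ((normmx rho + 1) * normmx (P t D))).
  by rewrite ler_wpM2r ?normmx_ge0 // lerDl.
rewrite -ler_pdivlMl // mulrC.
by move: Pt; rewrite sub0r normrN ger0_norm ?normmx_ge0.
Unshelve. all: by end_near. Qed.

Lemma faithful_density_pd (E : {linear 'M[C]_n -> 'M[C]_n}) sigma : (0 < n)%N ->
  (forall X, psdmx X -> psdmx (E X)) -> (forall X, psdmx X -> E X = 0 -> X = 0) ->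
  (forall X, \tr (sigma *m X) = \tr (E X) / n%:R) -> pdmx sigma.
Proof.
move=> n0 E_psd E_faithful sigmaE; split.
  apply: mxtrace_inj => X; have -> : \tr (sigma^t* *m X) = (\tr (sigma *m X^t*))^*.
    by rewrite -mxtrace_trmxC trmxC_mul trmxCK mxtrace_mulC.
  rewrite !sigmaE (positive_map_trmxC E_psd) rmorphM fmorphV /= rmorph_nat.
  by rewrite mxtrace_trmxC conjCK.
move=> v v0; rewrite -mxtrace_rank1 sigmaE.
have pX := psdmx_trmxC_mulmx v; have pEX := E_psd _ pX.
rewrite divr_gt0 ?ltr0n // lt_def psdmx_tr_ge0 // andbT; apply: contra v0 => /eqP trEX.
have EX0 : E (v^t* *m v) = 0 by apply: psdmx_trR_eq0; rewrite // /trR trEX raddf0.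
by apply/eqP/trmxC_mul_eq0/E_faithful.
Qed.

End Decoherence.

(** * The complex numbers *)
Section ComplexNumbers.
Variable R : realType.

Definition complex_complexification : complexification R :=
  @Complexification R R[i] (real_complex R) (@complex.Re R) (fun=> erefl) (@complexRe R).
Local Notation C := complex_complexification.

Lemma mfunE k f (A : 'M[R[i]]_k) : Defs.mfun f A = mxfun (C := C) f A.
Proof. by rewrite mxfun.unlock. Qed.

Lemma mpowE k s (A : 'M[R[i]]_k) : mpow s A = mxpow (C := C) s A.
Proof. exact: mfunE. Qed.

Lemma mlogE k (A : 'M[R[i]]_k) : mlog A = mxlog (C := C) A.
Proof. exact: mfunE. Qed.

Lemma GammasE k (sigma : 'M[R[i]]_k) s X : Gammas sigma s X = Gamma (C := C) sigma s X.
Proof. by rewrite /Gammas mpowE. Qed.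

Lemma wnorm_invE k : @wnorm_inv R k = @weighted_norm R C k.
Proof.
apply/funext => sigma; apply/funext => th; apply/funext => X.
by rewrite /wnorm_inv GammasE /schatten_inv /mabs !mpowE.
Qed.

Lemma amalgE k (N : set 'M[R[i]]_k) sigma a b X :
  amalg N sigma a b X = amalgamated_norm (C := C) sigma N a b X.
Proof. by rewrite /amalg /amalg_inf /amalg_sup wnorm_invE. Qed.

Lemma Ent_qE k E (sigma : 'M[R[i]]_k) q Y :
  Ent_q E sigma q Y = relative_entropy (C := C) sigma E q Y.
Proof. by rewrite /Ent_q GammasE !mpowE !mlogE. Qed.

Lemma norm_complex_le (z : R[i]) : complex.Re `|z| <= `|complex.Re z| + `|complex.Im z|.
Proof.
rewrite normc_def /= -ler_sqr ?nnegrE ?sqrtr_ge0 ?addr_ge0 // sqr_sqrtr; last first.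
  by rewrite addr_ge0 ?sqr_ge0.
by rewrite sqrrD !real_normK ?num_real // lerD2r lerDl mulrn_wge0 //.
Qed.

Lemma near_normmx_le (T : Type) (F : set_system T) {FF : Filter F} m k
    (A : T -> 'M[R[i]]_(m, k)) (d : T -> R) :
  (forall i j, \forall t \near F,
     `|complex.Re (A t i j)| <= d t /\ `|complex.Im (A t i j)| <= d t) ->
  \forall t \near F, normmx (C := C) (A t) <= (m * k)%:R * (2 * d t).
Proof.
move=> Ad; have : \forall t \near F, forall ij : 'I_m * 'I_k,
    `|complex.Re (A t ij.1 ij.2)| <= d t /\ `|complex.Im (A t ij.1 ij.2)| <= d t.
  by apply: filter_forall => ij; exact: Ad.
apply: filterS => t At; apply: normmx_le => i j.
apply: le_trans (norm_complex_le _) _; have [] := At (i, j).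
by rewrite mulr2n mulrDl mul1r; exact: lerD.
Qed.

Lemma is_uderive_entries k (Y : R -> 'M[R[i]]_k) (Y1 : 'M[R[i]]_k) :
  (forall i j,
     is_derive (0 : R) (1 : R) (fun t => complex.Re (Y t i j)) (complex.Re (Y1 i j)) /\
     is_derive (0 : R) (1 : R) (fun t => complex.Im (Y t i j)) (complex.Im (Y1 i j))) ->
  is_uderive (C := C) [set: unit] (fun t _ => Y t) (fun=> Y1).
Proof.
move=> dY; split; [by exists (normmx (C := C) (Y 0))|by exists (normmx (C := C) Y1)|].
move=> e e0; pose K : R := (k * k)%:R * 2; have K1 : 0 < K + 1 by rewrite ltr_wpDl // mulr_ge0.
have eK : 0 < e / (K + 1) by rewrite divr_gt0.
apply: filterS (near_normmx_le (F := nbhs (0 : R)) (A := fun t => Y t - Y 0 - t%:C%C *: Y1)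
  (d := fun t => e / (K + 1) * `|t|) _) => [t norm_le _ _|i j].
  rewrite ger0_norm ?normmx_ge0 // (le_trans norm_le) //.
  rewrite !mulrA ler_wpM2r // -/K ler_pdivrMr // mulrC ler_wpM2l ?(ltW e0) //.
  by rewrite lerDl.
have [/is_derive0P dRe /is_derive0P dIm] := dY i j.
apply: filterS2 (dRe _ eK) (dIm _ eK) => t /(_ tt Logic.I) Re_le /(_ tt Logic.I) Im_le.
rewrite !mxE; case: (Y t i j) (Y 0 i j) (Y1 i j) Re_le Im_le => [? ?] [? ?] [? ?] /=.
by rewrite !mul0r subr0 addr0.
Qed.

Lemma C2_near_is_derive e (f : R -> R) : 0 < e -> C2_near e f ->
  is_derive (0 : R) (1 : R) f (f^`() 0).
Proof.
move=> e0 /(_ 0); rewrite normr0 => /(_ e0)[df _ _].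
by rewrite derive1E; exact/derivableP.
Qed.

Lemma mderiv0_is_uderive k (Y : R -> 'M[R[i]]_k) e : 0 < e ->
  (forall i j, C2_near e (fun t => complex.Re (Y t i j)) /\
               C2_near e (fun t => complex.Im (Y t i j))) ->
  is_uderive (C := C) [set: unit] (fun t _ => Y t) (fun=> mderiv0 Y).
Proof.
move=> e0 CY; apply: is_uderive_entries => i j; rewrite [mderiv0 Y i j]mxE /=.
by have [CRe CIm] := CY i j; split; exact: C2_near_is_derive e0 _.
Qed.

Lemma decohering_condexp k (P : R -> 'M[R[i]]_k -> 'M[R[i]]_k)
    (E : {linear 'M[R[i]]_k -> 'M[R[i]]_k}) sigma :
  is_QMS P -> decohering P -> is_dfa_cond_exp P E -> is_sigma_Tr E sigma ->
  condexp (C := C) (dfa P) E sigma.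
Proof.
move=> [_ [P1 _]] [rho [rho_pd tr_rho invariant]] [_ [E_dfa [E_id [E_cp [E_bimod decay]]]]] sigmaE.
have k0 : (0 < k)%N.
  rewrite lt0n; apply/negP => /eqP k0; move: tr_rho; rewrite /mxtrace big1 => [/eqP|i].
    by rewrite eq_sym oner_eq0.
  by have := ltn_ord i; rewrite {2}k0.
have E_psd (X : 'M[C]_k) : psdmx X -> psdmx (E X : 'M[C]_k).
  by move=> /psdmx_mxblock1 pX; apply/psdmx_mxblock1; exact: (E_cp 1%N (fun _ _ => X)).
have E_faithful (X : 'M[C]_k) : psdmx X -> E X = 0 -> X = 0.
  move=> pX EX0; apply: (@pdmx_faithful R C k rho X rho_pd pX); apply: (@trR_decay_eq0 R C k P).
    by move=> t t0; rewrite /trR invariant.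
  pose K : R := (k * k)%:R * 2; have K1 : 0 < K + 1 by rewrite ltr_wpDl // mulr_ge0.
  apply/cvgrPdist_le => e e0; have eK : 0 < e / (K + 1) by rewrite divr_gt0.
  apply: filterS (near_normmx_le (F := +oo) (A := fun t => P t X)
    (d := fun=> e / (K + 1)) _) => [t norm_le|i j].
    rewrite sub0r normrN ger0_norm ?normmx_ge0 // (le_trans norm_le) //.
    by rewrite !mulrA -/K ler_pdivrMr // mulrC ler_wpM2l ?(ltW e0) // lerDl.
  have := decay X i j; rewrite EX0 subr0 => -[/cvgr0Pnorm_le Re0 /cvgr0Pnorm_le Im0].
  by apply: filterS2 (Re0 _ eK) (Im0 _ eK).
have adj1 : adjmx (1%:M : 'M[R[i]]_k) = 1%:M by exact: (trmxC1 C).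
have dfa1 : dfa P 1%:M by move=> t t0; rewrite adj1 mulmx1 P1 // adj1 mulmx1.
have sigma_pd := faithful_density_pd k0 E_psd E_faithful sigmaE.
exact: (@CondExp R C k (dfa P) E sigma k0 E_dfa E_id E_bimod E_psd dfa1 sigmaE sigma_pd).
Qed.

End ComplexNumbers.

Theorem theorem3p4 (R : realType) (n : nat)
  (P : R -> 'M[R[i]]_n -> 'M[R[i]]_n)
  (E : 'M[R[i]]_n -> 'M[R[i]]_n) (sigma : 'M[R[i]]_n)
  (p : R -> R) (q : R) (Y : R -> 'M[R[i]]_n) (e : R) :
  is_QMS P -> decohering P ->
  is_dfa_cond_exp P E -> is_sigma_Tr E sigma ->
  0 < e ->
  C2_near e p ->
  (forall s t, `|s| < e -> `|t| < e -> s < t -> p s < p t) ->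
  p 0 = q -> 1 <= q ->
  (forall i j, C2_near e (fun t => complex.Re (Y t i j)) /\
               C2_near e (fun t => complex.Im (Y t i j))) ->
  (forall t, `|t| < e -> mxpd (Y t)) ->
  is_derive (0 : R) (1 : R)
    (fun t => amalg (dfa P) sigma q (p t) (Y t))
    ((derive1 p 0 * Ent_q E sigma q (Y 0)
      + q * retr (mpow (q - 1) (Gammas sigma (q^-1) (Y 0))
                  *m Gammas sigma (q^-1) (mderiv0 Y)))
     / (q * (wnorm_inv sigma (q^-1) (Y 0)) `^ (q - 1))).
Proof.
move=> qms decoh dfaE sigmaE e0 Cp p_incr <- q1 CY pY.
pose E_linear : {linear 'M[R[i]]_n -> 'M[R[i]]_n} :=
  HB.pack E (GRing.isLinear.Build _ _ _ _ E dfaE.1).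
have ce := @decohering_condexp R n P E_linear sigma qms decoh dfaE sigmaE.
have near_e : \forall t \near (0 : R), `|t| < e by exact: (@nbhs0_lt R R^o).
have p_near : \forall t \near (0 : R), (t < 0 -> p t < p 0) /\ (0 < t -> p 0 < p t).
  by apply: filterS near_e => t te; split; apply: p_incr; rewrite ?normr0.
have pY_near : \forall t \near (0 : R), mxpd (Y t) by apply: filterS near_e; exact: pY.
have dY := mderiv0_is_uderive e0 CY; have dp := C2_near_is_derive e0 Cp.
have p0 : 0 < p 0 := lt_le_trans ltr01 q1.
under eq_fun do rewrite amalgE.
rewrite Ent_qE wnorm_invE mpowE !GammasE.
exact: (@is_derive_amalgamated_norm R _ n _ _ _ ce p _ Y _ dp p0 p_near pY_near dY).
Qed.
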